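(* There is a power series $\lambda$ in the maximal ideal $(X,Y)$ of $\mathbb{Z}/2[[X,Y]]$ such that $T_5^2$, in its action on $W5$, is multiplication by $\lambda^2$, i.e. $T_5^2=\lambda(T_7,T_{13})^2$ on $W5$.
   Context: For an odd prime $p$, $T_p:\mathbb{Z}/2[[x]]\to\mathbb{Z}/2[[x]]$ is the map $\sum c_nx^n\mapsto\sum c_{pn}x^n+\sum c_nx^{pn}$. Let $D=\sum_{n>0,\ \gcd(n,6)=1}x^{n^2}$; let $W1$, $W5$ be the $\mathbb{Z}/2$-spans of the $D^k$ with $k>0$ and $k\equiv1\pmod6$, resp. $k\equiv5\pmod 6$. $T_5$ maps $W5$ into $W1$ and $W1$ into $W5$, so $T_5^2$ stabilizes $W5$. $T_7$ and $T_{13}$ map each $D^{6m+5}$ to a sum of $D^{6r+5}$ with $r<m$, so $W5$ is a $\mathbb{Z}/2[[X,Y]]$-module with $X$ acting as $T_7$ and $Y$ as $T_{13}$. *)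

(* Defs.v *)
From HB Require Import structures.
From mathcomp Require Import all_boot all_order all_algebra.
From mathcomp Require Import boolp.

Set Implicit Arguments.
Unset Strict Implicit.
Unset Printing Implicit Defensive.

Import GRing.Theory.
Local Open Scope ring_scope.

(* pser R is R[[x]]; the coercion gives f n, the coefficient of x^n in f. *)
Record pser (R : Type) := Pser { coefps :> nat -> R }.

Lemma pserP (R : Type) (f g : pser R) : (forall n, f n = g n) -> f = g.
Proof. by case: f g => [f] [g] /= fg; congr Pser; apply/funext. Qed.

HB.instance Definition _ (R : Type) := gen_eqMixin (pser R).
HB.instance Definition _ (R : Type) := gen_choiceMixin (pser R).

Section PserZmod.
Variable R : zmodType.
Implicit Types f g h : pser R.

Definition ps_zero : pser R := Pser (fun=> 0).
Definition ps_add f g : pser R := Pser (fun n => f n + g n).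
Definition ps_opp f : pser R := Pser (fun n => - f n).

Lemma ps_addA : associative ps_add.
Proof. by move=> f g h; apply: pserP => n /=; rewrite addrA. Qed.
Lemma ps_addC : commutative ps_add.
Proof. by move=> f g; apply: pserP => n /=; rewrite addrC. Qed.
Lemma ps_add0 : left_id ps_zero ps_add.
Proof. by move=> f; apply: pserP => n /=; rewrite add0r. Qed.
Lemma ps_addN : left_inverse ps_zero ps_opp ps_add.
Proof. by move=> f; apply: pserP => n /=; rewrite addNr. Qed.

HB.instance Definition _ :=
  GRing.isZmodule.Build (pser R) ps_addA ps_addC ps_add0 ps_addN.

End PserZmod.

Section PserRing.
Variable R : comNzRingType.
Implicit Types f g h : pser R.

Definition ps_const (c : R) : pser R := Pser (fun n => if n == 0%N then c else 0).
Definition ps_var : pser R := Pser (fun n => (n == 1%N)%:R).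
Definition ps_mul f g : pser R :=
  Pser (fun n => \sum_(i < n.+1) f i * g (n - i)%N).
Definition ps_scale (c : R) f : pser R := Pser (fun n => c * f n).

Let trunc m f : {poly R} := \poly_(i < m.+1) f i.

Let truncE m f n : (n <= m)%N -> (trunc m f)`_n = f n.
Proof. by move=> nm; rewrite coef_poly ltnS nm. Qed.

Let ps_mulE m f g n : (n <= m)%N -> ps_mul f g n = (trunc m f * trunc m g)`_n.
Proof.
move=> nm; rewrite coefM; apply: eq_bigr => i _.
rewrite !truncE ?(leq_trans (leq_subr _ _)) //.
by rewrite (leq_trans _ nm) // -ltnS.
Qed.

Lemma ps_mulC : commutative ps_mul.
Proof.
by move=> f g; apply: pserP => n; rewrite !(@ps_mulE n) // mulrC.
Qed.

Lemma ps_mulA : associative ps_mul.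
Proof.
move=> f g h; apply: pserP => n.
transitivity ((trunc n f * (trunc n g * trunc n h))`_n).
  rewrite coefM; apply: eq_bigr => i _.
  have le_in : (i <= n)%N by rewrite -ltnS.
  by rewrite (truncE f le_in) (ps_mulE g h (leq_subr i n)).
rewrite mulrA coefM; apply: eq_bigr => i _.
have le_in : (i <= n)%N by rewrite -ltnS.
by rewrite (truncE h (leq_subr i n)) (ps_mulE f g le_in).
Qed.

Lemma ps_mul1 : left_id (ps_const 1) ps_mul.
Proof.
move=> f; apply: pserP => n /=.
by rewrite big_ord_recl /= mul1r subn0 big1 ?addr0 // => i _; rewrite mul0r.
Qed.

Lemma ps_mulDl : left_distributive ps_mul +%R.
Proof.
move=> f g h; apply: pserP => n /=; rewrite -big_split.
by apply: eq_bigr => i _; rewrite mulrDl.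
Qed.

Lemma ps_oner_neq0 : ps_const 1 != 0.
Proof.
by apply/eqP => /(congr1 (fun f : pser R => f 0%N)) /= /eqP; rewrite oner_eq0.
Qed.

HB.instance Definition _ := GRing.Zmodule_isComNzRing.Build (pser R)
  ps_mulA ps_mulC ps_mul1 ps_mulDl ps_oner_neq0.

Lemma ps_scaleA a b f : ps_scale a (ps_scale b f) = ps_scale (a * b) f.
Proof. by apply: pserP => n /=; rewrite mulrA. Qed.
Lemma ps_scale1 : left_id 1 ps_scale.
Proof. by move=> f; apply: pserP => n /=; rewrite mul1r. Qed.
Lemma ps_scaleDr : right_distributive ps_scale +%R.
Proof. by move=> a f g; apply: pserP => n /=; rewrite mulrDr. Qed.
Lemma ps_scaleDl f : {morph ps_scale^~ f : a b / a + b}.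
Proof. by move=> a b; apply: pserP => n /=; rewrite mulrDl. Qed.

HB.instance Definition _ := GRing.Zmodule_isLmodule.Build R (pser R)
  ps_scaleA ps_scale1 ps_scaleDr ps_scaleDl.

End PserRing.

Definition hecke (p : nat) (f : pser 'F_2) : pser 'F_2 :=
  Pser (fun n => f (p * n)%N + (if (p %| n)%N then f (n %/ p)%N else 0)).

(* The coefficient of x^m counts the n with n^2 = m; such an n is at most m. *)
Definition D : pser 'F_2 :=
  Pser (fun m => \sum_(n < m.+1 | [&& (0 < n)%N, coprime n 6 & (n ^ 2 == m)%N]) 1).

Definition W (r : nat) (f : pser 'F_2) : Prop :=
  exists (s : seq nat) (c : nat -> 'F_2),
    (forall k, k \in s -> (0 < k)%N /\ k = r %[mod 6])
    /\ f = \sum_(k <- s) c k *: D ^+ k.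

(* Z/2[[X,Y]] is encoded as Z/2[[Y]][[X]]: u i j is the coefficient of
   X^i Y^j in u. *)
Notation F2XY := (pser (pser 'F_2)).

Definition varX : F2XY := ps_var (pser 'F_2).
Definition varY : F2XY := ps_const (ps_var 'F_2).

Definition in_maxideal (u : F2XY) : Prop :=
  exists a b : F2XY, u = varX * a + varY * b.

(* g = u . f, where X acts as T_7 and Y as T_13: the sum of all
   u_ij T_7^i T_13^j f.  The existence of N makes this sum finite; on W 5 such
   an N exists since T_7 and T_13 are locally nilpotent there, and g does not
   depend on its choice. *)
Definition is_action (u : F2XY) (f g : pser 'F_2) : Prop :=
  exists N : nat,
    (forall i j : nat, (N <= i)%N || (N <= j)%N ->
       iter i (hecke 7) (iter j (hecke 13) f) = 0)
    /\ g = \sum_(i < N) \sum_(j < N)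
             u i j *: iter i (hecke 7) (iter j (hecke 13) f).

(* Main.v *)
(* Write F for the sum of the x^(n^2), n > 0 odd. The involution on the representations
   m^2 + 3 n^2 given by the cube roots of unity yields F^4 + F(x^3)^4 = F F(x^3), and a
   series with a given lowest term has at most one way of satisfying this equation.
   Since D^3 = F(x^3), rational parametrizations F = z / d(z), F(x^p) = z^p / d(z) give
   the modular equations relating D and D(x^p) for p = 5, 7, 13, and hence recursions in
   k for T_p(D^k).

   Let alpha, beta be the numbers whose binary digits are the base-2 digits of m in even,
   respectively odd, position. The recursion for p = 7 shows that T_7 lowers alpha by 1
   on leading terms, so on W5 an element of its kernel is determined by the coefficients
   of D^(6m+5) with alpha(m) = 0. This kernel contains the theta series D^(1+4^n) of
   Gaussian integers, on which T_13^(2^k) acts by multiplication by elements of norm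
   13^(2^k); a count of dimensions makes T_13 a single Jordan block there, ending in D^5.
   So the common kernel of T_7 and T_13 on W5 is spanned by D^5, whence every operator
   commuting with both is a power series in them, namely the one with the same
   coefficient of D^5. For T_5^2 the grading of exponents modulo 24 leaves only terms of
   even degree in each variable, so the series is a square; it has no constant term
   because T_5^2 kills D^5. *)

Require Import Defs.
From mathcomp Require Import all_boot all_order all_algebra.
From mathcomp Require Import boolp.
From mathcomp Require Import ring zify.

Set Implicit Arguments.
Unset Strict Implicit.
Unset Printing Implicit Defensive.
Import GRing.Theory.

(** * Digit pairs and leading terms *)

(** The obstacle is to bound the common kernel from above without a leading-term analysis of T_13.
    Only T_7 is analysed that way. Its kernel is seen through the coefficients with alpha(m) = 0, of
    which 2^n have m < 4^n, and an explicit T_13-chain inside that kernel is shown to have 2^n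
    members. The length comes out because T_13^(2^k) carries D^(1+4^(k+2)) to D^(1+4^(k+1)): in
    characteristic 2 the operator attached to a prime pi of norm 13 and its conjugate is raised to
    the power 2^k term by term, and the imaginary part of pi^(2^k) is exactly divisible by 2^(k+1).
    The square has two sources. Modulo 24 the residues 7 and 13 are independent of order 2 while 5^2
    = 1, so a monomial can occur only with even degree in each variable. And over the field with two
    elements a series in X^2 and Y^2 is the square of the series in X and Y with the same
    coefficients. *)

Fixpoint alpha_rec (n m : nat) :=
  if n is n'.+1 then odd m + 2 * alpha_rec n' (m %/ 4) else 0.
Fixpoint beta_rec (n m : nat) :=
  if n is n'.+1 then odd (m %/ 2) + 2 * beta_rec n' (m %/ 4) else 0.
(* The binary digits of alpha m and beta m are the digits of m in even,
   respectively odd, position. *)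
Definition alpha m := alpha_rec m m.
Definition beta m := beta_rec m m.

Lemma alpha_rec_stable n m : m <= n -> alpha_rec n m = alpha m.
Proof.
rewrite /alpha; elim/ltn_ind: m n => m IH [|n] mn; first by case: m mn IH.
case: m mn IH => [|m] mn IH.
  by rewrite /= div0n; elim: n {mn} => //= n ->.
rewrite /= IH ?(IH _ _ m) //; lia.
Qed.

Lemma beta_rec_stable n m : m <= n -> beta_rec n m = beta m.
Proof.
rewrite /beta; elim/ltn_ind: m n => m IH [|n] mn; first by case: m mn IH.
case: m mn IH => [|m] mn IH.
  by rewrite /= !div0n; elim: n {mn} => //= n ->.
rewrite /= IH ?(IH _ _ m) //; lia.
Qed.

Lemma alphaE m d : d < 4 -> alpha (4 * m + d) = odd d + 2 * alpha m.
Proof.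
move=> d4; rewrite -(@alpha_rec_stable (4 * m + d).+1) //=.
have -> : (4 * m + d) %/ 4 = m by lia.
rewrite alpha_rec_stable; last by lia.
by congr (_ + _); rewrite oddD oddM.
Qed.

Lemma betaE m d : d < 4 -> beta (4 * m + d) = d %/ 2 + 2 * beta m.
Proof.
move=> d4; rewrite -(@beta_rec_stable (4 * m + d).+1) //=.
have -> : (4 * m + d) %/ 4 = m by lia.
rewrite beta_rec_stable; last by lia.
by congr (_ + _); lia.
Qed.

Lemma base4 m : exists m' d, [/\ m = 4 * m' + d, d < 4 & (m' < m) || (m == 0)].
Proof. by exists (m %/ 4), (m %% 4); split; lia. Qed.

(** Interleaving binary digits is a bijection between pairs of numbers and numbers; [digits_surj] is
    the other half. *)
Lemma digits_inj m n : alpha m = alpha n -> beta m = beta n -> m = n.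
Proof.
have [k] := ubnP (m + n); elim: k m n => // k IH m n.
have [m' [d [-> d4 hm]]] := base4 m; have [n' [e [-> e4 hn]]] := base4 n.
move=> lek; rewrite !alphaE // !betaE // => ha hb.
have ed : d = e by case: d d4 ha hb {hm lek} => [|[|[|[|]]]] //;
  case: e e4 {hn} => [|[|[|[|]]]] //=; lia.
subst e; case: (posnP (m' + n')) => [|pos]; first by lia.
by rewrite (IH m' n') //; lia.
Qed.

Lemma digits_surj a b : exists m, alpha m = a /\ beta m = b.
Proof.
have [k] := ubnP (a + b); elim: k a b => // k IH a b lek.
case: (posnP (a + b)) => [|pos].
  by exists 0; split; rewrite /alpha /beta /=; lia.
have [|m [ma mb]] := IH (a %/ 2) (b %/ 2); first by lia.
exists (4 * m + (a %% 2 + 2 * (b %% 2))); rewrite alphaE ?betaE ?ma ?mb; last 2 first.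
- by lia.
- by lia.
by split; lia.
Qed.

Lemma alpha_split q m i : m < 4 ^ q -> alpha (m + 4 ^ q * i) = alpha m + 2 ^ q * alpha i.
Proof.
elim: q m => [|q IH] m; first by rewrite !mul1n; case: m.
have [m' [d [-> d4 _]]] := base4 m; rewrite expnS => h.
have -> : 4 * m' + d + 4 * 4 ^ q * i = 4 * (m' + 4 ^ q * i) + d by lia.
by rewrite !alphaE // IH ?expnS; lia.
Qed.

Lemma beta_split q m i : m < 4 ^ q -> beta (m + 4 ^ q * i) = beta m + 2 ^ q * beta i.
Proof.
elim: q m => [|q IH] m; first by rewrite !mul1n; case: m.
have [m' [d [-> d4 _]]] := base4 m; rewrite expnS => h.
have -> : 4 * m' + d + 4 * 4 ^ q * i = 4 * (m' + 4 ^ q * i) + d by lia.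
by rewrite !betaE // IH ?expnS; lia.
Qed.

Lemma alpha_bound q m : m < 4 ^ q -> alpha m < 2 ^ q.
Proof.
elim: q m => [|q IH] m; first by case: m.
have [m' [d [-> d4 _]]] := base4 m; rewrite !expnS => h.
by rewrite !alphaE //; have := IH m'; lia.
Qed.

Lemma beta_bound q m : m < 4 ^ q -> beta m < 2 ^ q.
Proof.
elim: q m => [|q IH] m; first by case: m.
have [m' [d [-> d4 _]]] := base4 m; rewrite !expnS => h.
by rewrite !betaE //; have := IH m'; lia.
Qed.

Lemma beta_le m : beta m <= m.
Proof.
elim/ltn_ind: m => m IH; have [m' [d [e d4 /orP [h|/eqP h]]]] := base4 m.
  by rewrite {1}e betaE //; have := IH _ h; lia.
by rewrite h.
Qed.

(** * Weights of exponents *)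

Section Weight.
Variable L : nat.
Hypothesis L_ge : 16 <= L.

(* Comparing weights for L large is comparing (alpha + beta, beta) lexicographically. *)
Definition weight m := alpha m * L + beta m * L.+1.

Lemma weightE m d : d < 4 -> weight (4 * m + d) = 2 * weight m + weight d.
Proof.
move=> d4; rewrite /weight alphaE // betaE //.
have -> : alpha d = odd d by rewrite -[d]/(4 * 0 + d) alphaE // addn0.
have -> : beta d = d %/ 2 by rewrite -[d]/(4 * 0 + d) betaE // addn0.
by lia.
Qed.

Lemma weight_digit : [/\ weight 0 = 0, weight 1 = L, weight 2 = L.+1 & weight 3 = L + L.+1].
Proof. by rewrite /weight /alpha /beta /=; split; lia. Qed.

(** In base-4 addition a carry is worth [2 * L] in the next place, and two digits whose sum passes 3
    lose at least that much. This bounds the weight gained by multiplying with a power of the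
    variable. *)
Lemma weight_sub x y : weight (x + y) <= weight x + weight y.
Proof.
have [k] := ubnP (x + y); elim: k x y => // k IH x y.
case: (posnP x) => [->|x0]; first by [].
case: (posnP y) => [->|y0]; first by rewrite addn0 leq_addr.
have [x' [d [ex d4 hx]]] := base4 x; have [y' [e [ey e4 hy]]] := base4 y.
move=> lek; have [w0 w1 w2 w3] := weight_digit.
have IH1 := IH x' y'; have IH2 := IH (x' + y') 1.
rewrite ex ey (weightE x') // (weightE y') //.
case: (ltnP (d + e) 4) => de.
  have -> : 4 * x' + d + (4 * y' + e) = 4 * (x' + y') + (d + e) by lia.
  rewrite weightE //; have {}IH1 : weight (x' + y') <= weight x' + weight y' by apply: IH1; lia.
  have wde : weight (d + e) <= weight d + weight e.
    case: d d4 de {ex hx} => [|[|[|[|]]]] //; case: e e4 {ey hy} => [|[|[|[|]]]] //= _ _ _;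
    rewrite ?[_ + _]/= ?w0 ?w1 ?w2 ?w3; lia.
  lia.
have -> : 4 * x' + d + (4 * y' + e) = 4 * (x' + y' + 1) + (d + e - 4) by lia.
rewrite weightE; last by lia.
have {}IH1 : weight (x' + y') <= weight x' + weight y' by apply: IH1; lia.
have {}IH2 : weight (x' + y' + 1) <= weight (x' + y') + L.
  by rewrite -w1; apply: IH2; lia.
have wde : 2 * L + weight (d + e - 4) <= weight d + weight e.
  case: d d4 de {ex hx lek} => [|[|[|[|]]]] //; case: e e4 {ey hy} => [|[|[|[|]]]] //= _ _ _;
  rewrite ?subn0 ?[_ - _]/= ?w0 ?w1 ?w2 ?w3; lia.
lia.
Qed.

Lemma weight_split q m i : m < 4 ^ q -> weight (m + 4 ^ q * i) = weight m + 2 ^ q * weight i.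
Proof. by move=> mq; rewrite /weight alpha_split // beta_split //; lia. Qed.

Lemma weight_scale q i : weight (4 ^ q * i) = 2 ^ q * weight i.
Proof. by have := @weight_split q 0 i; rewrite !add0n; apply; rewrite expn_gt0. Qed.

Definition lexle (a b : nat * nat) := (a.1 < b.1) || ((a.1 == b.1) && (a.2 <= b.2)).
Definition lexlt (a b : nat * nat) := (a.1 < b.1) || ((a.1 == b.1) && (a.2 < b.2)).
Definition lex m := (alpha m + beta m, beta m).
Definition lexD (a b : nat * nat) := (a.1 + b.1, a.2 + b.2).

Lemma lexle_weight a b c d : lexle (lexD (lex a) (lex b)) (lexD (lex c) (lex d)) ->
  beta a + beta b < L -> weight a + weight b <= weight c + weight d.
Proof. by rewrite /lexle /lexD /lex /weight /=; nia. Qed.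

Lemma lexlt_weight a b c d : lexlt (lexD (lex a) (lex b)) (lexD (lex c) (lex d)) ->
  beta a + beta b < L -> weight a + weight b < weight c + weight d.
Proof. by rewrite /lexlt /lexD /lex /weight /=; nia. Qed.

(** Since [beta k <= k < L], division of the weight by [L] has remainder [beta k] and quotient
    [alpha k + beta k]. *)
Lemma weight_inj m n : m < L -> n < L -> weight m = weight n -> m = n.
Proof.
have wE k : k < L -> weight k %% L = beta k /\ weight k %/ L = alpha k + beta k.
  move=> kL; have bL : beta k < L by apply: leq_ltn_trans (beta_le k) kL.
  have -> : weight k = (alpha k + beta k) * L + beta k by rewrite /weight; lia.
  by rewrite modnMDl modn_small // divnMDl ?divn_small; lia.
move=> mL nL e; have [m1 m2] := wE m mL; have [n1 n2] := wE n nL.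
by apply: digits_inj; move: m1 m2 n1 n2; rewrite e; lia.
Qed.

End Weight.

Local Open Scope ring_scope.

(* c m e plays the role of the coefficient of t^(6e+5) in T_7(t^(6m+5)). *)
Section Leading.
Variable c : nat -> nat -> 'F_2.
Definition shifted (s m e : nat) : 'F_2 := if (s <= e)%N then c m (e - s) else 0.

Definition lead_table : seq (seq nat) :=
  [:: [::]; [:: 0]; [::]; [:: 2]; [:: 1]; [:: 4; 0]; [:: 3]; [:: 6; 2]]%N.
Hypothesis c_small : forall m e, (m < 8)%N -> c m e = (e \in nth [::] lead_table m)%:R.
(** This is the relation [rel7_cubed] raised to the power [2 ^ j.+1]: its exponents are then
    multiples of 6, so the recursion stays within exponents of the form 6m+5. *)
Hypothesis c_rec : forall j m e,
  c (m + 8 * 2 ^ j) e = shifted (2 * 2 ^ j) (m + 2 * 2 ^ j) e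
    + shifted (2 ^ j) (m + 2 ^ j) e + shifted (8 * 2 ^ j) m e.

(** Taking [j = 2 * q] here and [j = 2 * q + 1] in [c_rec16] makes every shift a multiple of
    [4 ^ q]: only the leading block [i] is rewritten and the low part [m0] is carried along. *)
Lemma c_rec4 q i m0 e : (8 <= i < 16)%N ->
  c (m0 + 4 ^ q * i) e = shifted (4 ^ q * 2) (m0 + 4 ^ q * (i - 6)) e
    + shifted (4 ^ q * 1) (m0 + 4 ^ q * (i - 7)) e
    + shifted (4 ^ q * 8) (m0 + 4 ^ q * (i - 8)) e.
Proof.
move=> hi; have p2 : (2 ^ (2 * q) = 4 ^ q)%N by rewrite expnM.
have := c_rec (2 * q) (m0 + 4 ^ q * (i - 8)) e; rewrite p2.
have -> : (m0 + 4 ^ q * (i - 8) + 8 * 4 ^ q = m0 + 4 ^ q * i)%N by nia.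
have -> : (m0 + 4 ^ q * (i - 8) + 2 * 4 ^ q = m0 + 4 ^ q * (i - 6))%N by nia.
have -> : (m0 + 4 ^ q * (i - 8) + 4 ^ q = m0 + 4 ^ q * (i - 7))%N by nia.
by rewrite muln1 [(2 * _)%N]mulnC [(8 * _)%N]mulnC.
Qed.

Lemma c_rec16 q i m0 e : (16 <= i < 32)%N ->
  c (m0 + 4 ^ q * i) e = shifted (4 ^ q * 4) (m0 + 4 ^ q * (i - 12)) e
    + shifted (4 ^ q * 2) (m0 + 4 ^ q * (i - 14)) e
    + shifted (4 ^ q * 16) (m0 + 4 ^ q * (i - 16)) e.
Proof.
move=> hi; have p2 : (2 ^ (2 * q).+1 = 2 * 4 ^ q)%N by rewrite expnS expnM.
have := c_rec (2 * q).+1 (m0 + 4 ^ q * (i - 16)) e; rewrite p2.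
have -> : (m0 + 4 ^ q * (i - 16) + 8 * (2 * 4 ^ q) = m0 + 4 ^ q * i)%N by nia.
have -> : (m0 + 4 ^ q * (i - 16) + 2 * (2 * 4 ^ q) = m0 + 4 ^ q * (i - 12))%N by nia.
have -> : (m0 + 4 ^ q * (i - 16) + 2 * 4 ^ q = m0 + 4 ^ q * (i - 14))%N by nia.
by rewrite !mulnA [(2 * 4 ^ q)%N]mulnC [(2 * 2 * _)%N]mulnC [(8 * 2 * _)%N]mulnC.
Qed.

(* For a leading digit i, the terms (s, k) of the recursion: multiplication by the
   scaled s-th power of the variable, and the new leading digit k. *)
Definition terms (i : nat) : seq (nat * nat) :=
  if (i < 16)%N then [:: (2, i - 6); (1, i - 7); (8, i - 8)]%N
  else [:: (4, i - 12); (2, i - 14); (16, i - 16)]%N.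

Lemma c_terms q i m0 e : (8 <= i < 32)%N ->
  c (m0 + 4 ^ q * i) e
  = \sum_(x <- terms i) shifted (4 ^ q * x.1) (m0 + 4 ^ q * x.2) e.
Proof.
move=> hi; rewrite /terms; case: ltnP => i16.
  by rewrite !big_cons big_nil addr0 addrA /= c_rec4 //; lia.
by rewrite !big_cons big_nil addr0 addrA /= c_rec16 //; lia.
Qed.

(** The window from 8 to 31 spans a factor of 4, so stripping base-4 digits one at a time cannot
    jump over it. All checks on the recursion thus concern 24 leading blocks. *)
Lemma scale_exists m : (8 <= m)%N -> exists q i m0,
  [/\ m = m0 + 4 ^ q * i, m0 < 4 ^ q & 8 <= i < 32]%N.
Proof.
elim/ltn_ind: m => m IH m8; case: (ltnP m 32) => m32.
  by exists 0%N, m, 0%N; rewrite mul1n; split; lia.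
have [||q [i [m0 [e m0q hi]]]] := IH (m %/ 4)%N; first by lia.
  by lia.
exists q.+1, i, (4 * m0 + m %% 4)%N; rewrite expnS; split=> //; nia.
Qed.

Definition all_terms (P : nat -> nat * nat -> bool) :=
  all (fun i => all (P i) (terms i)) (iota 8 24).

Lemma all_termsP P i x : all_terms P -> (8 <= i < 32)%N -> x \in terms i -> P i x.
Proof.
move=> /allP h hi; have hi' : i \in iota 8 24 by rewrite mem_iota; lia.
exact: (allP (h i hi')).
Qed.

(** Phrased with [lex] instead of [weight], so that one finite computation serves every [L] that is
    at least 16. *)
Lemma terms_small : all_terms (fun i x => (x.2 < i) && (beta x.1 + beta x.2 < 16)
  && (beta i < 16) && lexle (lexD (lex x.1) (lex x.2)) (lexD (lex i) (lex 0)))%N.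
Proof. by vm_compute. Qed.

(** T_7 lowers weights by at least [L]. In the induction a term (s, k) adds at most the weight of s
    by subadditivity, and [terms_small] says that s and k together weigh no more than the block
    [i]. *)
Lemma lead_weight L m e : (16 <= L)%N -> c m e != 0 ->
  (weight L e + L <= weight L m)%N.
Proof.
move=> L16; elim/ltn_ind: m e => m IH e.
case: (ltnP m 8) => m8.
  rewrite c_small //; case: (boolP (e \in _)) => // he _.
  have h : all (fun m => all (fun e => lexle (lexD (lex e) (lex 1))
     (lexD (lex m) (lex 0)) && (beta e + beta 1 < 16))%N (nth [::] lead_table m)) (iota 0 8).
    by vm_compute.
  have mi : m \in iota 0 8 by rewrite mem_iota.
  have /andP [h1 h2] := allP (allP h m mi) e he.
  have := lexle_weight L16 h1 (leq_trans h2 L16).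
  by have [-> -> _ _] := weight_digit L16; rewrite addn0.
have [q [i [m0 [mE m0q hi]]]] := scale_exists m8; subst m.
rewrite c_terms // => nz.
have [x xi] : exists2 x, x \in terms i & shifted (4 ^ q * x.1) (m0 + 4 ^ q * x.2) e != 0.
  have [/hasP [x xi hx]|none] := boolP (has (fun x => shifted (4 ^ q * x.1) (m0 + 4 ^ q * x.2) e != 0) (terms i)).
    by exists x.
  case/negP: nz; rewrite big_seq big1 // => x xi; apply/eqP; apply: contraTT none => h.
  by rewrite negbK; apply/hasP; exists x.
have /andP [/andP [/andP [lti b1] b2] lx] := all_termsP terms_small hi xi.
rewrite /shifted; case: leqP => [se|]; last by rewrite eqxx.
have lt1 : (m0 + 4 ^ q * x.2 < m0 + 4 ^ q * i)%N by rewrite ltn_add2l ltn_pmul2l ?expn_gt0.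
move=> /(IH _ lt1); rewrite !weight_split // => h.
have := weight_sub L16 (e - 4 ^ q * x.1) (4 ^ q * x.1); rewrite subnK // weight_scale // => h2.
have := lexle_weight L16 lx (leq_trans b1 L16); have [-> _ _ _] := weight_digit L16; rewrite addn0.
rewrite -(leq_pmul2l (expn_gt0 2 q : (0 < 2 ^ q)%N)) mulnDr; move: h h2; case: (x) => s k /=; lia.
Qed.

(* The index with digits (alpha i - 1, beta i), for i < 32. *)
Definition pred_index (i : nat) : nat :=
  find (fun k => (alpha k + 1 == alpha i) && (beta k == beta i))%N (iota 0 32).

(* Whether a term of the recursion contributes the leading coefficient: in case A
   the low part of the index absorbs the decrement of alpha, in case B the borrow
   reaches the digit i. *)
Definition hitA i (x : nat * nat) := (i - x.1 == x.2)%N.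
Definition missA i (x : nat * nat) :=
  lexlt (lexD (lex x.2) (lex 0)) (lexD (lex (i - x.1)) (lex 0)).
Definition hitB i (x : nat * nat) :=
  let k := pred_index i in
  [&& x.1 <= k, alpha (k - x.1) + 1 == alpha x.2 & beta (k - x.1) == beta x.2]%N.
Definition missB i (x : nat * nat) :=
  let k := pred_index i in
  (k < x.1)%N || lexlt (lexD (lex x.2) (lex 0)) (lexD (lex (k - x.1)) (lex 1)).

Lemma terms_A : all_terms (fun i x => [&& x.1 <= i, hitA i x || missA i x & beta x.2 < 16])%N.
Proof. by vm_compute. Qed.
Lemma terms_B : all_terms (fun i x => (alpha i == 0) || (hitB i x || missB i x))%N.
Proof. by vm_compute. Qed.

(** An odd number of contributions equal to 1 makes the leading coefficient 1. *)
Lemma parity_A : all (fun i => odd (count (hitA i) (terms i))) (iota 8 24).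
Proof. by vm_compute. Qed.
Lemma parity_B : all (fun i => (alpha i == 0) || [&& odd (count (hitB i) (terms i)),
  alpha (pred_index i) + 1 == alpha i & beta (pred_index i) == beta i])%N (iota 8 24).
Proof. by vm_compute. Qed.

Lemma sum_bool (T : Type) (s : seq T) (P : pred T) :
  \sum_(x <- s) (P x)%:R = (odd (count P s))%:R :> 'F_2.
Proof.
elim: s => [|x s IH]; first by rewrite big_nil.
rewrite big_cons IH /= oddD oddb.
by case: (P x); case: (odd _); apply: val_inj.
Qed.

(** A term of the recursion either aims at the exponent with alpha lowered by 1, and contributes 1
    by induction, or is too light to reach it by [lead_weight]. The parity checks count the
    former. *)
Lemma lead_coef_one m e : (alpha e + 1 = alpha m)%N -> beta e = beta m -> c m e = 1.
Proof.
elim/ltn_ind: m e => m IH e.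
case: (ltnP m 8) => m8.
  have h : all (fun m => (alpha m == 0) || has (fun e => (alpha e + 1 == alpha m)
     && (beta e == beta m)) (nth [::] lead_table m))%N (iota 0 8) by vm_compute.
  have mi : m \in iota 0 8 by rewrite mem_iota.
  have /orP [/eqP -> |/hasP [k ki /andP [/eqP a1 /eqP b1]] a2 b2] := allP h m mi.
    by rewrite addn1.
  have -> : e = k by apply: digits_inj; rewrite ?b1 //; lia.
  by rewrite c_small // ki.
have [q [i [m0 [mE m0q hi]]]] := scale_exists m8; subst m.
have [e0 [k [eE e0q]]] : exists e0 k, (e = e0 + 4 ^ q * k /\ e0 < 4 ^ q)%N.
  exists (e %% 4 ^ q)%N, (e %/ 4 ^ q)%N; rewrite ltn_mod expn_gt0; split => //.
  by rewrite {1}(divn_eq e (4 ^ q)); lia.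
subst e; rewrite !alpha_split // !beta_split // => ea eb.
have i_in : i \in iota 8 24 by rewrite mem_iota; lia.
have be0 := beta_bound e0q; have bm0 := beta_bound m0q.
have ae0 := alpha_bound e0q; have am0 := alpha_bound m0q.
have eb2 : beta k = beta i by nia.
have eb0 : beta e0 = beta m0 by nia.
pose L := (16 + m0 + 4 ^ q * i)%N.
have L16 : (16 <= L)%N by rewrite /L; lia.
have zero m' e' : (weight L m' < weight L e' + L)%N -> c m' e' = 0.
  by move=> h; apply/eqP; apply: contraTT h => /(lead_weight L16); rewrite -leqNgt.
rewrite c_terms // big_seq.
(* If alpha of the low part is 0, lowering alpha borrows from the block [i] and fills the low part,
   so [alpha e0] is [2 ^ q - 1]; otherwise the block is unchanged. *)
case: (posnP (alpha m0)) => [am|am].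
  have ek : (alpha k + 1 = alpha i)%N by nia.
  have eae0 : (alpha e0 = 2 ^ q - 1)%N by nia.
  have := allP parity_B i i_in; rewrite [alpha i == 0%N]gtn_eqF /=; last by lia.
  move=> /and3P [par /eqP pa /eqP pb].
  have kE : pred_index i = k by apply: digits_inj; lia.
  rewrite (eq_bigr (fun x => (hitB i x)%:R)) => [|x xi].
    by rewrite -big_seq sum_bool par.
  have /andP [/andP [/andP [lti _] _] _] := all_termsP terms_small hi xi.
  have := all_termsP terms_B hi xi; rewrite gtn_eqF /=; last by lia.
  have /and3P [_ _ b2] := all_termsP terms_A hi xi.
  case: (boolP (hitB i x)) => [/and3P [le1 /eqP a1 /eqP b1] _|_ /=].
    rewrite kE in le1 a1 b1.
    rewrite /shifted ifT; last by nia.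
    have -> : (e0 + 4 ^ q * k - 4 ^ q * x.1 = e0 + 4 ^ q * (k - x.1))%N by nia.
    apply: IH.
    - by rewrite ltn_add2l ltn_pmul2l ?expn_gt0.
    - by rewrite !alpha_split //; nia.
    - by rewrite !beta_split //; nia.
  rewrite /missB kE => /orP [lt1|lx]; rewrite /shifted.
    by rewrite ifF //; apply/negbTE; rewrite -ltnNge; nia.
  case: ifP => // le1.
  case: (leqP x.1 k) => le2; last first.
    by move: le1; rewrite leqNgt => /negP []; nia.
  have -> : (e0 + 4 ^ q * k - 4 ^ q * x.1 = e0 + 4 ^ q * (k - x.1))%N by nia.
  apply: zero; rewrite !weight_split //.
  have := lexlt_weight L16 lx; have [-> -> _ _] := weight_digit L16.
  have -> : beta 0 = 0%N by [].
  rewrite addn0 addn0 => /(_ (leq_trans b2 L16)) h.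
  have -> : (weight L e0 = weight L m0 + (2 ^ q - 1) * L)%N.
    by rewrite /weight eae0 eb0 am; lia.
  have : (2 ^ q > 0)%N by rewrite expn_gt0.
  by nia.
have eai : alpha k = alpha i by nia.
have eae0 : (alpha e0 + 1 = alpha m0)%N by nia.
have kE : k = i by apply: digits_inj.
subst k.
have par := allP parity_A i i_in.
rewrite (eq_bigr (fun x => (hitA i x)%:R)) => [|x xi].
  by rewrite -big_seq sum_bool par.
have /andP [/andP [/andP [lti _] _] _] := all_termsP terms_small hi xi.
have /and3P [le1 hm b2] := all_termsP terms_A hi xi.
rewrite /shifted ifT; last by nia.
have -> : (e0 + 4 ^ q * i - 4 ^ q * x.1 = e0 + 4 ^ q * (i - x.1))%N by nia.
move: hm; case: (boolP (hitA i x)) => [/eqP -> _|_ /= lx].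
  apply: IH.
  - by rewrite ltn_add2l ltn_pmul2l ?expn_gt0.
  - by rewrite !alpha_split //; nia.
  - by rewrite !beta_split //; nia.
apply: zero; rewrite !weight_split //.
have := lexlt_weight L16 lx; have [-> _ _ _] := weight_digit L16.
have -> : beta 0 = 0%N by [].
rewrite !addn0 => /(_ (leq_trans b2 L16)) h.
have -> : (weight L e0 + 2 ^ q * weight L (i - x.1) + L
   = weight L m0 + 2 ^ q * weight L (i - x.1))%N.
  by rewrite /weight eb0 -eae0; lia.
by rewrite ltn_add2l ltn_pmul2l ?expn_gt0.
Qed.

End Leading.

(** * Power series over the field with two elements *)

Lemma F2_cases (c : 'F_2) : c = 0 \/ c = 1.
Proof. by case: c => [[|[|]]] // ?; [left|right]; apply: val_inj. Qed.

Lemma F2_addxx (c : 'F_2) : c + c = 0.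
Proof. by case: (F2_cases c) => ->; apply: val_inj. Qed.

Lemma F2_sqr (c : 'F_2) : c * c = c.
Proof. by case: (F2_cases c) => ->; apply: val_inj. Qed.

Section Char2.
Variable R : zmodType.
Hypothesis addxx : forall c : R, c + c = 0.

Lemma ps_addxx (f : pser R) : f + f = 0.
Proof. by apply: pserP => n; exact: addxx. Qed.

End Char2.

Section CoefMorph.
Variable R : comNzRingType.
Implicit Types f g : pser R.

Lemma coefpsD f g n : (f + g) n = f n + g n. Proof. by []. Qed.
Lemma coefps0 n : (0 : pser R) n = 0. Proof. by []. Qed.
Lemma coefpsM f g n : (f * g) n = \sum_(i < n.+1) f i * g (n - i)%N.
Proof. by []. Qed.
Lemma coefpsZ c f n : (c *: f) n = c * f n. Proof. by []. Qed.
Lemma coefps1 n : (1 : pser R) n = (n == 0%N)%:R.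
Proof. by rewrite /GRing.one /=; case: ifP. Qed.
Lemma coefps_sum (I : Type) (s : seq I) (P : pred I) (F : I -> pser R) n :
  (\sum_(i <- s | P i) F i) n = \sum_(i <- s | P i) F i n.
Proof. by elim/big_rec2: _ => // i y1 y2 _ <-. Qed.

Lemma ps_scaleAl c f g : c *: (f * g) = (c *: f) * g.
Proof.
apply: pserP => n; rewrite coefpsZ !coefpsM mulr_sumr.
by apply: eq_bigr => i _; rewrite coefpsZ mulrA.
Qed.

Lemma ps_constM c f : ps_const c * f = c *: f.
Proof.
apply: pserP => n; rewrite coefpsM big_ord_recl /= subn0 big1 ?addr0 //.
by move=> i _; rewrite mul0r.
Qed.

Lemma coefps_varM f n : (ps_var R * f) n = if n is m.+1 then f m else 0.
Proof.
rewrite coefpsM; case: n => [|n]; first by rewrite big_ord1 /= mul0r.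
rewrite big_ord_recl big_ord_recl /= mul0r mul1r add0r subSS subn0 big1 ?addr0 //.
by move=> i _; rewrite mul0r.
Qed.

End CoefMorph.

Notation F2ps := (pser 'F_2).

Opaque ps_mul ps_add ps_opp ps_const ps_var.

Lemma F2ps_addxx (f : F2ps) : f + f = 0.
Proof. exact: ps_addxx F2_addxx f. Qed.

Lemma F2ps_addK (f g : F2ps) : f + g + g = f.
Proof. by rewrite -addrA F2ps_addxx addr0. Qed.

Lemma F2ps_add_eq0 (f g : F2ps) : f + g = 0 -> f = g.
Proof. by move=> h; rewrite -[f](F2ps_addK f g) h add0r. Qed.

Definition has_order (f : F2ps) (k : nat) :=
  f k = 1 /\ forall i, (i < k)%N -> f i = 0.

Lemma has_order_ex (f : F2ps) : f <> 0 -> exists k, has_order f k.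
Proof.
move=> f0; have ex : exists k, f k != 0.
  apply: contrapT => h; apply: f0; apply: pserP => n.
  by apply/eqP; apply: contrapT => /negP hn; apply: h; exists n.
exists (ex_minn ex); case: ex_minnP => k fk kmin; split.
  by case: (F2_cases (f k)) fk => ->.
move=> i ik; apply/eqP; apply: contraTT ik => fi.
by rewrite -leqNgt; apply: kmin.
Qed.

Lemma coefps_low (f g : F2ps) a b n :
  (forall i, (i < a)%N -> f i = 0) -> (forall i, (i < b)%N -> g i = 0) ->
  (n < a + b)%N -> (f * g) n = 0.
Proof.
move=> fa gb nab; rewrite coefpsM big1 // => i _.
case: (ltnP i a) => ia; first by rewrite fa // mul0r.
by rewrite gb ?mulr0 //; have := ltn_ord i; lia.
Qed.

Lemma has_orderM (f g : F2ps) a b :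
  has_order f a -> has_order g b -> has_order (f * g) (a + b).
Proof.
move=> [fa fl] [gb gl]; split; last by move=> i; apply: coefps_low.
have lab : (a < (a + b).+1)%N by lia.
rewrite coefpsM (bigD1 (Ordinal lab)) //= addKn fa gb mul1r big1 ?addr0 //.
move=> i /eqP ne; case: (ltngtP i a) => ia.
- by rewrite fl // mul0r.
- by rewrite (gl (a + b - i)%N) ?mulr0 //; have := ltn_ord i; lia.
- by case: ne; apply: val_inj.
Qed.

Lemma has_order_neq0 (f : F2ps) a : has_order f a -> f <> 0.
Proof. by move=> [fa _] f0; move: fa; rewrite f0 => /eqP. Qed.

Lemma has_order_inj (f : F2ps) a b : has_order f a -> has_order f b -> a = b.
Proof.
move=> [fa la] [fb lb]; case: (ltngtP a b) => // h.
- by move: fa; rewrite lb // => /eqP.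
- by move: fb; rewrite la // => /eqP.
Qed.

Lemma has_order1 : has_order 1 0.
Proof. by split => //; rewrite coefps1. Qed.

Lemma has_orderX (f : F2ps) a n : has_order f a -> has_order (f ^+ n) (a * n).
Proof.
move=> fa; elim: n => [|n IH]; first by rewrite muln0; exact: has_order1.
by rewrite mulnS exprS; apply: has_orderM.
Qed.

Lemma has_orderD (f g : F2ps) a :
  has_order f a -> (forall i, (i <= a)%N -> g i = 0) -> has_order (f + g) a.
Proof.
move=> [fa fl] gl; split; first by rewrite coefpsD fa gl ?addr0.
by move=> i ia; rewrite coefpsD fl // gl ?addr0 // ltnW.
Qed.

Lemma F2ps_mulf_eq0 (f g : F2ps) : f * g = 0 -> f = 0 \/ g = 0.
Proof.
move=> fg; case: (pselect (f = 0)); first by left.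
move=> /has_order_ex [a fa]; right; apply: contrapT => /has_order_ex [b gb].
exact: has_order_neq0 (has_orderM fa gb) fg.
Qed.

Lemma F2ps_mulI (f g h : F2ps) : f <> 0 -> f * g = f * h -> g = h.
Proof.
move=> f0 e; have : f * (g + h) = 0 by rewrite mulrDr e F2ps_addxx.
by case/F2ps_mulf_eq0 => // /F2ps_add_eq0.
Qed.

Lemma F2ps_sqrD (f g : F2ps) : (f + g) ^+ 2 = f ^+ 2 + g ^+ 2.
Proof. by rewrite sqrrD mulr2n F2ps_addxx addr0. Qed.

Lemma F2ps_exprD (f g : F2ps) q :
  (f + g) ^+ (2 ^ q) = f ^+ (2 ^ q) + g ^+ (2 ^ q).
Proof.
elim: q => [|q IH]; first by rewrite !expr1.
by rewrite expnSr !exprM IH F2ps_sqrD.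
Qed.

Lemma F2ps_expr_eq0 (f : F2ps) n : f ^+ n = 0 -> f = 0.
Proof.
move=> h; apply: contrapT => /has_order_ex [a /(has_orderX n) /has_order_neq0].
by rewrite h.
Qed.

Lemma char2_cube (R : comPzRingType) (addxx : forall c : R, c + c = 0) (f g : R) :
  f ^+ 3 = g ^+ 3 -> (f + g) * (f ^+ 2 + f * g + g ^+ 2) = 0.
Proof.
move=> e; transitivity (f ^+ 3 + g ^+ 3 + (f ^+ 2 * g + f ^+ 2 * g)
  + (f * g ^+ 2 + f * g ^+ 2)); first by ring.
by rewrite e !addxx.
Qed.

(* f^2+fg+g^2 has no zero: its leading coefficient is 1+1+1 when the orders agree. *)
Lemma F2ps_cube_inj (f g : F2ps) : f ^+ 3 = g ^+ 3 -> f = g.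
Proof.
move=> e; case: (pselect (f = 0)) => [f0|/has_order_ex [a fa]].
  by move: e; rewrite f0 expr0n /= => /esym/F2ps_expr_eq0 ->.
have [b gb] : exists b, has_order g b.
  apply: has_order_ex => g0; apply: (has_order_neq0 (has_orderX 3 fa)).
  by rewrite e g0 expr0n.
have eab : a = b.
  by have := has_orderX 3 gb; rewrite -e => /(has_order_inj (has_orderX 3 fa)); lia.
subst b; have := char2_cube F2ps_addxx e.
case/F2ps_mulf_eq0 => [/F2ps_add_eq0 //|h].
have /(congr1 (fun u : F2ps => u (a + a)%N)) := h.
rewrite !coefpsD !expr2 (has_orderM fa fa).1 (has_orderM fa gb).1.
by rewrite (has_orderM gb gb).1 coefps0 => /eqP.
Qed.

(** * The substitution of x^p for x, Frobenius, and the Hecke operators *)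

Section SubstPow.
Variable p : nat.
Hypothesis p_gt0 : (0 < p)%N.

Definition Vop (f : F2ps) : F2ps :=
  Pser (fun n => if (p %| n)%N then f (n %/ p)%N else 0).
Definition Uop (f : F2ps) : F2ps := Pser (fun n => f (p * n)%N).

Lemma Vop_mul f n : Vop f (p * n)%N = f n.
Proof. by rewrite /= dvdn_mulr // mulKn. Qed.

Lemma sum_multiples (g : nat -> 'F_2) n :
  (forall i, ~~ (p %| i)%N -> g i = 0) ->
  \sum_(i < (p * n).+1) g i = \sum_(i < n.+1) g (p * i)%N.
Proof.
move=> g0; elim: n => [|n IH]; first by rewrite muln0 !big_ord1 muln0.
rewrite [in RHS]big_ord_recr /= -IH.
have -> : (p * n.+1).+1 = ((p * n).+1 + p)%N by lia.
rewrite big_split_ord /=; congr (_ + _).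
have lt_p : (p.-1 < p)%N by rewrite prednK.
rewrite (bigD1 (Ordinal lt_p)) //= big1 ?addr0 => [|i /eqP ine].
  by congr (g _); move: p_gt0; lia.
apply: g0; rewrite addSnnS dvdn_addr ?dvdn_mulr // gtnNdvd //.
have := ltn_ord i; have : (i : nat) <> p.-1 by move=> h; apply/ine/val_inj.
by move: p_gt0; lia.
Qed.

(** The projection formula; it is what converts modular equations into recursions for T_p. *)
Lemma Uop_VM f g : Uop (Vop g * f) = g * Uop f.
Proof.
apply: pserP => n; rewrite [LHS]coefpsM coefpsM.
rewrite (sum_multiples (g := fun i => Vop g i * f (p * n - i)%N)); last first.
  by move=> i /negbTE pi; rewrite /= pi mul0r.
by apply: eq_bigr => i _; rewrite Vop_mul -mulnBr.
Qed.

Lemma UopV f : Uop (Vop f) = f.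
Proof. by apply: pserP => n; apply: Vop_mul. Qed.

Lemma VopM f g : Vop (f * g) = Vop f * Vop g.
Proof.
apply: pserP => n; case: (boolP (p %| n)%N) => [/dvdnP [m ->]|pn].
  rewrite mulnC Vop_mul.
  transitivity (Uop (Vop f * Vop g) m); last by [].
  by rewrite Uop_VM UopV.
rewrite [LHS]/= (negbTE pn) coefpsM big1 // => i _ /=.
case: ifP => [pi|_]; last by rewrite mul0r.
case: ifP => [pni|_]; last by rewrite mulr0.
case/negP: pn; have le_in : (i <= n)%N by rewrite -ltnS.
by rewrite -(subnKC le_in) dvdn_add.
Qed.

Lemma VopD f g : Vop (f + g) = Vop f + Vop g.
Proof.
apply: pserP => n; rewrite [RHS]coefpsD /=.
by case: ifP; rewrite ?coefpsD ?addr0.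
Qed.

Lemma Vop1 : Vop 1 = 1.
Proof.
apply: pserP => n; rewrite coefps1 /=; case: ifP => [/dvdnP [m ->]|].
  by rewrite mulnK // coefps1 muln_eq0 (gtn_eqF p_gt0) orbF.
by case: n => [|n] //; rewrite dvdn0.
Qed.

Lemma VopX f k : Vop (f ^+ k) = Vop f ^+ k.
Proof.
by elim: k => [|k IH]; rewrite ?expr0 ?Vop1 // !exprS VopM IH.
Qed.

Lemma has_orderV f a : has_order f a -> has_order (Vop f) (p * a).
Proof.
move=> [fa fl]; split; first by rewrite Vop_mul.
move=> i ia /=; case: ifP => // pi; apply: fl.
by rewrite ltn_divLR // mulnC.
Qed.

End SubstPow.

Lemma Vop_comp p q f : (0 < p)%N -> (0 < q)%N ->
  Vop p (Vop q f) = Vop (p * q) f.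
Proof.
move=> p0 q0; apply: pserP => n /=; case: (boolP (p %| n)%N).
  by move=> /dvdnP [m ->]; rewrite mulnK // [(m * p)%N]mulnC dvdn_pmul2l // divnMl.
move=> pn; case: ifP => // pqn; case/negP: pn; exact: dvdn_trans (dvdn_mulr q (dvdnn p)) pqn.
Qed.

(** Pairing i with n - i cancels everything but the middle term. Applied to a square this is
    Frobenius, for series, polynomials and series in two variables alike. *)
Lemma sum_sym (R : zmodType) (addxx : forall c : R, c + c = 0) n
  (h : nat -> nat -> R) : (forall i j, h i j = h j i) ->
  \sum_(i < n.+1) h i (n - i)%N = if odd n then 0 else h n./2 n./2.
Proof.
move=> hC; elim/ltn_ind: n h hC => -[|[|n]] IH h hC.
- by rewrite big_ord1.
- by rewrite big_ord_recl big_ord1 /= hC addxx.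
rewrite big_ord_recl big_ord_recr /= subn0 addrCA /bump !add1n subnn.
rewrite [h n.+2 _]hC addxx addr0 negbK.
rewrite (eq_bigr (fun i : 'I_n.+1 => h i.+1 (n - i).+1)) => [|i _].
  by rewrite (IH n _ (fun i j => h i.+1 j.+1)).
by rewrite add1n subSS subSn // -ltnS.
Qed.

Lemma F2ps_sqrE f : f ^+ 2 = Vop 2 f.
Proof.
apply: pserP => n; rewrite expr2 coefpsM (@sum_sym _ F2_addxx n (fun i j => f i * f j)).
  by rewrite /= dvdn2 divn2; case: (odd n) => //=; rewrite F2_sqr.
by move=> i j; rewrite mulrC.
Qed.

Lemma F2ps_pow2E f q : f ^+ (2 ^ q) = Vop (2 ^ q) f.
Proof.
elim: q => [|q IH].
  by rewrite expr1; apply: pserP => n /=; rewrite dvd1n divn1.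
by rewrite expnSr exprM IH F2ps_sqrE Vop_comp ?expn_gt0 // mulnC.
Qed.

Lemma heckeE p f : hecke p f = Uop p f + Vop p f.
Proof. by []. Qed.

Lemma heckeD p : {morph hecke p : f g / f + g}.
Proof.
move=> f g; apply: pserP => n; rewrite [RHS]coefpsD /= addrACA coefpsD.
by congr (_ + _); case: ifP; rewrite ?coefpsD ?addr0.
Qed.

Lemma hecke0 p : hecke p 0 = 0.
Proof. by apply: pserP => n /=; case: ifP; rewrite addr0. Qed.

Lemma heckeZ p c f : hecke p (c *: f) = c *: hecke p f.
Proof. by apply: pserP => n; rewrite coefpsZ /= mulrDr; case: ifP; rewrite ?mulr0. Qed.

(** Squaring is the substitution of x^2 for x, and 2 is prime to p. *)
Lemma hecke_sqr p f : odd p -> hecke p (f ^+ 2) = (hecke p f) ^+ 2.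
Proof.
move=> op; rewrite !F2ps_sqrE !heckeE VopD //; congr (_ + _); last first.
  by rewrite !(Vop_comp, odd_gt0 op) // mulnC.
apply: pserP => n /=; rewrite Gauss_dvdr ?coprime2n //.
by case: ifP => // /dvdnP [m ->]; rewrite mulnA !mulnK.
Qed.

Lemma heckeC p q f : prime p -> prime q -> p != q ->
  hecke p (hecke q f) = hecke q (hecke p f).
Proof.
move=> pp pq pq_ne; have cpq : coprime p q.
  by rewrite prime_coprime // dvdn_prime2.
have cqp : coprime q p by rewrite coprime_sym.
have p0 := prime_gt0 pp; have q0 := prime_gt0 pq.
apply: pserP => n /=.
rewrite !(Gauss_dvdr _ cqp) !(Gauss_dvdr _ cpq) mulnCA.
have swap : (if (p %| n)%N then f (q * (n %/ p))%N else 0)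
   = (if (p %| n)%N then f (q * n %/ p)%N else 0).
  by case: ifP => // /dvdnP [m ->]; rewrite mulnA !mulnK.
have swap2 : (if (q %| n)%N then f (p * (n %/ q))%N else 0)
   = (if (q %| n)%N then f (p * n %/ q)%N else 0).
  by case: ifP => // /dvdnP [m ->]; rewrite mulnA !mulnK.
have both : (if (p %| n)%N then if (q %| n %/ p)%N then f (n %/ p %/ q)%N else 0 else 0)
   = (if (q %| n)%N then if (p %| n %/ q)%N then f (n %/ q %/ p)%N else 0 else 0).
  case: (boolP (p %| n)%N) => pn; case: (boolP (q %| n)%N) => qn.
  - have /dvdnP [m nE] : (p * q %| n)%N by rewrite Gauss_dvd // pn.
    have -> : (n %/ p = m * q)%N by rewrite nE [(p * q)%N]mulnC mulnA mulnK.
    have -> : (n %/ q = m * p)%N by rewrite nE mulnA mulnK.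
    by rewrite !dvdn_mull // !mulnK.
  - case: ifP => // h; case/negP: qn; rewrite -(divnK pn); exact: dvdn_mulr.
  - case: ifP => // h; case/negP: pn; rewrite -(divnK qn); exact: dvdn_mulr.
  - by [].
have spl (P : bool) (u v : 'F_2) : (if P then u + v else 0) = (if P then u else 0) + (if P then v else 0).
  by case: P; rewrite ?addr0.
by rewrite !spl swap swap2 both addrACA.
Qed.

(** * The modular equation of degree 3 *)

Definition theta (P : pred nat) : F2ps :=
  Pser (fun m => \sum_(n < m.+1 | P n && (n ^ 2 == m)%N) 1).

Lemma leq_sq n : (n <= n ^ 2)%N.
Proof. by case: n => // n; rewrite -mulnn leq_pmulr. Qed.

Lemma sum1_widen (P : pred nat) m n :
  (m <= n)%N -> (forall i, (m <= i)%N -> ~~ P i) ->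
  \sum_(i < m | P i) (1 : 'F_2) = \sum_(i < n | P i) 1.
Proof.
move=> mn P0; rewrite (big_ord_widen_cond _ _ (fun=> 1) mn).
by apply: eq_bigl => i; case: ltnP => im; rewrite ?andbT // (negbTE (P0 _ im)).
Qed.

Lemma Vop_theta a P N i : (0 < a)%N -> (i <= N)%N ->
  Vop a (theta P) i = \sum_(m < N.+1 | P m && (a * m ^ 2 == i)%N) 1.
Proof.
move=> a0 iN; case: (boolP (a %| i)%N) => [/dvdnP [j iE]|ai]; last first.
  rewrite /= (negbTE ai) big1 // => m /andP [_ /eqP iE].
  by rewrite -iE dvdn_mulr in ai.
have -> : Vop a (theta P) i = theta P j by rewrite iE mulnC Vop_mul.
rewrite /= (@sum1_widen (fun n => P n && (n ^ 2 == j)%N) j.+1 N.+1).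
- apply: eq_bigl => m; rewrite iE [(a * _)%N]mulnC eqn_mul2r.
  by rewrite (gtn_eqF a0).
- by rewrite ltnS; nia.
- by move=> n jn; apply/negP => /andP [_ /eqP]; nia.
Qed.

Lemma theta_mul a b P Q N : (0 < a)%N -> (0 < b)%N ->
  (Vop a (theta P) * Vop b (theta Q)) N =
  \sum_(x : 'I_N.+1 * 'I_N.+1 |
         [&& P x.1, Q x.2 & (a * x.1 ^ 2 + b * x.2 ^ 2 == N)%N]) 1.
Proof.
move=> a0 b0; rewrite coefpsM.
transitivity (\sum_(i < N.+1) \sum_(x : 'I_N.+1 * 'I_N.+1 |
   (P x.1 && (a * x.1 ^ 2 == i)%N) && (Q x.2 && (b * x.2 ^ 2 == N - i)%N))
   (1 : 'F_2)).
  apply: eq_bigr => i _; have iN : (i <= N)%N by rewrite -ltnS.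
  rewrite (Vop_theta _ a0 iN) (Vop_theta _ b0 (leq_subr i N)).
  rewrite mulr_suml (eq_bigr (fun i0 : 'I_N.+1 =>
    \sum_(j < N.+1 | Q j && (b * j ^ 2 == N - i)%N) (1 : 'F_2))) => [|j _].
    by rewrite pair_big.
  by rewrite mul1r.
rewrite (exchange_big_dep predT) //= [RHS]big_mkcond /=.
apply: eq_bigr => -[m n] _ /=; case: ifP => [/and3P [Pm Qn /eqP e]|h].
  have mN : (a * m ^ 2 < N.+1)%N by lia.
  have e' : (b * n ^ 2 = N - a * m ^ 2)%N by lia.
  rewrite (bigD1 (Ordinal mN)) /=; last first.
    by rewrite Pm Qn -e' !eqxx.
  rewrite big1 ?addr0 // => i /andP [/andP [/andP [_ /eqP ie] _] /eqP ne].
  by case: ne; apply: val_inj; rewrite /= ie.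
rewrite big1 // => i /andP [/andP [Pm /eqP e1] /andP [Qn /eqP e2]].
move: h; rewrite Pm Qn e1 e2 subnKC ?eqxx //.
by rewrite -ltnS.
Qed.

(** Orbits of length two cancel modulo 2. *)
Lemma parity_involution (T : finType) (S : pred T) (f : T -> T) :
  (forall x, S x -> S (f x)) -> (forall x, S x -> f (f x) = x) ->
  \sum_(x | S x) (1 : 'F_2) = \sum_(x | S x && (f x == x)) 1.
Proof.
move: {2}#|S| (leqnn #|S|) => n; elim: n S => [|n IH] S Sn Sf ff.
  have S0 x : S x = false by move: Sn; rewrite leqn0 => /eqP/card0_eq/(_ x).
  by rewrite !big_pred0 // => x; rewrite S0.
case: (pickP [pred x | S x && (f x != x)]) => [x /= /andP [Sx fx]|none]; last first.
  apply: eq_bigl => x; case: (boolP (S x)) => //= Sx.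
  by have := none x; rewrite /= Sx /= => /negbT; rewrite negbK => ->.
have Sfx := Sf _ Sx.
pose S' := [pred y | S y && (y != x) && (y != f x)].
rewrite (bigD1 x) //= (bigD1 (f x)) /=; last by rewrite Sfx fx.
rewrite addrA F2_addxx add0r.
have e1 : \sum_(y | S' y) (1 : 'F_2) = \sum_(y | S' y && (f y == y)) 1.
  apply: IH.
  - rewrite -ltnS; apply: leq_trans Sn; apply: proper_card; apply/properP; split.
      by apply/subsetP => y /andP [/andP [Sy _] _].
    by exists x; rewrite // unfold_in /= eqxx andbF.
  - move=> y /andP [/andP [Sy yx] yfx] /=; rewrite Sf //=; apply/andP; split.
      by apply: contraNneq yfx => <-; rewrite ff.
    by apply: contraNneq yx => /(congr1 f); rewrite !ff // => ->.
  - by move=> y /andP [/andP [Sy _] _]; exact: ff.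
have e2 : \sum_(y | S y && (f y == y)) (1 : 'F_2) = \sum_(y | S' y && (f y == y)) 1.
  apply: eq_bigl => y /=; case: (boolP (S y)) => //= Sy.
  case: (eqVneq y x) => [->|yx] /=; first by rewrite (negbTE fx).
  case: (eqVneq y (f x)) => [->|_] //=.
  by rewrite ff // eq_sym (negbTE fx).
by rewrite e2 -e1.
Qed.

Definition ndist (a b : nat) : nat := ((a - b) + (b - a))%N.

(* Multiplication of m + n sqrt(-3) by the cube root of unity which keeps both
   coordinates odd integers, followed by absolute values. *)
Definition eis_rot (x : nat * nat) : nat * nat :=
  let: (m, n) := x in
  if ((m + n) %% 4 == 0)%N then ((m + 3 * n) %/ 2, ndist m n %/ 2)%N
  else (ndist m (3 * n) %/ 2, (m + n) %/ 2)%N.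

Lemma eis_rot_odd m n : odd m -> odd n ->
  odd (eis_rot (m, n)).1 /\ odd (eis_rot (m, n)).2.
Proof.
rewrite /eis_rot /ndist => om on; case: eqP => h /=; split; lia.
Qed.

Lemma eis_rotK m n : odd m -> odd n -> eis_rot (eis_rot (m, n)) = (m, n).
Proof.
rewrite /eis_rot /ndist => om on; case: eqP => h /=; case: eqP => h2 /=;
congr (_, _); lia.
Qed.

Lemma eis_rot_norm m n : odd m -> odd n ->
  ((eis_rot (m, n)).1 ^ 2 + 3 * (eis_rot (m, n)).2 ^ 2 = m ^ 2 + 3 * n ^ 2)%N.
Proof.
rewrite /eis_rot /ndist => om on; case: eqP => h /=.
(* Naming the half-difference removes truncated subtraction and division, leaving polynomial
   identities. *)
- have [[j e]|[j e]] : (exists j, m = n + 2 * j \/ False)%N \/ (exists j, n = m + 2 * j)%N.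
  + case: (leqP n m) => c; [left; exists ((m - n) %/ 2)%N; left|right; exists ((n - m) %/ 2)%N]; lia.
  + case: e => // e; have -> : ((m + 3 * n) %/ 2 = 2 * n + j)%N by lia.
    have -> : ((m - n + (n - m)) %/ 2 = j)%N by lia.
    rewrite e; nia.
  + have -> : ((m + 3 * n) %/ 2 = 2 * m + 3 * j)%N by lia.
    have -> : ((m - n + (n - m)) %/ 2 = j)%N by lia.
    rewrite e; nia.
- have [[j e]|[j e]] : (exists j, m = 3 * n + 2 * j \/ False)%N \/ (exists j, 3 * n = m + 2 * j)%N.
  + case: (leqP (3 * n) m) => c; [left; exists ((m - 3 * n) %/ 2)%N; left|right; exists ((3 * n - m) %/ 2)%N]; lia.
  + case: e => // e; have -> : ((m + n) %/ 2 = 2 * n + j)%N by lia.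
    have -> : ((m - 3 * n + (3 * n - m)) %/ 2 = j)%N by lia.
    rewrite e; nia.
  + have -> : ((m - 3 * n + (3 * n - m)) %/ 2 = j)%N by lia.
    have [i ie] : exists i, (m + n = 2 * i)%N by exists ((m + n) %/ 2)%N; lia.
    have -> : ((m + n) %/ 2 = i)%N by lia.
    have -> : (n = (i + j) %/ 2)%N by lia.
    have [l le] : exists l, (i + j = 2 * l)%N by exists n; lia.
    have -> : ((i + j) %/ 2 = l)%N by lia.
    have e1 : (m + l = 2 * i)%N by lia.
    have e2 : (j + i = 2 * l)%N by lia.
    have e3 : ((j + i) * i = 2 * l * i)%N by rewrite e2.
    have e4 : ((m + l) * l = 2 * i * l)%N by rewrite e1.
    have e5 : ((j + i) * (j + i) = 2 * l * (2 * l))%N by rewrite e2.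
    have e6 : ((m + l) * (m + l) = 2 * i * (2 * i))%N by rewrite e1.
    by rewrite -!mulnn; lia.
Qed.

Lemma eis_rot_fix m n : odd m -> odd n ->
  (eis_rot (m, n) == (m, n)) = (m == n) || (m == 3 * n)%N.
Proof.
rewrite /eis_rot /ndist => om on; apply/eqP/orP.
  case: eqP => h [] e1 e2; [right|left]; apply/eqP; lia.
case=> /eqP e; case: eqP => h; congr (_, _); lia.
Qed.

Arguments eis_rot : simpl never.

Notation F := (theta odd).

(** On the right, the coefficient of x^N counts odd m, n with m^2 + 3 n^2 = N. Modulo 2 only the
    fixed points of [eis_rot] remain: m = n gives N = 4 n^2, which is F(x^4), and m = 3n gives N =
    12 n^2, which is F(x^12). *)
Lemma theta_odd_rel3 : F ^+ 4 + Vop 3 F ^+ 4 = F * Vop 3 F.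
Proof.
rewrite !(F2ps_pow2E _ 2) Vop_comp // [(2 ^ 2 * 3)%N]/=.
have F1 : F = Vop 1 F by apply: pserP => n /=; rewrite dvd1n divn1.
apply: pserP => N; rewrite {3}F1 theta_mul // coefpsD !(@Vop_theta _ _ N) //.
pose nat2 (x : 'I_N.+1 * 'I_N.+1) : nat * nat := (x.1 : nat, x.2 : nat).
pose f (x : 'I_N.+1 * 'I_N.+1) : 'I_N.+1 * 'I_N.+1 :=
  (inord (eis_rot (nat2 x)).1, inord (eis_rot (nat2 x)).2).
pose S (x : 'I_N.+1 * 'I_N.+1) :=
  [&& odd x.1, odd x.2 & (1 * x.1 ^ 2 + 3 * x.2 ^ 2 == N)%N].
have fE x : S x -> nat2 (f x) = eis_rot (nat2 x).
  case: x => m n /and3P [/= om on /eqP e].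
  have := eis_rot_norm om on; have [o1 o2] := eis_rot_odd om on.
  rewrite /nat2 /f /=; case: (eis_rot _) o1 o2 => a b /= o1 o2 e2.
  have aN : (a < N.+1)%N by have := leq_sq a; lia.
  have bN : (b < N.+1)%N by have := leq_sq b; lia.
  by rewrite !inordK.
have nat2I : injective nat2.
  by move=> [m n] [m' n'] [] /= e1 e2; congr (_, _); apply: val_inj.
have fixE x : S x -> (f x == x) = (x.1 == x.2 :> nat) || (x.1 == 3 * x.2 :> nat)%N.
  move=> Sx; have /and3P [om on _] := Sx.
  by rewrite -eis_rot_fix // -(inj_eq nat2I) fE.
rewrite (@parity_involution _ S f); first last.
- move=> x Sx; apply: nat2I; have /and3P [om on _] := Sx.
  have Sfx : S (f x).
    have := fE _ Sx; case: (f x) => a b; rewrite /S /nat2 /= => e.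
    have := eis_rot_norm om on; have := eis_rot_odd om on.
    rewrite -e /= => -[-> ->] /= en; have /and3P [_ _ /eqP /= h] := Sx.
    by apply/eqP; lia.
  by rewrite fE // fE // eis_rotK.
- move=> x Sx; have /and3P [om on _] := Sx.
  have := fE _ Sx; case: (f x) => a b; rewrite /S /nat2 /= => e.
  have := eis_rot_norm om on; have := eis_rot_odd om on.
  rewrite -e /= => -[-> ->] /= en; have /and3P [_ _ /eqP /= h] := Sx.
    by apply/eqP; lia.
rewrite (bigID (fun x : 'I_N.+1 * 'I_N.+1 => x.1 == x.2 :> nat)) /=; congr (_ + _).
  rewrite (reindex_onto (fun m => (m, m)) fst) /=; last first.
    by move=> [m n] /= /andP [_ /eqP e]; congr (_, _); apply: val_inj.
  apply: eq_bigl => m; rewrite !eqxx !andbT /S /=.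
  have -> : (1 * m ^ 2 + 3 * m ^ 2 = 4 * m ^ 2)%N by lia.
  case om: (odd m) => //=; case: eqP => //= e.
  rewrite fixE ?eqxx // /S /= om /=; apply/eqP; lia.
rewrite (reindex_onto (fun n : 'I_N.+1 => (inord (3 * n), n)) snd) /=; last first.
  move=> [m n] /= /andP [/andP [Sx]]; rewrite fixE //= => /orP [->//|/eqP e _].
  by congr (_, _); apply: val_inj; rewrite /= -e inordK.
apply: eq_bigl => n; rewrite eqxx andbT.
apply/andP/andP => [[on /eqP e]|[/andP [Sx]]].
  have le3 : (3 * n < N.+1)%N by rewrite ltnS; nia.
  have Sx : S (inord (3 * n), n).
    by rewrite /S /= inordK // on oddM on /=; apply/eqP; lia.
  rewrite Sx fixE //= inordK // eqxx orbT; split => //.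
  by apply/eqP => h; move: on; have -> : (n : nat) = 0%N by lia.
rewrite fixE //= => /orP [->//|/eqP e _].
by move: Sx; rewrite /S /= e => /and3P [_ -> /eqP h]; split => //; apply/eqP; lia.
Qed.

(** * Modular equations of degrees 5, 7 and 13 *)

(* Computable polynomials over F_2: a row is a polynomial in y, a table is a
   polynomial in x whose coefficients are rows. *)
Fixpoint row_add (s t : seq bool) : seq bool :=
  match s, t with
  | [::], _ => t
  | _, [::] => s
  | a :: s', b :: t' => (a (+) b) :: row_add s' t'
  end.

Fixpoint row_mul (s t : seq bool) : seq bool :=
  if s is a :: s' then row_add (if a then t else [::]) (false :: row_mul s' t)
  else [::].

Fixpoint tab_add (s t : seq (seq bool)) : seq (seq bool) :=
  match s, t with
  | [::], _ => t
  | _, [::] => s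
  | a :: s', b :: t' => row_add a b :: tab_add s' t'
  end.

Fixpoint tab_mul (s t : seq (seq bool)) : seq (seq bool) :=
  if s is a :: s' then tab_add (map (row_mul a) t) ([::] :: tab_mul s' t)
  else [::].

Inductive pexpr :=
  PX | PY | P1 | PAdd of pexpr & pexpr | PMul of pexpr & pexpr | PPow of pexpr & nat.

Fixpoint pexpr_tab (e : pexpr) : seq (seq bool) :=
  match e with
  | PX => [:: [::]; [:: true]]
  | PY => [:: [:: false; true]]
  | P1 => [:: [:: true]]
  | PAdd a b => tab_add (pexpr_tab a) (pexpr_tab b)
  | PMul a b => tab_mul (pexpr_tab a) (pexpr_tab b)
  | PPow a n => iter n (tab_mul (pexpr_tab a)) [:: [:: true]]
  end.

Definition tab_zero (t : seq (seq bool)) := all (all negb) t.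

(* Quotient of a table by x^k + (lower), both given with decreasing powers of x. *)
Fixpoint tab_rdiv (g : seq (seq bool)) (n : nat) (t : seq (seq bool)) :=
  if n is n'.+1 then
    if t is h :: t' then h :: tab_rdiv g n' (tab_add (map (row_mul h) g) t')
    else [::]
  else [::].

Definition tab_div (t g : seq (seq bool)) : seq (seq bool) :=
  rev (tab_rdiv (behead (rev g)) (size t - (size g).-1) (rev t)).

(** The division algorithm is not trusted: the quotient is multiplied back. *)
Definition divides_tab (g t : seq (seq bool)) :=
  tab_zero (tab_add t (tab_mul g (tab_div t g))).

(** * Evaluating computed polynomials in a ring of characteristic 2 *)

Section Eval.
Variable R : comNzRingType.
Hypothesis addxx : forall c : R, c + c = 0.
Variables x y : R.

Fixpoint row_eval (s : seq bool) : R :=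
  if s is a :: s' then a%:R + y * row_eval s' else 0.

Fixpoint tab_eval (t : seq (seq bool)) : R :=
  if t is a :: t' then row_eval a + x * tab_eval t' else 0.

Fixpoint pexpr_eval (e : pexpr) : R :=
  match e with
  | PX => x
  | PY => y
  | P1 => 1
  | PAdd a b => pexpr_eval a + pexpr_eval b
  | PMul a b => pexpr_eval a * pexpr_eval b
  | PPow a n => pexpr_eval a ^+ n
  end.

Lemma row_evalD s t : row_eval (row_add s t) = row_eval s + row_eval t.
Proof.
elim: s t => [|a s IH] [|b t] /=; rewrite ?add0r ?addr0 // IH mulrDr addrACA.
by congr (_ + _); case: a; case: b; rewrite /= ?addxx ?addr0 ?add0r.
Qed.

Lemma row_evalM s t : row_eval (row_mul s t) = row_eval s * row_eval t.
Proof.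
elim: s => [|a s IH] /=; first by rewrite mul0r.
rewrite row_evalD /= IH add0r mulrDl mulrA; congr (_ + _).
by case: a; rewrite /= ?mul1r ?mul0r.
Qed.

Lemma tab_evalD s t : tab_eval (tab_add s t) = tab_eval s + tab_eval t.
Proof.
elim: s t => [|a s IH] [|b t] /=; rewrite ?add0r ?addr0 //.
by rewrite IH mulrDr addrACA row_evalD.
Qed.

Lemma tab_eval_map a t : tab_eval (map (row_mul a) t) = row_eval a * tab_eval t.
Proof.
elim: t => [|b t IH] /=; first by rewrite mulr0.
by rewrite IH row_evalM mulrDr; congr (_ + _); rewrite mulrCA.
Qed.

Lemma tab_evalM s t : tab_eval (tab_mul s t) = tab_eval s * tab_eval t.
Proof.
elim: s => [|a s IH] /=; first by rewrite mul0r.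
by rewrite tab_evalD /= IH tab_eval_map add0r mulrDl mulrA.
Qed.

Lemma pexpr_tabE e : tab_eval (pexpr_tab e) = pexpr_eval e.
Proof.
elim: e => /= [|||a <- b <-|a <- b <-|a IH n].
- by rewrite !mulr0 addr0 add0r addr0 mulr1.
- by rewrite !mulr0 addr0 add0r addr0 mulr1.
- by rewrite !mulr0 !addr0.
- exact: tab_evalD.
- exact: tab_evalM.
- elim: n => [|n IHn]; first by rewrite /= !mulr0 !addr0.
  by rewrite iterS tab_evalM IHn IH exprS.
Qed.

Lemma tab_zeroP t : tab_zero t -> tab_eval t = 0.
Proof.
elim: t => //= a t IH /andP [a0 /IH ->]; rewrite mulr0 addr0.
by elim: a a0 => //= -[] // s IHs /IHs ->; rewrite mulr0 addr0.
Qed.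

Lemma char2_add_eq0 (u v : R) : u + v = 0 -> u = v.
Proof. by move=> e; rewrite -[u]addr0 -(addxx v) addrA e add0r. Qed.

Lemma divides_tabP g t : divides_tab (pexpr_tab g) (pexpr_tab t) ->
  pexpr_eval t = pexpr_eval g * tab_eval (tab_div (pexpr_tab t) (pexpr_tab g)).
Proof.
move=> /tab_zeroP; rewrite tab_evalD tab_evalM !pexpr_tabE.
exact: char2_add_eq0.
Qed.

Lemma pexpr_eq s t : tab_zero (tab_add (pexpr_tab s) (pexpr_tab t)) ->
  pexpr_eval s = pexpr_eval t.
Proof.
by move=> /tab_zeroP; rewrite tab_evalD !pexpr_tabE; exact: char2_add_eq0.
Qed.

End Eval.

(** Modulo 2, F is the discriminant form and 1/F is j. The parameter z is the Hauptmodul (eta(p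
    tau)/eta(tau))^(24/(p-1)) of Gamma_0(p), and each [d] is the reduction of the classical
    numerator in j = d(z)/z. It is palindromic of degree p+1, so z -> 1/z exchanges F and F(x^p). *)
Definition d5 (u : pexpr) := PPow (PAdd P1 u) 6.
Definition q3 (u : pexpr) := PAdd (PAdd P1 u) (PPow u 2).
Definition d7 (u : pexpr) := PPow (q3 u) 4.
Definition d13 (u : pexpr) := PMul (PPow (PAdd P1 u) 6) (PPow (q3 u) 4).

(* With denominators cleared, the modular equation of degree 3 between the values of
   t^k / d(t) at X and Y. *)
Definition corr3 (d : pexpr -> pexpr) (k : nat) :=
  PAdd (PAdd (PMul (PPow PX (4 * k)) (PPow (d PY) 4))
             (PMul (PPow PY (4 * k)) (PPow (d PX) 4)))
       (PMul (PPow (PMul PX PY) k) (PPow (PMul (d PX) (d PY)) 3)).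

Definition xy := PMul PX PY.
Definition xy3 := PMul xy (PAdd P1 (PAdd (PPow PX 2) (PAdd (PPow PY 2) (PPow xy 2)))).
(** The factor of [corr3 d 1] that vanishes at (z, z(x^3)). Its degree 4 = 3 + 1 in each variable is
    that of the correspondence of level 3; it is monic in x, as [tab_div] expects. *)
Definition G5 := PAdd (PAdd (PPow PX 4) (PPow PY 4)) xy3.
Definition G7 := PAdd (PAdd (PPow PX 4) (PPow PY 4))
  (PAdd xy (PAdd (PPow xy 2) (PPow xy 3))).
Definition G13 := PAdd (PAdd (PPow PX 4) (PPow PY 4)) (PAdd xy3 (PPow xy 2)).

(** The last condition says that the cofactor of [g] in [corr3 d 1] has constant term 1. It cannot
    vanish at series without constant term, which forces [g] to vanish. *)
Definition good_corr (d : pexpr -> pexpr) (g : pexpr) (p : nat) :=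
  [&& divides_tab (pexpr_tab g) (pexpr_tab (corr3 d 1)),
      divides_tab (pexpr_tab g) (pexpr_tab (corr3 d p))
    & head false (head [::] (tab_div (pexpr_tab (corr3 d 1)) (pexpr_tab g)))].

Lemma good_corr5 : good_corr d5 G5 5. Proof. by vm_compute. Qed.
Lemma good_corr7 : good_corr d7 G7 7. Proof. by vm_compute. Qed.
Lemma good_corr13 : good_corr d13 G13 13. Proof. by vm_compute. Qed.

Lemma coprime6 n : coprime n 6 = odd n && ~~ (3 %| n)%N.
Proof.
rewrite -[6%N]/(2 * 3)%N coprimeMr coprimen2; congr (_ && _).
by rewrite coprime_sym prime_coprime.
Qed.

Lemma D_theta : D = theta (fun n => odd n && ~~ (3 %| n)%N).
Proof.
rewrite /D /theta; congr Pser; apply/funext => m.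
apply: eq_bigl => n; rewrite coprime6.
by case: (n : nat) => // k; rewrite ltn0Sn.
Qed.

Lemma theta_odd_split : F = D + Vop 9 F.
Proof.
apply: pserP => m; rewrite coefpsD (@Vop_theta _ _ m) // D_theta /=.
rewrite (bigID (fun n : 'I_m.+1 => ~~ (3 %| n)%N)) /=; congr (_ + _).
  by apply: eq_bigl => n; rewrite andbAC.
pose h (n : 'I_m.+1) : 'I_m.+1 := inord (3 * n).
rewrite (reindex_onto h (fun n : 'I_m.+1 => inord (n %/ 3))) /=; last first.
  move=> n /andP [_ /negPn n3]; apply: val_inj.
  have lt3 : (n %/ 3 < m.+1)%N by have := ltn_ord n; lia.
  by rewrite /h /= (inordK lt3) mulnC divnK // inordK.
apply: eq_bigl => n; rewrite /h.
apply/andP/andP => [[/andP [/andP [o /eqP e] d] /eqP i]|[on /eqP e]].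
  case: (ltnP (3 * n) m.+1) => c.
    by move: o e; rewrite inordK // oddM /= => -> em; split => //; apply/eqP; lia.
  (* An index out of range is sent to 0, which is not odd, so this branch is empty. *)
  have h0 : inord (3 * n) = ord0 :> 'I_m.+1.
    by rewrite /inord /insubd insubN // -leqNgt.
  by move: o; rewrite h0.
have c : (3 * n < m.+1)%N by have := leq_sq n; lia.
rewrite inordK // oddM on dvdn_mulr //= mulKn // inord_val eqxx; split => //.
by rewrite andbT; apply/eqP; lia.
Qed.

Lemma has_order_theta_odd : has_order F 1.
Proof.
split => [|[|i] //]; last by rewrite /= big_ord1_cond.
by rewrite /= big_mkcond big_ord_recl big_ord1 /= add0r.
Qed.

Lemma char2_cube_from (R : comPzRingType) (addxx : forall c : R, c + c = 0)
  (f g h : R) : f ^+ 4 + g ^+ 4 = f * g -> g ^+ 4 + h ^+ 4 = g * h ->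
  f ^+ 4 + h ^+ 4 = g * (f + h).
Proof.
move=> e1 e2; transitivity (f ^+ 4 + g ^+ 4 + (g ^+ 4 + h ^+ 4)).
  by rewrite addrA -[f ^+ 4 + _ + _]addrA addxx addr0.
by rewrite e1 e2 mulrDr [f * g]mulrC.
Qed.

Lemma has_orderD1 : has_order D 1.
Proof.
have -> : D = F + Vop 9 F by rewrite {1}theta_odd_split F2ps_addK.
apply: has_orderD has_order_theta_odd _ => i i1.
by apply: (has_orderV (p := 9) _ has_order_theta_odd).2; lia.
Qed.

(** Adding the degree 3 equation to its image under x -> x^3 eliminates the fourth power of F(x^3).
    What remains is D^4 = F(x^3) D, and D cancels. *)
Lemma D_cube : D ^+ 3 = Vop 3 F.
Proof.
have DE : D = F + Vop 9 F by rewrite {1}theta_odd_split F2ps_addK.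
have e2 : Vop 3 F ^+ 4 + Vop 9 F ^+ 4 = Vop 3 F * Vop 9 F.
  have /(congr1 (Vop 3)) := theta_odd_rel3.
  by rewrite VopD // !VopX // [RHS]VopM // !Vop_comp.
have e := char2_cube_from F2ps_addxx theta_odd_rel3 e2.
apply: (@F2ps_mulI D); first exact: has_order_neq0 has_orderD1.
by rewrite -exprS DE (F2ps_exprD _ _ 2) e mulrC.
Qed.

Definition agree (n : nat) (f g : F2ps) := forall i, (i < n)%N -> f i = g i.

Lemma agreeD n f g f' g' : agree n f g -> agree n f' g' -> agree n (f + f') (g + g').
Proof. by move=> h h' i ni; rewrite !coefpsD (h i ni) (h' i ni). Qed.

Lemma agreeM n f g f' g' : agree n f g -> agree n f' g' -> agree n (f * f') (g * g').
Proof.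
move=> h h' i ni; rewrite !coefpsM; apply: eq_bigr => j _.
by rewrite h ?h' //; have := ltn_ord j; lia.
Qed.

Lemma agreeX n f g k : agree n f g -> agree n (f ^+ k) (g ^+ k).
Proof.
move=> h; elim: k => [|k IH]; first by rewrite !expr0 => i _; reflexivity.
by rewrite (exprS f) (exprS g); exact: (agreeM h IH).
Qed.

Lemma agree_pexpr n f g y e : agree n f g ->
  agree n (pexpr_eval f y e) (pexpr_eval g y e).
Proof.
move=> h; elim: e => [|||a IHa b IHb|a IHa b IHb|a IH k].
- exact: h.
- move=> i _; reflexivity.
- move=> i _; reflexivity.
- exact: (agreeD IHa IHb).
- exact: (agreeM IHa IHb).
- exact: (agreeX k IH).
Qed.

Lemma agree_shift n (h f g : F2ps) : h 0%N = 0 -> agree n f g -> agree n.+1 (h * f) (h * g).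
Proof.
move=> h0 fg i ni; rewrite !coefpsM; apply: eq_bigr => -[[|j] jn] _ /=.
  by rewrite h0 !mul0r.
by rewrite fg //; lia.
Qed.

(** The contraction principle for the x-adic topology: coefficient n is final from iterate n+1
    on. *)
Lemma fixpoint_exists (Phi : F2ps -> F2ps) :
  (forall n f g, agree n f g -> agree n.+1 (Phi f) (Phi g)) ->
  exists z, z = Phi z.
Proof.
move=> ctr; pose it n := iter n Phi 0.
have it1 n : agree n (it n) (it n.+1).
  by elim: n => [|n IH] //; apply: (ctr n).
have itm n k : agree n (it n) (it (n + k)%N).
  elim: k => [|k IH]; first by rewrite addn0.
  by move=> i ni; rewrite IH // addnS it1 //; lia.
pose z : F2ps := Pser (fun n => it n.+1 n).
have zit n : agree n z (it n).
  by move=> i ni; rewrite /= (itm i.+1 (n - i.+1)%N) // subnKC.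
exists z; apply: pserP => n; rewrite (zit n.+1) //.
by apply: esym; apply: (ctr n).
Qed.

Lemma pexpr_unit (x y : F2ps) e : x 0%N = 0 -> y 0%N = 0 ->
  head false (head [::] e) -> tab_eval x y e 0%N = 1 :> 'F_2.
Proof.
move=> x0 y0; case: e => [|[|[] r] t] // _.
have -> : tab_eval x y ((true :: r) :: t) = 1 + y * row_eval y r + x * tab_eval x y t.
  by [].
by rewrite !coefpsD !coefpsM !big_ord1 x0 y0 !mul0r !addr0 coefps1.
Qed.

Lemma order0 (f : F2ps) : f 0%N = 1 -> has_order f 0. Proof. by []. Qed.

Lemma char2_rel3_diff (R : comPzRingType) (addxx : forall c : R, c + c = 0)
  (a b c e : R) : (a + c) ^+ 4 = a ^+ 4 + c ^+ 4 -> (b + e) ^+ 4 = b ^+ 4 + e ^+ 4 ->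
  a ^+ 4 + b ^+ 4 = a * b -> c ^+ 4 + e ^+ 4 = c * e ->
  (a + c) * b = (a + c) ^+ 4 + (b + e) ^+ 4 + c * (b + e).
Proof.
move=> -> -> h1 h2.
transitivity ((a + c) * b + (c * e + c * e)); first by rewrite addxx addr0.
transitivity (a * b + c * e + (c * b + c * e)); first by ring.
by rewrite -h1 -{1}h2; ring.
Qed.

(* If E(x) and E(x^3) are related by the modular equation of degree 3 then the
   lowest term of E determines E: in the difference of two solutions the term
   of order k+3p cannot be cancelled. *)
Lemma rel3_rigid p (E1 E2 : F2ps) : has_order E1 p -> has_order E2 p ->
  E1 ^+ 4 + Vop 3 E1 ^+ 4 = E1 * Vop 3 E1 ->
  E2 ^+ 4 + Vop 3 E2 ^+ 4 = E2 * Vop 3 E2 -> E1 = E2.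
Proof.
move=> o1 o2 r1 r2; apply: F2ps_add_eq0; set d := E1 + E2.
apply: contrapT => /has_order_ex [k dk].
have pk : (p < k)%N.
  rewrite ltnNge; apply/negP => kp; have := dk.1; rewrite coefpsD.
  case: (ltnP k p) => c; first by rewrite o1.2 // o2.2 // addr0 => /eqP.
  have -> : k = p by lia.
  by rewrite o1.1 o2.1 F2_addxx => /eqP.
have d3 : Vop 3 d = Vop 3 E1 + Vop 3 E2 by rewrite VopD.
have key : d * Vop 3 E1 = d ^+ 4 + Vop 3 d ^+ 4 + E2 * Vop 3 d.
  rewrite d3; apply: (char2_rel3_diff F2ps_addxx) r1 r2;
  exact: (F2ps_exprD _ _ 2).
have o3 : has_order (d * Vop 3 E1) (k + 3 * p).
  by apply: has_orderM dk _; apply: has_orderV.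
have := o3.1; rewrite key !coefpsD.
rewrite (has_orderX 4 dk).2; last by lia.
rewrite (has_orderX 4 (has_orderV (isT : 0 < 3)%N dk)).2; last by lia.
rewrite (has_orderM o2 (has_orderV (isT : 0 < 3)%N dk)).2; last by lia.
by rewrite !addr0 => /eqP.
Qed.

(** With f = z/d, the product [z ^+ k.-1 * f] is z^k/d written without division; hence the exception
    at [k = 0]. *)
Lemma corr3_factor (R : comPzRingType) (k : nat) (f f' z z' d d' : R) : z = f * d -> z' = f' * d' ->
  z ^+ (4 * k) * d' ^+ 4 + z' ^+ (4 * k) * d ^+ 4 + (z * z') ^+ k * (d * d') ^+ 3
  = (d * d') ^+ 4 * ((z ^+ k.-1 * f) ^+ 4 + (z' ^+ k.-1 * f') ^+ 4
      + (z ^+ k.-1 * f) * (z' ^+ k.-1 * f')) \/ k = 0%N.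
Proof.
case: k => [|k] ze ze'; [by right | left].
have e (u : R) : u ^+ (4 * k.+1) = (u ^+ k) ^+ 4 * u ^+ 4.
  by rewrite mulnC exprM (exprS u k) exprMn mulrC.
rewrite !e [(z * z') ^+ _]exprMn /= (exprS z k) (exprS z' k).
by move: (z ^+ k) (z' ^+ k) => zk zk'; rewrite ze ze'; ring.
Qed.

(* Solve z = F d(z). The modular equation of degree 3 for F = z / d(z) puts the pair
   (z, z(x^3)) on the curve g = 0; there z^p / d(z) satisfies the same equation, so by
   rigidity it is F(x^p). *)
Lemma theta_odd_param (d : pexpr -> pexpr) g p : odd p -> good_corr d g p ->
  (forall x y : F2ps, x 0%N = 0 -> y 0%N = 0 ->
     pexpr_eval x y (d PX) 0%N = 1 /\ pexpr_eval x y (d PY) 0%N = 1) ->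
  (forall x y : F2ps, pexpr_eval y x (d PY) = pexpr_eval x y (d PX)) ->
  (forall x : F2ps, Vop 3 (pexpr_eval x x (d PX))
     = pexpr_eval (Vop 3 x) (Vop 3 x) (d PX)) ->
  (forall x y y' : F2ps, pexpr_eval x y (d PX) = pexpr_eval x y' (d PX)) ->
  exists z : F2ps, has_order z 1 /\ z = F * pexpr_eval z z (d PX)
    /\ Vop p F = z ^+ p.-1 * F.
Proof.
move=> op /and3P [/(divides_tabP F2ps_addxx) div1 /(divides_tabP F2ps_addxx) divp hd]
  d1 dsym dV dy.
have [z ze] : exists z : F2ps, z = F * pexpr_eval z 0 (d PX).
  apply: fixpoint_exists => n u v uv; apply: agree_shift.
    by rewrite has_order_theta_odd.2.
  exact: agree_pexpr.
(* The second variable is a dummy in [d PX]; the 0 used for the fixed point is traded for whatever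
   is convenient. *)
rewrite (dy _ _ z) in ze.
have F0 : F 0%N = 0 by rewrite has_order_theta_odd.2.
have z0 : z 0%N = 0 by rewrite ze coefpsM big_ord1 F0 mul0r.
have oz : has_order z 1.
  rewrite ze -[X in has_order _ X]addn0; apply: has_orderM has_order_theta_odd _.
  by apply: order0; case: (d1 z z z0 z0).
exists z; split=> //; split => //.
pose z' := Vop 3 z; have z'0 : z' 0%N = 0 by rewrite /z' /= div0n.
have ze' : z' = Vop 3 F * pexpr_eval z z' (d PY).
  by rewrite dsym {1}/z' {1}ze VopM // dV -/z' (dy _ _ z).
rewrite (dy _ _ z') in ze.
have dd0 : (pexpr_eval z z' (d PX) * pexpr_eval z z' (d PY)) ^+ 4 <> 0.
  have [u v] := d1 z z' z0 z'0.
  exact: has_order_neq0 (has_orderX 4 (has_orderM (order0 u) (order0 v))).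
have corr k : odd k -> pexpr_eval z z' (corr3 d k) =
   (pexpr_eval z z' (d PX) * pexpr_eval z z' (d PY)) ^+ 4 *
   ((z ^+ k.-1 * F) ^+ 4 + (z' ^+ k.-1 * Vop 3 F) ^+ 4
      + (z ^+ k.-1 * F) * (z' ^+ k.-1 * Vop 3 F)).
  by move=> ok; case: (corr3_factor k ze ze') => // k0; rewrite k0 in ok.
(* For k = 1 the factorisation contains the true equation between F and F(x^3), so [corr3 d 1]
   vanishes, and its cofactor is a unit. *)
have G0 : pexpr_eval z z' g = 0.
  have := corr 1%N isT; rewrite /= !expr0 !mul1r theta_odd_rel3 F2ps_addxx mulr0.
  rewrite -[LHS]/(pexpr_eval z z' (corr3 d 1)) div1 => /F2ps_mulf_eq0 [//|h].
  have := pexpr_unit z0 z'0 hd.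
  by rewrite h coefps0 => /esym /eqP.
have := corr p op; rewrite divp G0 mul0r => /esym /F2ps_mulf_eq0 [//|h].
have p0 := odd_gt0 op.
apply: (@rel3_rigid p).
- by rewrite -[X in has_order _ X]muln1; exact: (has_orderV p0 has_order_theta_odd).
- have e : (1 * p.-1 + 1 = p)%N by lia.
  by have := has_orderM (has_orderX p.-1 oz) has_order_theta_odd; rewrite e.
- have /(congr1 (Vop p)) := theta_odd_rel3.
  rewrite VopD // !VopX // [RHS]VopM //.
  by rewrite !Vop_comp // mulnC.
- rewrite VopM // VopX // -/z'; exact: F2ps_add_eq0 h.
Qed.

Lemma pexpr_eval_Vop3 (x : F2ps) e :
  Vop 3 (pexpr_eval x x e) = pexpr_eval (Vop 3 x) (Vop 3 x) e.
Proof.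
elim: e => [|||a IHa b IHb|a IHa b IHb|a IH k].
- reflexivity.
- reflexivity.
- exact: Vop1.
- by rewrite [LHS]VopD IHa IHb.
- by rewrite [LHS]VopM // IHa IHb.
- by rewrite [LHS]VopX // IH.
Qed.

Lemma coef0_add1_pow (f : F2ps) k : f 0%N = 0 -> ((1 + f) ^+ k) 0%N = 1.
Proof.
move=> f0; have o : has_order (1 + f) 0 by split; rewrite // coefpsD f0 coefps1 addr0.
exact: (has_orderX k o).1.
Qed.

(** The parametrization of F after substituting x^3 for x, since F(x^3) = D^3. *)
Lemma D_param d g p : odd p -> good_corr d g p ->
  (forall x y : F2ps, x 0%N = 0 -> y 0%N = 0 ->
     pexpr_eval x y (d PX) 0%N = 1 /\ pexpr_eval x y (d PY) 0%N = 1) ->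
  (forall x y : F2ps, pexpr_eval y x (d PY) = pexpr_eval x y (d PX)) ->
  (forall x y y' : F2ps, pexpr_eval x y (d PX) = pexpr_eval x y' (d PX)) ->
  exists w : F2ps, w = D ^+ 3 * pexpr_eval w w (d PX)
    /\ Vop p D ^+ 3 = w ^+ p.-1 * D ^+ 3.
Proof.
move=> op gd d1 dsym dy.
have [z [oz [ze Fp]]] := theta_odd_param op gd d1 dsym (fun x => pexpr_eval_Vop3 x _) dy.
exists (Vop 3 z); rewrite D_cube; split.
  by rewrite {1}ze VopM // pexpr_eval_Vop3.
rewrite -VopX ?odd_gt0 // D_cube Vop_comp ?odd_gt0 // mulnC -Vop_comp ?odd_gt0 //.
by rewrite Fp VopM // VopX.
Qed.

Lemma coef0_d5 (x : F2ps) : x 0%N = 0 -> ((1 + x) ^+ 6) 0%N = 1.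
Proof. exact: coef0_add1_pow. Qed.

Lemma coef0_d7 (x : F2ps) : x 0%N = 0 -> ((1 + x + x ^+ 2) ^+ 4) 0%N = 1.
Proof.
move=> x0; rewrite -addrA; apply: coef0_add1_pow.
by rewrite coefpsD x0 expr2 coefpsM big_ord1 x0 mul0r addr0.
Qed.

(** Only the cube of D(x^5) is expressed through w and D^3, as 5 - 1 is not divisible by 3. So the
    equation is proved for the cubes, as a polynomial identity modulo [a * d5(w) = w], and the cube
    root is taken by injectivity. *)
Lemma modular5 : D ^+ 6 + Vop 5 D ^+ 6 = D * Vop 5 D.
Proof.
have [w [we B3]] : exists w : F2ps, w = D ^+ 3 * pexpr_eval w w (d5 PX)
    /\ Vop 5 D ^+ 3 = w ^+ 4 * D ^+ 3.
  apply: (D_param _ good_corr5) => // x y x0 y0.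
  by split; apply: coef0_d5.
apply: F2ps_cube_inj; rewrite exprMn B3.
have -> : Vop 5 D ^+ 6 = (w ^+ 4 * D ^+ 3) ^+ 2 by rewrite -B3 -exprM.
have -> : D ^+ 6 = (D ^+ 3) ^+ 2 by rewrite -exprM.
move: (D ^+ 3) we => a we.
have e : pexpr_eval w a (PPow (PAdd (PPow PY 2) (PPow (PMul (PPow PX 4) PY) 2)) 3)
   = pexpr_eval w a (PMul (PPow PY 2) (PPow (PMul PY (d5 PX)) 4)).
  by apply: (pexpr_eq F2ps_addxx); vm_compute.
have e' : pexpr_eval w a (PMul PY (d5 PX)) = w by rewrite {2}we.
transitivity (pexpr_eval w a (PMul (PPow PY 2) (PPow (PMul PY (d5 PX)) 4))).
  by rewrite -e.
have -> : pexpr_eval w a (PMul (PPow PY 2) (PPow (PMul PY (d5 PX)) 4))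
  = a ^+ 2 * (pexpr_eval w a (PMul PY (d5 PX))) ^+ 4 by [].
by rewrite e' (expr2 a) -mulrA; congr (_ * _); apply: mulrC.
Qed.

(** Here (7 - 1)/3 = 2, so the cube root gives D(x^7) = w^2 D itself and no cubing of the equation
    is required. Degree 13 is alike, with w^4. *)
Lemma modular7 : D ^+ 8 + D ^+ 4 * Vop 7 D ^+ 4 + Vop 7 D ^+ 8 = D * Vop 7 D.
Proof.
have [w [we B3]] : exists w : F2ps, w = D ^+ 3 * pexpr_eval w w (d7 PX)
    /\ Vop 7 D ^+ 3 = w ^+ 6 * D ^+ 3.
  apply: (D_param _ good_corr7) => // x y x0 y0.
  by split; apply: coef0_d7.
have -> : Vop 7 D = w ^+ 2 * D.
  by apply: F2ps_cube_inj; rewrite B3 exprMn -exprM.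
move: D we => a we.
have e : pexpr_eval w a (PAdd (PAdd (PPow PY 8) (PMul (PPow PY 4)
     (PPow (PMul (PPow PX 2) PY) 4))) (PPow (PMul (PPow PX 2) PY) 8))
   = pexpr_eval w a (PMul (PPow PY 2) (PPow (PMul (PPow PY 3) (d7 PX)) 2)).
  by apply: (pexpr_eq F2ps_addxx); vm_compute.
have e' : pexpr_eval w a (PMul (PPow PY 3) (d7 PX)) = w by rewrite {2}we.
transitivity (pexpr_eval w a (PMul (PPow PY 2) (PPow (PMul (PPow PY 3) (d7 PX)) 2))).
  by rewrite -e.
have -> : pexpr_eval w a (PMul (PPow PY 2) (PPow (PMul (PPow PY 3) (d7 PX)) 2))
  = a ^+ 2 * (pexpr_eval w a (PMul (PPow PY 3) (d7 PX))) ^+ 2 by [].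
by rewrite e' (expr2 a) -mulrA; congr (_ * _); apply: mulrC.
Qed.

Lemma modular13 :
  (D ^+ 2 + Vop 13 D ^+ 2) * (D ^+ 12 + Vop 13 D ^+ 12) = D * Vop 13 D.
Proof.
have [w [we B3]] : exists w : F2ps, w = D ^+ 3 * pexpr_eval w w (d13 PX)
    /\ Vop 13 D ^+ 3 = w ^+ 12 * D ^+ 3.
  apply: (D_param _ good_corr13) => // x y x0 y0.
  have h (u : F2ps) : u 0%N = 0 -> ((1 + u) ^+ 6 * (1 + u + u ^+ 2) ^+ 4) 0%N = 1.
    by move=> u0; rewrite coefpsM big_ord1 coef0_d5 // coef0_d7 // mulr1.
  by split; apply: h.
have -> : Vop 13 D = w ^+ 4 * D.
  by apply: F2ps_cube_inj; rewrite B3 exprMn -exprM.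
move: D we => a we.
have e : pexpr_eval w a (PMul (PAdd (PPow PY 2) (PPow (PMul (PPow PX 4) PY) 2))
     (PAdd (PPow PY 12) (PPow (PMul (PPow PX 4) PY) 12)))
   = pexpr_eval w a (PMul (PPow PY 2) (PPow (PMul (PPow PY 3) (d13 PX)) 4)).
  by apply: (pexpr_eq F2ps_addxx); vm_compute.
have e' : pexpr_eval w a (PMul (PPow PY 3) (d13 PX)) = w by rewrite {2}we.
transitivity (pexpr_eval w a (PMul (PPow PY 2) (PPow (PMul (PPow PY 3) (d13 PX)) 4))).
  by rewrite -e.
have -> : pexpr_eval w a (PMul (PPow PY 2) (PPow (PMul (PPow PY 3) (d13 PX)) 4))
  = a ^+ 2 * (pexpr_eval w a (PMul (PPow PY 3) (d13 PX))) ^+ 4 by [].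
by rewrite e' (expr2 a) -mulrA; congr (_ * _); apply: mulrC.
Qed.

(** * Recursions for the Hecke operators *)

Notation F2poly := {poly 'F_2}.

Implicit Types (P Q : F2poly) (c : 'F_2) (k n : nat).

Definition ev (P : F2poly) : F2ps := \sum_(i < size P) P`_i *: D ^+ i.

Lemma ev_widen P n : (size P <= n)%N -> ev P = \sum_(i < n) P`_i *: D ^+ i.
Proof.
move=> Pn; rewrite /ev (big_ord_widen n (fun i => P`_i *: D ^+ i) Pn).
rewrite big_mkcond; apply: eq_bigr => i _; case: ltnP => // h.
by rewrite nth_default // scale0r.
Qed.

Lemma evD P Q : ev (P + Q) = ev P + ev Q.
Proof.
rewrite (@ev_widen (P + Q) (maxn (size P) (size Q))) ?size_polyD //.
rewrite (@ev_widen P (maxn (size P) (size Q))) ?leq_maxl //.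
rewrite (@ev_widen Q (maxn (size P) (size Q))) ?leq_maxr //.
by rewrite -big_split; apply: eq_bigr => i _; rewrite coefD scalerDl.
Qed.

Lemma ev0 : ev 0 = 0.
Proof. by rewrite /ev size_poly0 big_ord0. Qed.

Lemma evZ c P : ev (c *: P) = c *: ev P.
Proof.
rewrite (@ev_widen _ (size P)) ?size_scale_leq // /ev scaler_sumr.
by apply: eq_bigr => i _; rewrite coefZ scalerA.
Qed.

Lemma ev_sum (I : Type) (s : seq I) (G : I -> F2poly) :
  ev (\sum_(i <- s) G i) = \sum_(i <- s) ev (G i).
Proof.
elim: s => [|i s IH]; first by rewrite !big_nil ev0.
by rewrite !big_cons evD IH.
Qed.

Lemma evXn k : ev 'X^k = D ^+ k.
Proof.
rewrite /ev size_polyXn big_ord_recr /= coefXn eqxx scale1r big1 ?add0r // => i _.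
by rewrite coefXn ltn_eqF ?scale0r.
Qed.

Lemma ev_mulXn k P : ev ('X^k * P) = D ^+ k * ev P.
Proof.
rewrite (@ev_widen _ (k + size P)); last first.
  by rewrite (leq_trans (size_polyMleq _ _)) // size_polyXn.
rewrite big_split_ord /= big1 ?add0r => [|i _]; last first.
  by rewrite coefXnM ltn_ord scale0r.
rewrite /ev mulr_sumr; apply: eq_bigr => i _.
rewrite coefXnM ltnNge leq_addr /= addKn exprD.
by rewrite [RHS]mulrC -ps_scaleAl mulrC.
Qed.

Lemma F2poly_addxx (P : F2poly) : P + P = 0.
Proof. by apply/polyP => i; rewrite coefD coef0 F2_addxx. Qed.

Lemma polyXn_sum (P : F2poly) : P = \sum_(i < size P) P`_i *: 'X^i.
Proof. by rewrite -[LHS]coefK poly_def. Qed.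

Lemma F2poly_sqrD P Q : (P + Q) ^+ 2 = P ^+ 2 + Q ^+ 2.
Proof. by rewrite sqrrD mulr2n F2poly_addxx addr0. Qed.

Lemma ev_sqr P : ev (P ^+ 2) = ev P ^+ 2.
Proof.
rewrite [in LHS](polyXn_sum P) [in RHS]/ev; elim: (index_enum _) => [|i s IH].
  by rewrite !big_nil !expr0n ev0.
rewrite !big_cons F2poly_sqrD F2ps_sqrD evD IH.
congr (_ + _); case: (F2_cases P`_i) => ->.
  by rewrite !scale0r !expr0n ev0.
by rewrite !scale1r -!exprM evXn.
Qed.

(** D has order 1, so the lowest term of [P] cannot be cancelled: the powers of D are linearly
    independent. *)
Lemma ev_eq0 P : ev P = 0 -> P = 0.
Proof.
move=> evP; apply/eqP; apply: contrapT => /negP P0.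
have ex : exists k, P`_k != 0.
  by exists (size P).-1; rewrite -/(lead_coef P) lead_coef_eq0.
have := congr1 (fun f : F2ps => f (ex_minn ex)) evP.
case: ex_minnP => k Pk kmin; rewrite /ev coefps_sum coefps0.
have kP : (k < size P)%N.
  by rewrite ltnNge; apply: contraNN Pk => h; rewrite nth_default.
rewrite (bigD1 (Ordinal kP)) //= big1 ?addr0 => [|i /eqP ine].
  rewrite ?coefpsZ; have := (has_orderX k has_orderD1).1; rewrite mul1n => ->.
  by rewrite mulr1 => /eqP; apply/negP.
rewrite ?coefpsZ; case: (ltngtP i k) => ik.
- case: (eqVneq P`_i 0) => [->|Pi]; first by rewrite mul0r.
  by have := kmin _ Pi; lia.
- by rewrite (has_orderX i has_orderD1).2 ?mulr0 // mul1n.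
- by case: ine; apply: val_inj.
Qed.

Lemma ev_inj P Q : ev P = ev Q -> P = Q.
Proof.
move=> e; have /ev_eq0 h : ev (P + Q) = 0 by rewrite evD e F2ps_addxx.
by rewrite -[P]addr0 -(F2poly_addxx Q) addrA h add0r.
Qed.

Definition rel := seq (nat * nat).

Definition rel5 : rel := [:: (6, 0)%N; (0, 6)%N; (1, 1)%N].
Definition rel7 : rel := [:: (8, 0)%N; (4, 4)%N; (0, 8)%N; (1, 1)%N].
Definition rel13 : rel := [:: (14, 0)%N; (2, 12)%N; (12, 2)%N; (0, 14)%N; (1, 1)%N].
Definition rel_pow (S : rel) (m : nat) : rel := [seq (m * x.1, m * x.2)%N | x <- S].

(** A relation lists exponent pairs of a polynomial over the field with two elements. Both orders of
    D and D(x^p) are required because the two halves of T_p use one each. *)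
Definition rel_holds (p : nat) (S : rel) :=
  \sum_(x <- S) D ^+ x.1 * Vop p D ^+ x.2 = 0 /\
  \sum_(x <- S) D ^+ x.2 * Vop p D ^+ x.1 = 0.

Lemma Uop_sum p (I : Type) (s : seq I) (G : I -> F2ps) :
  Uop p (\sum_(i <- s) G i) = \sum_(i <- s) Uop p (G i).
Proof. by apply: pserP => n; rewrite !coefps_sum /= coefps_sum. Qed.

(** Multiply the equation by D^k and apply U_p: by the projection formula D(x^p)^j leaves as D^j.
    The V_p half is D(x^p)^k times the exchanged equation. *)
Lemma hecke_rel p S k : (0 < p)%N -> rel_holds p S ->
  \sum_(x <- S) D ^+ x.2 * hecke p (D ^+ (k + x.1)) = 0.
Proof.
move=> p0 [h1 h2].
transitivity (Uop p (D ^+ k * \sum_(x <- S) D ^+ x.1 * Vop p D ^+ x.2)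
   + Vop p D ^+ k * \sum_(x <- S) D ^+ x.2 * Vop p D ^+ x.1).
  rewrite !mulr_sumr Uop_sum -big_split; apply: eq_bigr => x _ /=.
  rewrite heckeE mulrDr; congr (_ + _).
    by rewrite mulrA -exprD [_ * Vop p D ^+ _]mulrC -VopX // Uop_VM.
  by rewrite VopX // exprD mulrCA.
rewrite h1 h2 !mulr0 addr0; exact: pserP.
Qed.

Section Char2Relations.
Variable R : comPzRingType.
Hypothesis addxx : forall c : R, c + c = 0.
Variables a b : R.

Let sum3 (x y z : R) : x + y = z -> x + (y + z) = 0.
Proof. by move=> <-; rewrite addrA addxx. Qed.

Lemma char2_rel5 : a ^+ 6 + b ^+ 6 = a * b ->
  \sum_(x <- rel5) a ^+ x.1 * b ^+ x.2 = 0 /\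
  \sum_(x <- rel5) a ^+ x.2 * b ^+ x.1 = 0.
Proof.
rewrite /rel5 !big_cons !big_nil /= !addr0 !expr0 !expr1 !mulr1 !mul1r => h.
by split; apply: sum3; rewrite // addrC.
Qed.

Lemma char2_rel7 : a ^+ 8 + a ^+ 4 * b ^+ 4 + b ^+ 8 = a * b ->
  \sum_(x <- rel7) a ^+ x.1 * b ^+ x.2 = 0 /\
  \sum_(x <- rel7) a ^+ x.2 * b ^+ x.1 = 0.
Proof.
rewrite /rel7 !big_cons !big_nil /= !addr0 !expr0 !expr1 !mulr1 !mul1r => h.
split; rewrite addrA; apply: sum3; rewrite // -h.
by rewrite [b ^+ 8 + _]addrC [LHS]addrC addrA.
Qed.

Lemma char2_rel13 : (a ^+ 2 + b ^+ 2) * (a ^+ 12 + b ^+ 12) = a * b ->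
  \sum_(x <- rel13) a ^+ x.1 * b ^+ x.2 = 0 /\
  \sum_(x <- rel13) a ^+ x.2 * b ^+ x.1 = 0.
Proof.
rewrite /rel13 !big_cons !big_nil /= !addr0 !expr0 !expr1 !mulr1 !mul1r => h.
split; rewrite 2!addrA; apply: sum3; rewrite -h; ring.
Qed.

End Char2Relations.

Lemma rel_holds5 : rel_holds 5 rel5.
Proof. exact: (char2_rel5 F2ps_addxx modular5). Qed.

Lemma rel_holds7 : rel_holds 7 rel7.
Proof. exact: (char2_rel7 F2ps_addxx modular7). Qed.

Lemma rel_holds13 : rel_holds 13 rel13.
Proof. exact: (char2_rel13 F2ps_addxx modular13). Qed.

(** Two facts are propagated along the recursion: T_p lowers degree, and it multiplies exponents by
    p modulo 24. *)
Definition good_coefs p k Q :=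
  forall e, Q`_e != 0 -> (e < k)%N && (e == p * k %[mod 24]).

Definition liftable p k := exists Q, ev Q = hecke p (D ^+ k) /\ good_coefs p k Q.

Definition good_rel p n (S : rel) :=
  all (fun x => [&& x.1 < n, x.1 + x.2 <= n & x.2 + p * x.1 == p * n %[mod 24]]%N) S.

Lemma good_coefsD p k P Q : good_coefs p k P -> good_coefs p k Q ->
  good_coefs p k (P + Q).
Proof.
move=> h1 h2 e; rewrite coefD; case: (eqVneq P`_e 0) => [->|/h1 //].
by rewrite add0r => /h2.
Qed.

Lemma good_coefs0 p k : good_coefs p k 0.
Proof. by move=> e; rewrite coef0 eqxx. Qed.

Lemma coef_sqr P e : (P ^+ 2)`_e = if odd e then 0 else P`_e./2.
Proof.
rewrite expr2 coefM (@sum_sym _ F2_addxx e (fun i j => P`_i * P`_j)).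
  by case: ifP => // _; rewrite F2_sqr.
by move=> i j; rewrite mulrC.
Qed.

Lemma liftable_rec p n S : odd p -> (0 < n)%N ->
  rel_holds p ((n, 0%N) :: S) -> good_rel p n S ->
  (forall k, (k < n)%N -> liftable p k) -> forall k, liftable p k.
Proof.
move=> op n0 rh gS base; elim/ltn_ind => k IH; rewrite /liftable.
case: (ltnP k n) => [/base //|nk].
have := hecke_rel (k - n) (odd_gt0 op) rh; rewrite big_cons /= expr0 mul1r subnK //.
move=> /F2ps_add_eq0 ->.
elim: S gS {rh} => [|[i j] S IHS] gS.
  by exists 0; rewrite big_nil ev0; split => //; apply: good_coefs0.
move: gS => /= /andP [/and3P [ilt ij /eqP res] /IHS [Q [eQ gQ]]].
have [|P [eP gP]] := IH (k - n + i)%N; first by lia.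
exists ('X^j * P + Q); rewrite big_cons evD ev_mulXn eP eQ; split => //.
apply: good_coefsD => // e; rewrite coefXnM; case: ltnP => // je /gP /andP [c1 /eqP c2].
apply/andP; split; first by lia.
apply/eqP; rewrite -(subnKC je) -modnDmr c2 modnDmr.
rewrite mulnDr addnCA -modnDmr res modnDmr -mulnDr subnK //.
Qed.

Lemma liftable_double p k : odd p -> liftable p k -> liftable p k.*2.
Proof.
move=> op [Q [eQ gQ]]; exists (Q ^+ 2).
rewrite -muln2 exprM hecke_sqr // ev_sqr eQ; split => // e.
rewrite coef_sqr; case: ifP => // oe /gQ /andP [c1 /eqP c2].
have ee : e = (e./2 * 2)%N by rewrite muln2 even_halfK ?oe.
apply/andP; split; first by lia.
by apply/eqP; rewrite ee mulnA -modnMml c2 modnMml.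
Qed.

(** * Values on small powers of D *)

Lemma theta_coef a (P : pred nat) N : (0 < a)%N ->
  Vop a (theta P) N = 1 <-> exists2 m, P m & (a * m ^ 2 = N)%N.
Proof.
move=> a0; rewrite (@Vop_theta _ _ N) //; split=> [h|[m Pm e]].
  apply: contrapT => nex; move: h; rewrite big1 => [/eqP //|m /andP [Pm /eqP e]].
  by case: nex; exists m.
have mN : (m < N.+1)%N by have := leq_sq m; nia.
rewrite (bigD1 (Ordinal mN)) /=; last by rewrite Pm e eqxx.
rewrite big1 ?addr0 // => i /andP [/andP [_ /eqP ie] /eqP ne].
case: ne; apply: val_inj => /=; apply/eqP.
by rewrite -(eqn_exp2r _ _ (isT : 0 < 2)%N) -(eqn_pmul2l a0) ie e.
Qed.

Lemma F2_eq (c d : 'F_2) : (c = 1 <-> d = 1) -> c = d.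
Proof.
case: (F2_cases c) => ->; case: (F2_cases d) => -> // [h1 h2].
- by have /eqP := h2 erefl.
- by have /eqP := h1 erefl.
Qed.

(* p n = a m^2 forces p | m, so the two parts of T_p agree. *)
Lemma hecke_theta p a (P : pred nat) : prime p -> coprime p a -> (0 < a)%N ->
  (forall m, P (p * m)%N = P m) -> hecke p (Vop a (theta P)) = 0.
Proof.
move=> pp cpa a0 Pp; have p0 := prime_gt0 pp.
apply: pserP => n; rewrite coefps0 heckeE coefpsD.
suff -> : Uop p (Vop a (theta P)) n = Vop p (Vop a (theta P)) n by rewrite F2_addxx.
apply: F2_eq; rewrite -[Uop p _ n]/(Vop a (theta P) (p * n)%N).
rewrite Vop_comp // !theta_coef ?muln_gt0 ?p0 //; split=> [[m Pm e]|[m Pm e]].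
  have /dvdnP [m' mE] : (p %| m)%N.
    have : (p %| a * m ^ 2)%N by rewrite e dvdn_mulr.
    by rewrite Gauss_dvdr // Euclid_dvdX // andbT.
  exists m'; first by rewrite -Pp mulnC -mE.
  by apply/eqP; rewrite -(eqn_pmul2l p0) -e mE; apply/eqP; nia.
by exists (p * m)%N; rewrite ?Pp // -e; nia.
Qed.

Lemma hecke_D1 p : prime p -> (3 < p)%N -> hecke p (D ^+ 1) = 0.
Proof.
move=> pp p3; have cp : coprime p 6.
  rewrite prime_coprime //; apply/negP => p6.
  by have := dvdn_leq (isT : 0 < 6)%N p6; case: p pp p3 p6 => [|[|[|[|[|[|[|p]]]]]]].
rewrite expr1 D_theta.
have -> : theta (fun n => odd n && ~~ (3 %| n)%N)
  = Vop 1 (theta (fun n => odd n && ~~ (3 %| n)%N)).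
  by apply: pserP => n; rewrite /= dvd1n divn1.
apply: hecke_theta; rewrite ?coprimen1 // => m.
by rewrite -!coprime6 coprimeMl cp.
Qed.

Lemma hecke_D3 p : prime p -> (3 < p)%N -> hecke p (D ^+ 3) = 0.
Proof.
move=> pp p3; have op : odd p by case/even_prime: pp => // p2; rewrite p2 in p3.
rewrite D_cube; apply: hecke_theta => // [|m]; last by rewrite oddM op.
by rewrite prime_coprime // dvdn_prime2 //; lia.
Qed.

Lemma liftable_zero p k : hecke p (D ^+ k) = 0 -> liftable p k.
Proof. by rewrite /liftable => ->; exists 0; rewrite ev0; split => //; apply: good_coefs0. Qed.

Lemma liftable_D p k : (1 < k)%N -> (1 == p * k %[mod 24])%N ->
  hecke p (D ^+ k) = D -> liftable p k.
Proof.
rewrite /liftable => k1 r ->; exists 'X; rewrite -[X in ev X]expr1 evXn expr1; split => // e.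
by rewrite coefX; case: (eqVneq e 1%N) => [->|_]; rewrite ?eqxx // k1 r.
Qed.

Lemma F2ps_mul_eq_sqr (d f : F2ps) : d * f = f ^+ 2 -> f = 0 \/ f = d.
Proof.
move=> e; have : f * (f + d) = 0.
  by rewrite mulrDr [f * d]mulrC e -expr2 F2ps_addxx.
by case/F2ps_mulf_eq0 => [|/F2ps_add_eq0]; [left|right].
Qed.

Lemma hecke_powM2 p k : odd p -> hecke p (D ^+ (k * 2)) = hecke p (D ^+ k) ^+ 2.
Proof. by move=> op; rewrite exprM hecke_sqr. Qed.

Lemma hecke_DX_coef1 p : (1 < p)%N -> hecke p (D ^+ p) 1%N = 1.
Proof.
move=> p1 /=; rewrite muln1 dvdn1 gtn_eqF // addr0.
by have := (has_orderX p has_orderD1).1; rewrite mul1n.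
Qed.

Lemma hecke_D0 p : (0 < p)%N -> hecke p (D ^+ 0) = 0.
Proof.
move=> p0; rewrite expr0 heckeE Vop1 // -(Vop1 p0) UopV //.
by rewrite Vop1 // F2ps_addxx.
Qed.

Lemma hecke_even0 p k : odd p -> hecke p (D ^+ k) = 0 ->
  hecke p (D ^+ (k * 2)) = 0.
Proof. by move=> op h; rewrite hecke_powM2 // h expr0n. Qed.

(** The recursion for exponent 10 closes on itself, as T_5(D^10) is the square of T_5(D^5). The
    resulting quadratic equation has the solutions 0 and D, and the coefficient of x decides. *)
Lemma hecke5_D5 : hecke 5 (D ^+ 5) = D.
Proof.
have s4 : hecke 5 (D ^+ 4) = 0.
  exact: (@hecke_even0 5 2 isT (@hecke_even0 5 1 isT (hecke_D1 (isT : prime 5) isT))).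
have s10 : hecke 5 (D ^+ 10) = hecke 5 (D ^+ 5) ^+ 2 := @hecke_powM2 5 5 isT.
have := @hecke_rel 5 rel5 4 isT rel_holds5.
rewrite /rel5 !big_cons big_nil /= !addnE /= s4 s10 mulr0 add0r addr0 expr0 expr1 mul1r.
move=> /F2ps_add_eq0/esym/F2ps_mul_eq_sqr [] // e.
by have := @hecke_DX_coef1 5 isT; rewrite e coefps0 => /eqP.
Qed.

Lemma hecke7_D5 : hecke 7 (D ^+ 5) = 0.
Proof.
have s2 := @hecke_even0 7 1 isT (hecke_D1 (isT : prime 7) isT).
have s3 : hecke 7 (D ^+ 3) = 0 := hecke_D3 (isT : prime 7) isT.
have s6 : hecke 7 (D ^+ 6) = 0 := @hecke_even0 7 3 isT s3.
have s10 : hecke 7 (D ^+ 10) = hecke 7 (D ^+ 5) ^+ 2 := @hecke_powM2 7 5 isT.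
have := @hecke_rel 7 rel7 2 isT rel_holds7.
rewrite /rel7 !big_cons big_nil /= !addnE /= s2 s3 s6 s10 !mulr0 !addr0 expr0 mul1r.
exact: F2ps_expr_eq0.
Qed.

Lemma hecke7_D7 : hecke 7 (D ^+ 7) = D.
Proof.
have s6 : hecke 7 (D ^+ 6) = 0.
  exact: (@hecke_even0 7 3 isT (hecke_D3 (isT : prime 7) isT)).
have s10 : hecke 7 (D ^+ 10) = 0 := @hecke_even0 7 5 isT hecke7_D5.
have s14 : hecke 7 (D ^+ 14) = hecke 7 (D ^+ 7) ^+ 2 := @hecke_powM2 7 7 isT.
have := @hecke_rel 7 rel7 6 isT rel_holds7.
rewrite /rel7 !big_cons big_nil /= !addnE /= s6 s10 s14 !mulr0 !add0r addr0 expr0 mul1r expr1.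
move=> /F2ps_add_eq0/esym/F2ps_mul_eq_sqr [] // e.
by have := @hecke_DX_coef1 7 isT; rewrite e coefps0 => /eqP.
Qed.

Lemma has_order_pos (f : F2ps) a : f 0%N = 0 -> has_order f a -> (0 < a)%N.
Proof. by case: a => // f0 [h _]; move: h; rewrite f0 => /eqP. Qed.

Lemma coef0_hecke p f : hecke p f 0%N = 0.
Proof. by rewrite /= dvdn0 muln0 div0n F2_addxx. Qed.

Section VanishingSums.
Variables (R : comPzRingType) (a b c e : R).
Lemma sum_z4 : a + b * 0 + c * 0 + e * 0 = a. Proof. by rewrite !mulr0 !addr0. Qed.
Lemma sum_z6 : a + b * 0 + c + e * 0 = a + c. Proof. by rewrite !mulr0 !addr0. Qed.
Lemma sum_z8 : a + b + c + e * 0 = a + b + c. Proof. by rewrite !mulr0 !addr0. Qed.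
Lemma sum_z10 : 0 + b * 0 + c + e = c + e. Proof. by rewrite !mulr0 !add0r. Qed.
Lemma sum_z12 : a + b + c * 0 + e * 0 = a + b. Proof. by rewrite !mulr0 !addr0. Qed.
End VanishingSums.

(* The relation at k = 4, 8, 10 gives d s5 = s9^2, d s9 = s11^2 + d^2 s5^4 + d^12 s5^2
   and d s11 = d^2 s11^2 + d^14 s5^2; comparing orders forces s9 = 0. *)
Lemma rec13_small (s : nat -> F2ps) (d : F2ps) : has_order d 1 ->
  (forall k, s k 0%N = 0) -> (forall k, s (k * 2)%N = s k ^+ 2) ->
  s 1%N = 0 -> s 3%N = 0 ->
  (forall k, s (k + 14)%N + d ^+ 12 * s (k + 2)%N + d ^+ 2 * s (k + 12)%N
     + d ^+ 14 * s k = d * s (k + 1)%N) ->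
  [/\ s 5%N = 0, s 7%N = 0, s 9%N = 0, s 11%N = 0 & s 13%N = 0 \/ s 13%N = d].
Proof.
move=> od s0 dbl s1 s3 rl.
have ev0 k : s k = 0 -> s (k * 2)%N = 0 by move=> h; rewrite dbl h expr0n.
have s4 : s 4%N = 0 := ev0 2%N (ev0 1%N s1).
have s8 : s 8%N = 0 := ev0 4%N s4.
have s16 : s 16%N = 0 := ev0 8%N s8.
have s6 : s 6%N = 0 := ev0 3%N s3.
have s12 : s 12%N = 0 := ev0 6%N s6.
have s24 : s 24%N = 0 := ev0 12%N s12.
have s10 : s 10%N = s 5%N ^+ 2 := dbl 5%N.
have s20 : s 20%N = (s 5%N ^+ 2) ^+ 2 by rewrite -s10 -(dbl 10%N).
have s18 : s 18%N = s 9%N ^+ 2 := dbl 9%N.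
have s22 : s 22%N = s 11%N ^+ 2 := dbl 11%N.
have s14 : s 14%N = s 7%N ^+ 2 := dbl 7%N.
have s26 : s 26%N = s 13%N ^+ 2 := dbl 13%N.
have r4 : s 18%N + d ^+ 12 * s 6%N + d ^+ 2 * s 16%N + d ^+ 14 * s 4%N = d * s 5%N := rl 4%N.
have r6 : s 20%N + d ^+ 12 * s 8%N + d ^+ 2 * s 18%N + d ^+ 14 * s 6%N = d * s 7%N := rl 6%N.
have r8 : s 22%N + d ^+ 12 * s 10%N + d ^+ 2 * s 20%N + d ^+ 14 * s 8%N = d * s 9%N := rl 8%N.
have r10 : s 24%N + d ^+ 12 * s 12%N + d ^+ 2 * s 22%N + d ^+ 14 * s 10%N = d * s 11%N := rl 10%N.
have r12 : s 26%N + d ^+ 12 * s 14%N + d ^+ 2 * s 24%N + d ^+ 14 * s 12%N = d * s 13%N := rl 12%N.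
move: (s 18%N) (s 6%N) (s 16%N) (s 4%N) (s 20%N) (s 8%N) (s 22%N) (s 10%N) (s 24%N) (s 12%N) (s 26%N) (s 14%N)
  s18 s6 s16 s4 s20 s8 s22 s10 s24 s12 s26 s14 r4 r6 r8 r10 r12.
move=> x1 x2 x3 x4 x5 x6 x7 x8 x9 x10 x11 x12 -> -> -> -> -> -> -> -> -> -> -> ->.
move: (s 5%N) (s 7%N) (s 9%N) (s 11%N) (s 13%N) (s0 5%N) (s0 7%N) (s0 9%N) (s0 11%N) (s0 13%N).
move=> s5 s7 s9 s11 s13 z5 z7 z9 z11 z13.
rewrite sum_z4 sum_z6 sum_z8 sum_z10 sum_z12 => r4 r6 r8 r10 r12.
have s9z : s9 = 0.
  apply: contrapT => /has_order_ex [a9 o9].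
  have a9p := has_order_pos z9 o9.
  have [a5 o5] : exists a, has_order s5 a.
    apply: has_order_ex => h5; rewrite h5 mulr0 in r4.
    exact: has_order_neq0 (has_orderX 2 o9) r4.
  have e5 : (1 + a5 = a9 * 2)%N.
    by apply: has_order_inj (has_orderM od o5) _; rewrite -r4; apply: has_orderX.
  have [a11 o11] : exists a, has_order s11 a.
    apply: has_order_ex => h11; rewrite h11 expr0n mulr0 mulr0 add0r in r10.
    exact: has_order_neq0 (has_orderM (has_orderX 14 od) (has_orderX 2 o5)) r10.
  have e11 : (1 * 14 + a5 * 2 = 1 + a11)%N.
    apply: has_order_inj (has_orderM (has_orderX 14 od) (has_orderX 2 o5)) _.
    have -> : d ^+ 14 * s5 ^+ 2 = d * s11 + d ^+ 2 * s11 ^+ 2.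
      by rewrite -r10 addrC addrA F2ps_addxx add0r.
    apply: has_orderD (has_orderM od o11) _ => i hi.
    by rewrite (has_orderM (has_orderX 2 od) (has_orderX 2 o11)).2 //; lia.
  have := (has_orderM od o9).1; rewrite -r8 !coefpsD.
  rewrite (has_orderX 2 o11).2; last by lia.
  rewrite (has_orderM (has_orderX 12 od) (has_orderX 2 o5)).2; last by lia.
  rewrite (has_orderM (has_orderX 2 od) (has_orderX 2 (has_orderX 2 o5))).2; last by lia.
  by rewrite !addr0 => /eqP.
have D0 := has_order_neq0 od.
have Dz (f : F2ps) : d * f = 0 -> f = 0 by case/F2ps_mulf_eq0.
have s5z : s5 = 0 by apply: Dz; rewrite -r4 s9z expr0n.
have s11z : s11 = 0.
  rewrite s5z s9z !expr0n !mulr0 !addr0 in r8.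
  exact: F2ps_expr_eq0 r8.
have s7z : s7 = 0.
  by apply: Dz; rewrite -r6 s5z s9z !expr0n !mulr0 !addr0.
split=> //.
rewrite s7z expr0n !mulr0 !addr0 in r12.
exact: F2ps_mul_eq_sqr (esym r12).
Qed.

Lemma hecke13_small : [/\ hecke 13 (D ^+ 5) = 0, hecke 13 (D ^+ 7) = 0,
  hecke 13 (D ^+ 9) = 0, hecke 13 (D ^+ 11) = 0 & hecke 13 (D ^+ 13) = D].
Proof.
have [|||||] := @rec13_small (fun k => hecke 13 (D ^+ k)) D has_orderD1.
- by move=> k; apply: coef0_hecke.
- by move=> k; apply: hecke_powM2.
- exact: (hecke_D1 (isT : prime 13) isT).
- exact: (hecke_D3 (isT : prime 13) isT).
- move=> k; have := @hecke_rel 13 rel13 k isT rel_holds13.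
  rewrite /rel13 !big_cons big_nil /= addn0 addr0 expr0 mul1r expr1.
  by rewrite !addrA => /F2ps_add_eq0.
move=> s5 s7 s9 s11 s13; split=> //; case: s13 => // e.
by have := @hecke_DX_coef1 13 isT; rewrite e coefps0 => /eqP.
Qed.

Lemma lift5 k : liftable 5 k.
Proof.
apply: (@liftable_rec 5 6 (behead rel5)) => //; first exact: rel_holds5.
have s1 : liftable 5 1 := liftable_zero (hecke_D1 (isT : prime 5) isT).
have s2 : liftable 5 2 := liftable_double (isT : odd 5) s1.
move=> [|[|[|[|[|[|]]]]]] // _.
- exact: liftable_zero (hecke_D0 (isT : 0 < 5)%N).
- exact: liftable_zero (hecke_D3 (isT : prime 5) isT).
- exact: liftable_double (isT : odd 5) s2.
- exact: (@liftable_D 5 5 isT isT hecke5_D5).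
Qed.

Lemma lift7 k : liftable 7 k.
Proof.
apply: (@liftable_rec 7 8 (behead rel7)) => //; first exact: rel_holds7.
have s1 : liftable 7 1 := liftable_zero (hecke_D1 (isT : prime 7) isT).
have s2 : liftable 7 2 := liftable_double (isT : odd 7) s1.
have s3 : liftable 7 3 := liftable_zero (hecke_D3 (isT : prime 7) isT).
move=> [|[|[|[|[|[|[|[|]]]]]]]] // _.
- exact: liftable_zero (hecke_D0 (isT : 0 < 7)%N).
- exact: liftable_double (isT : odd 7) s2.
- exact: liftable_zero hecke7_D5.
- exact: liftable_double (isT : odd 7) s3.
- exact: (@liftable_D 7 7 isT isT hecke7_D7).
Qed.

Lemma lift13 k : liftable 13 k.
Proof.
apply: (@liftable_rec 13 14 (behead rel13)) => //; first exact: rel_holds13.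
have [h5 h7 h9 h11 h13] := hecke13_small.
have s1 : liftable 13 1 := liftable_zero (hecke_D1 (isT : prime 13) isT).
have dbl j : liftable 13 j -> liftable 13 j.*2 := @liftable_double 13 j isT.
have s3 : liftable 13 3 := liftable_zero (hecke_D3 (isT : prime 13) isT).
have s2 : liftable 13 2 := dbl 1%N s1.
have s4 : liftable 13 4 := dbl 2%N s2.
have s6 : liftable 13 6 := dbl 3%N s3.
have s5 : liftable 13 5 := liftable_zero h5.
move=> [|[|[|[|[|[|[|[|[|[|[|[|[|[|]]]]]]]]]]]]]] // _.
- exact: liftable_zero (hecke_D0 (isT : 0 < 13)%N).
- exact: liftable_zero.
- exact: dbl 4%N s4.
- exact: liftable_zero.
- exact: dbl 5%N s5.
- exact: liftable_zero.
- exact: dbl 6%N s6.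
- exact: (@liftable_D 13 13 isT isT h13).
Qed.

(** * The Hecke operators on polynomials in D *)

Lemma hecke_sum p (I : Type) (s : seq I) (G : I -> F2ps) :
  hecke p (\sum_(i <- s) G i) = \sum_(i <- s) hecke p (G i).
Proof.
elim: s => [|i s IH]; first by rewrite !big_nil hecke0.
by rewrite !big_cons heckeD IH.
Qed.

Record polyop (p : nat) (T : F2poly -> F2poly) : Prop := PolyOp {
  polyopE : forall P, ev (T P) = hecke p (ev P);
  polyop_good : forall k, good_coefs p k (T 'X^k) }.

Lemma polyop_exists p : (forall k, liftable p k) -> exists T, polyop p T.
Proof.
move=> /choice [q hq]; pose T P := \sum_(i < size P) P`_i *: q i.
have TE P : ev (T P) = hecke p (ev P).
  rewrite /T ev_sum [in RHS]/ev hecke_sum; apply: eq_bigr => i _.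
  by rewrite evZ heckeZ (hq i).1.
exists T; split=> // k.
have -> : T 'X^k = q k by apply: ev_inj; rewrite TE evXn (hq k).1.
exact: (hq k).2.
Qed.

Section PolyOpTheory.
Variables (p : nat) (T : F2poly -> F2poly).
Hypothesis hT : polyop p T.

Lemma polyopD P Q : T (P + Q) = T P + T Q.
Proof. by apply: ev_inj; rewrite evD !(polyopE hT) evD heckeD. Qed.

Lemma polyop0 : T 0 = 0.
Proof. by apply: ev_inj; rewrite (polyopE hT) ev0 hecke0. Qed.

Lemma polyopZ c P : T (c *: P) = c *: T P.
Proof. by apply: ev_inj; rewrite evZ !(polyopE hT) evZ heckeZ. Qed.

Lemma polyop_sum (I : Type) (s : seq I) (G : I -> F2poly) :
  T (\sum_(i <- s) G i) = \sum_(i <- s) T (G i).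
Proof.
elim: s => [|i s IH]; first by rewrite !big_nil polyop0.
by rewrite !big_cons polyopD IH.
Qed.

Lemma polyop_expand P : T P = \sum_(i < size P) P`_i *: T 'X^i.
Proof.
by rewrite {1}(polyXn_sum P) polyop_sum; apply: eq_bigr => i _; rewrite polyopZ.
Qed.

Lemma polyop_coef P e : (T P)`_e = \sum_(i < size P) P`_i * (T 'X^i)`_e.
Proof.
by rewrite polyop_expand coef_sum; apply: eq_bigr => i _; rewrite coefZ.
Qed.

Lemma polyop_sqr P : odd p -> T (P ^+ 2) = T P ^+ 2.
Proof.
by move=> op; apply: ev_inj; rewrite ev_sqr !(polyopE hT) ev_sqr hecke_sqr.
Qed.

Lemma polyop_rel S k : (0 < p)%N -> rel_holds p S ->
  \sum_(x <- S) 'X^(x.2) * T 'X^(k + x.1) = 0.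
Proof.
move=> p0 h; apply: ev_inj; rewrite ev0 ev_sum -[RHS](hecke_rel k p0 h).
by apply: eq_bigr => x _; rewrite ev_mulXn (polyopE hT) evXn.
Qed.

Lemma polyop_coef_ne0 P e : (T P)`_e != 0 ->
  exists i, [/\ P`_i != 0, (e < i)%N & e = p * i %[mod 24]].
Proof.
rewrite polyop_coef => nz.
have [[i Pi /= nz']|none] := pselect (exists2 i : 'I_(size P), P`_i != 0 & (T 'X^i)`_e != 0).
  by have /andP [h1 /eqP h2] := polyop_good hT nz'; exists i.
case/eqP: nz; apply: big1 => i _; apply/eqP; apply: contrapT => /negP.
by rewrite mulf_eq0 negb_or => /andP [h1 h2]; apply: none; exists i.
Qed.

End PolyOpTheory.

Lemma rel_holds_pow p S q : (0 < p)%N -> rel_holds p S ->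
  rel_holds p (rel_pow S (2 ^ q)).
Proof.
move=> p0 [h1 h2].
have frob (I : Type) (s : seq I) (G : I -> F2ps) :
    \sum_(i <- s) G i ^+ (2 ^ q) = (\sum_(i <- s) G i) ^+ (2 ^ q).
  elim: s => [|i s IH]; last by rewrite !big_cons IH F2ps_exprD.
  by rewrite !big_nil expr0n gtn_eqF ?expn_gt0.
split; rewrite /rel_pow big_map /=.
  rewrite (eq_bigr (fun x => (D ^+ x.1 * Vop p D ^+ x.2) ^+ (2 ^ q))).
    by rewrite frob h1 expr0n gtn_eqF ?expn_gt0.
  by move=> x _; rewrite exprMn -!exprM ![(2 ^ q * _)%N]mulnC.
rewrite (eq_bigr (fun x => (D ^+ x.2 * Vop p D ^+ x.1) ^+ (2 ^ q))).
  by rewrite frob h2 expr0n gtn_eqF ?expn_gt0.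
by move=> x _; rewrite exprMn -!exprM ![(2 ^ q * _)%N]mulnC.
Qed.

(** The product of the degree 7 relation over a -> omega a, omega running through the cube roots of
    unity. With x = a^8, y = a^4 b^4 + ab, z = b^8 it is x^3 + y^3 + z^3 - 3xyz, and only exponents
    divisible by 3 survive. *)
Definition rel7_cubed : rel := [:: (24, 0)%N; (6, 6)%N; (3, 3)%N; (0, 24)%N].

Lemma char2_rel7_cubed (R : comNzRingType) (addxx : forall c : R, c + c = 0) (a b : R) :
  a ^+ 8 + a ^+ 4 * b ^+ 4 + b ^+ 8 = a * b ->
  \sum_(x <- rel7_cubed) a ^+ x.1 * b ^+ x.2 = 0.
Proof.
move=> h; rewrite /rel7_cubed !big_cons big_nil /= !expr0 !mulr1 mul1r addr0.
pose g := PAdd (PAdd (PAdd (PPow PX 8) (PPow (PMul PX PY) 4)) (PPow PY 8)) (PMul PX PY).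
pose t := PAdd (PPow PX 24) (PAdd (PMul (PPow PX 6) (PPow PY 6))
  (PAdd (PMul (PPow PX 3) (PPow PY 3)) (PPow PY 24))).
have dv : divides_tab (pexpr_tab g) (pexpr_tab t) by vm_compute.
have g0 : pexpr_eval a b g = 0 by rewrite /= exprMn h addxx.
by have := divides_tabP addxx a b dv; rewrite g0 mul0r.
Qed.

Lemma rel_holds7_cubed : rel_holds 7 rel7_cubed.
Proof.
have h := modular7; split; first exact: (char2_rel7_cubed F2ps_addxx h).
have h' : Vop 7 D ^+ 8 + Vop 7 D ^+ 4 * D ^+ 4 + D ^+ 8 = Vop 7 D * D.
  rewrite [RHS]mulrC -h [Vop 7 D ^+ 4 * _]mulrC [Vop 7 D ^+ 8 + _]addrC.
  by rewrite [LHS]addrC addrA.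
rewrite -[RHS](char2_rel7_cubed F2ps_addxx h').
by apply: eq_bigr => x _; rewrite mulrC.
Qed.

Lemma char2_add4 (V : zmodType) (addxx : forall c : V, c + c = 0) (a b c d : V) :
  a + (b + (c + d)) = 0 -> a = b + c + d.
Proof.
rewrite -[b + c + d]addrA; move: (b + (c + d)) => x h.
have e : a = a + (x + x) by rewrite addxx addr0.
by rewrite e addrA h add0r.
Qed.

(** * Coefficients of T_7 on the exponents 6m+5 *)

Section LeadingT7.
Variable T : F2poly -> F2poly.
Hypothesis hT : polyop 7 T.

Let s k : F2poly := T 'X^k.

Lemma T7_rec k : s (k + 8) = 'X^4 * s (k + 4) + 'X * s (k + 1) + 'X^8 * s k.
Proof.
have := polyop_rel hT k isT rel_holds7.
rewrite /rel7 !big_cons big_nil /= addr0 addn0 expr0 mul1r expr1.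
move=> /(char2_add4 F2poly_addxx) e; rewrite /s e addrAC.
by [].
Qed.

Lemma T7_zero k : hecke 7 (D ^+ k) = 0 -> s k = 0.
Proof. by move=> h; apply: ev_inj; rewrite ev0 (polyopE hT) evXn. Qed.

Lemma T7_double k : s k = 0 -> s (k * 2) = 0.
Proof. by move=> h; rewrite /s exprM (polyop_sqr hT) // -/(s k) h expr0n. Qed.

(* The rows of T_7(t^k) for k = n+7, ..., n. *)
Fixpoint T7_rows (n : nat) : seq (seq bool) :=
  if n is n'.+1 then
    let l := T7_rows n' in
    row_add (ncons 4 false (nth [::] l 3))
      (row_add (false :: nth [::] l 6) (ncons 8 false (nth [::] l 7))) :: l
  else [:: [:: false; true]; [::]; [::]; [::]; [::]; [::]; [::]; [::]].

Lemma row_eval_ncons n r : row_eval ('X : F2poly) (ncons n false r) = 'X^n * row_eval 'X r.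
Proof.
elim: n => [|n IH]; first by rewrite mul1r.
by rewrite /= add0r IH exprS mulrA.
Qed.

Lemma coef_row r e : (row_eval ('X : F2poly) r)`_e = (nth false r e)%:R.
Proof.
elim: r e => [|b r IH] [|e] /=; rewrite ?coef0 //.
- by rewrite coefD coefXM addr0; case: b; rewrite ?coef1 ?coef0.
- by rewrite coefD coefXM IH /=; case: b; rewrite ?coef1 ?coef0 add0r.
Qed.

Lemma T7_rowsE n i : (i <= n + 7)%N ->
  s i = row_eval 'X (nth [::] (T7_rows n) (n + 7 - i)).
Proof.
have s1 : s 1 = 0 := T7_zero (hecke_D1 (isT : prime 7) isT).
have s3 : s 3 = 0 := T7_zero (hecke_D3 (isT : prime 7) isT).
elim: n i => [|n IH] i hi.
  case: i hi => [|[|[|[|[|[|[|[|]]]]]]]] // _.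
  - exact: T7_zero (hecke_D0 (isT : 0 < 7)%N).
  - exact: T7_double s1.
  - exact: (@T7_double 2 (T7_double s1)).
  - exact: T7_zero hecke7_D5.
  - exact: (@T7_double 3 s3).
  - apply: ev_inj; rewrite (polyopE hT) evXn hecke7_D7.
    have -> : nth [::] (T7_rows 0) (0 + 7 - 7) = ncons 1 false [:: true] by [].
    by rewrite row_eval_ncons /= mulr0 addr0 mulr1 evXn expr1.
case: (ltngtP i (n + 8)) => h; last first.
- have -> : (n.+1 + 7 - i = 0)%N by lia.
  have -> : nth [::] (T7_rows n.+1) 0 = row_add (ncons 4 false (nth [::] (T7_rows n) 3))
    (row_add (ncons 1 false (nth [::] (T7_rows n) 6)) (ncons 8 false (nth [::] (T7_rows n) 7))).
    by [].
  rewrite h T7_rec !(row_evalD F2poly_addxx) !row_eval_ncons expr1.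
  rewrite (IH (n + 4)%N) ?(IH (n + 1)%N) ?(IH n); try lia.
  have -> : (n + 7 - (n + 4) = 3)%N by lia.
  have -> : (n + 7 - (n + 1) = 6)%N by lia.
  have -> : (n + 7 - n = 7)%N by lia.
  by rewrite addrA.
- by lia.
rewrite IH; last by lia.
by have -> : (n.+1 + 7 - i = (n + 7 - i).+1)%N by lia.
Qed.

Definition c7 m e : 'F_2 := (s (6 * m + 5))`_(6 * e + 5).

Lemma c7_small m e : (m < 8)%N -> c7 m e = (e \in nth [::] lead_table m)%:R.
Proof.
(* [T7_rows 40] reaches the exponent 47 = 6 * 7 + 5. The bound 53 = 6 * 8 + 5 on the row sizes
   disposes of every e from 8 on. *)
move=> m8; rewrite /c7 (@T7_rowsE 40); last by lia.
rewrite coef_row.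
have chk : all (fun m => all (fun e => nth false (nth [::] (T7_rows 40) (40 + 7 - (6 * m + 5)))
    (6 * e + 5) == (e \in nth [::] lead_table m)) (iota 0 8) &&
    (size (nth [::] (T7_rows 40) (40 + 7 - (6 * m + 5))) <= 53)%N &&
    all (fun e => e < 8)%N (nth [::] lead_table m)) (iota 0 8) by vm_compute.
have mi : m \in iota 0 8 by rewrite mem_iota.
have /andP [/andP [h1 h2] h3] := allP chk m mi; clear chk.
case: (ltnP e 8) => e8.
  have ei : e \in iota 0 8 by rewrite mem_iota.
  by rewrite (eqP (allP h1 e ei)).
rewrite nth_default; last by lia.
have /negbTE -> : e \notin nth [::] lead_table m; last by [].
by apply/negP => /(allP h3); rewrite ltnNge e8.
Qed.

Lemma c7_rec j m e :
  c7 (m + 8 * 2 ^ j) e = shifted c7 (2 * 2 ^ j) (m + 2 * 2 ^ j) e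
    + shifted c7 (2 ^ j) (m + 2 ^ j) e + shifted c7 (8 * 2 ^ j) m e.
Proof.
have := polyop_rel hT (6 * m + 5) isT (rel_holds_pow j.+1 (isT : 0 < 7)%N rel_holds7_cubed).
rewrite /rel_pow big_map /rel7_cubed !big_cons big_nil /= addr0.
move=> /(congr1 (fun P : F2poly => P`_(6 * e + 5))).
rewrite !coefD coef0 !coefXnM muln0 ltn0 subn0 addn0.
rewrite -!/(s _).
have sh a b : ((if (6 * e + 5 < 6 * a)%N then 0 else (s (6 * b + 5))`_(6 * e + 5 - 6 * a))
   = shifted c7 a b e).
  rewrite /shifted /c7; case: (leqP a e) => h; last by rewrite ifT //; lia.
  by rewrite ifF; [congr (_`_ _); lia|lia].
rewrite !expnS -/(2 ^ j)%N.
have -> : (6 * m + 5 + 2 * 2 ^ j * 24 = 6 * (m + 8 * 2 ^ j) + 5)%N by lia.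
have -> : (6 * m + 5 + 2 * 2 ^ j * 6 = 6 * (m + 2 * 2 ^ j) + 5)%N by lia.
have -> : (6 * m + 5 + 2 * 2 ^ j * 3 = 6 * (m + 2 ^ j) + 5)%N by lia.
have -> : (2 * 2 ^ j * 6 = 6 * (2 * 2 ^ j))%N by lia.
have -> : (2 * 2 ^ j * 3 = 6 * 2 ^ j)%N by lia.
have -> : (2 * 2 ^ j * 24 = 6 * (8 * 2 ^ j))%N by lia.
rewrite !sh -/(c7 _ _) => /(char2_add4 F2_addxx).
by [].
Qed.

End LeadingT7.

(** * Theta series of Gaussian integers *)

Notation gint := (int * int)%type.

Section GaussianTheta.

Import Order.TTheory Num.Theory.

Definition gmul (u z : gint) : gint :=
  (u.1 * z.1 - u.2 * z.2, u.1 * z.2 + u.2 * z.1).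
Definition gconj (z : gint) : gint := (z.1, - z.2).
Definition gnorm (z : gint) : int := z.1 * z.1 + z.2 * z.2.

Lemma gmulA : associative gmul.
Proof. by move=> [a b] [c d] [e f]; rewrite /gmul /=; congr (_, _); ring. Qed.

Lemma gmulC : commutative gmul.
Proof. by move=> [a b] [c d]; rewrite /gmul /=; congr (_, _); ring. Qed.

Lemma gconjM u z : gconj (gmul u z) = gmul (gconj u) (gconj z).
Proof. by case: u z => [a b] [c d]; rewrite /gconj /gmul /=; congr (_, _); ring. Qed.

Definition irange (N : nat) : seq int := [seq (i%:Z - N%:Z) | i <- iota 0 (2 * N).+1].
Definition box (N : nat) : seq gint := [seq (a, b) | a <- irange N, b <- irange N].

Lemma mem_irange N (a : int) : (a \in irange N) = (`|a| <= N)%N.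
Proof.
apply/mapP/idP => [[i]|h].
  by rewrite mem_iota => hi ->; lia.
by exists (absz (a + N%:Z)); rewrite ?mem_iota; lia.
Qed.

Lemma irange_uniq N : uniq (irange N).
Proof. by rewrite map_inj_uniq ?iota_uniq // => i j; lia. Qed.

Lemma mem_box N (z : gint) : (z \in box N) = (`|z.1| <= N)%N && (`|z.2| <= N)%N.
Proof.
rewrite -!mem_irange; case: z => a b /=; apply/allpairsP/andP.
  by move=> [[x y]] [/= hx hy [-> ->]].
by move=> [ha hb]; exists (a, b).
Qed.

Lemma box_uniq N : uniq (box N).
Proof. by rewrite allpairs_uniq ?irange_uniq // => -[a b] [c d] _ _ [-> ->]. Qed.

(* Each associate class {z, -z, iz, -iz} of odd norm has one representative here. *)
Definition primary (z : gint) : bool := ((z.1 %% 4)%Z == 1) && ((z.2 %% 2)%Z == 0).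

Definition shell (n : nat) : seq gint :=
  [seq z <- box n | primary z && (gnorm z == n%:Z)].

Lemma gnorm_box (z : gint) n : gnorm z = n%:Z -> z \in box n.
Proof.
rewrite mem_box /gnorm => h.
have sq (a : int) : (absz a <= absz (a * a)%R)%N.
  by rewrite abszM; case: (absz a) => // k; rewrite leq_pmulr.
have sq0 (a : int) : 0 <= a * a by nia.
have := sq z.1; have := sq z.2; have := sq0 z.1; have := sq0 z.2.
by move: (z.1 * z.1) (z.2 * z.2) h => x y h; lia.
Qed.

Lemma mem_shell n z : (z \in shell n) = primary z && (gnorm z == n%:Z).
Proof.
rewrite mem_filter andb_idr // => /andP [_ /eqP]; exact: gnorm_box.
Qed.

Lemma shell_uniq n : uniq (shell n).
Proof. by rewrite filter_uniq ?box_uniq. Qed.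

Definition gtheta (c : gint -> 'F_2) : F2ps := Pser (fun n => \sum_(z <- shell n) c z).

Lemma gtheta_ext (c c' : gint -> 'F_2) : (forall z, primary z -> c z = c' z) -> gtheta c = gtheta c'.
Proof.
move=> h; apply: pserP => n /=; rewrite big_seq [RHS]big_seq; apply: eq_bigr => z.
by rewrite mem_shell => /andP [/h].
Qed.

(** A prime of norm 13, with the associate chosen so that multiplication by it preserves
    [primary]. *)
Definition gpi : gint := (- 3, - 2).
Section Pi.
Variable eps : int.
Hypothesis eps1 : eps * eps = 1.
Let p : gint := (- 3, - (2 * eps)).
(** Up to sign the real part of conj(p) w: on numbers of norm divisible by 13 this detects
    divisibility by p. The sign [eps] treats the prime and its conjugate together. *)
Let dv (w : gint) := (13 %| 3 * w.1 + 2 * eps * w.2)%Z.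

Lemma eps_cases : eps = 1 \/ eps = -1.
Proof. by nia. Qed.

Lemma shell_pi n : perm_eq [seq gmul p z | z <- shell n] [seq w <- shell (13 * n) | dv w].
Proof.
apply: uniq_perm.
- rewrite map_inj_in_uniq ?shell_uniq // => -[a b] [c d] _ _ [] /= h1 h2.
  by case: eps_cases => e; move: h1 h2; rewrite e => h1 h2; congr (_, _); lia.
- by rewrite filter_uniq ?shell_uniq.
move=> w; rewrite mem_filter mem_shell; apply/mapP/andP.
  move=> [[a b]]; rewrite mem_shell /primary /gnorm /dv /= => /andP [/andP [h1 h2] /eqP h3] ->.
  rewrite /gmul /p /=; case: eps_cases => ->; (split; [by lia|]);
    (apply/andP; split; [by lia|]); apply/eqP; lia.
case: w => a b; rewrite /primary /gnorm /dv /= => -[/dvdzP [s hs] /andP [/andP [h1 h2] /eqP h3]].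
have /dvdzP [t ht] : (13 %| 3 * b - 2 * eps * a)%Z.
  by case: eps_cases => e; move: hs; rewrite e => hs; lia.
exists (- s, - t); last first.
  by case: eps_cases => e; move: hs ht; rewrite /gmul /p e /= => hs ht; congr (_, _); lia.
rewrite mem_shell /primary /gnorm /=.
have n13 : 13 * (s * s + t * t) = a * a + b * b.
  case: eps_cases => e; move: hs ht; rewrite e => hs ht.
  - have : (13 * s) * (13 * s) + (13 * t) * (13 * t) = 13 * (a * a + b * b).
      by rewrite ![13 * _]mulrC -hs -ht; ring.
    lia.
  - have : (13 * s) * (13 * s) + (13 * t) * (13 * t) = 13 * (a * a + b * b).
      by rewrite ![13 * _]mulrC -hs -ht; ring.
    lia.
apply/andP; split; last by apply/eqP; lia.
by case: eps_cases => e; move: hs ht; rewrite e => hs ht; lia.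
Qed.
End Pi.

Definition dvpi (w : gint) := (13 %| 3 * w.1 + 2 * w.2)%Z.
Definition dvpibar (w : gint) := (13 %| 3 * w.1 - 2 * w.2)%Z.
Definition twist (u : gint) (c : gint -> 'F_2) (z : gint) : 'F_2 :=
  c (gmul u z) + c (gmul (gconj u) z).
Definition scale13 (z : gint) : gint := (13 * z.1, 13 * z.2).

Lemma sum_shell_pi n (c : gint -> 'F_2) :
  \sum_(z <- shell n) c (gmul gpi z) = \sum_(w <- shell (13 * n) | dvpi w) c w.
Proof.
rewrite -[RHS]big_filter.
have h : perm_eq [seq gmul gpi z | z <- shell n] [seq w <- shell (13 * n) | dvpi w].
  by have := @shell_pi 1 erefl n; rewrite /dvpi /gpi !mulr1.
by rewrite -(perm_big _ h) big_map.
Qed.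

Lemma sum_shell_pibar n (c : gint -> 'F_2) :
  \sum_(z <- shell n) c (gmul (gconj gpi) z) = \sum_(w <- shell (13 * n) | dvpibar w) c w.
Proof.
rewrite -[RHS]big_filter.
have h : perm_eq [seq gmul (gconj gpi) z | z <- shell n]
    [seq w <- shell (13 * n) | dvpibar w].
  have := @shell_pi (-1) erefl n; rewrite /dvpibar /gpi /gconj /=.
  by congr perm_eq; apply: eq_filter => w; congr (_ %| _)%Z; rewrite mulrN1 mulNr.
by rewrite -(perm_big _ h) big_map.
Qed.

Lemma dvpi_or n w : w \in shell (13 * n) -> dvpi w || dvpibar w.
Proof.
rewrite mem_shell => /andP [_ /eqP h]; rewrite /dvpi /dvpibar.
have : (13 %| (3 * w.1 + 2 * w.2) * (3 * w.1 - 2 * w.2))%Z.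
  have -> : (3 * w.1 + 2 * w.2) * (3 * w.1 - 2 * w.2) = 9 * gnorm w - 13 * (w.2 * w.2).
    by rewrite /gnorm; ring.
  by rewrite h; lia.
by rewrite !dvdzE abszM Euclid_dvdM.
Qed.

Lemma shell_13 m :
  perm_eq [seq scale13 z | z <- shell m] [seq w <- shell (13 * (m * 13)) | dvpi w && dvpibar w].
Proof.
apply: uniq_perm.
- rewrite map_inj_uniq ?shell_uniq // => -[a b] [c d] [] h1 h2; congr (_, _); lia.
- by rewrite filter_uniq ?shell_uniq.
move=> w; rewrite mem_filter mem_shell; apply/mapP/andP.
  move=> [[a b]]; rewrite mem_shell /primary /gnorm => /andP [/andP [h1 h2] /eqP h3] ->.
  rewrite /scale13 /dvpi /dvpibar /=; move: h1 h2 h3 => /= h1 h2 h3.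
  split; first by lia.
  by apply/andP; split; [lia|apply/eqP; lia].
case: w => a b; rewrite /primary /gnorm /dvpi /dvpibar /= => -[/andP [d1 d2] /andP [/andP [h1 h2] /eqP h3]].
have /dvdzP [s hs] : (13 %| a)%Z by lia.
have /dvdzP [t ht] : (13 %| b)%Z by lia.
subst a b; exists (s, t); last by rewrite /scale13 /=; congr (_, _); lia.
rewrite mem_shell /primary /gnorm /=.
by apply/andP; split; [lia|apply/eqP; lia].
Qed.

Lemma shell_13_empty n w : ~~ (13 %| n)%N -> w \in shell (13 * n) ->
  dvpi w && dvpibar w = false.
Proof.
case: w => a b n13; rewrite mem_shell => /andP [_ /eqP h]; apply/negP => /andP [d1 d2].
case/negP: n13; move: h d1 d2; rewrite /gnorm /dvpi /dvpibar /= => h d1 d2.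
have /dvdzP [s hs] : (13 %| a)%Z by lia.
have /dvdzP [t ht] : (13 %| b)%Z by lia.
rewrite hs ht in h.
have : (n%:Z = 13 * (s * s + t * t)) by lia.
move: (s * s + t * t) => x hx; lia.
Qed.

(** Every number of norm 13n is divisible by pi or its conjugate. Those divisible by both are the
    13z: the twist counts them twice, and the two halves U and V of T_13 count them once each. *)
Lemma hecke13_gtheta (c : gint -> 'F_2) : (forall z, c (scale13 z) = c z) ->
  hecke 13 (gtheta c) = gtheta (twist gpi c).
Proof.
move=> c13; apply: pserP => n.
rewrite -[RHS]/(\sum_(z <- shell n) twist gpi c z) /twist big_split /=.
rewrite sum_shell_pi sum_shell_pibar.
rewrite [X in _ = X + _]big_mkcond [X in _ = _ + X]big_mkcond -big_split /=.
transitivity (\sum_(w <- shell (13 * n)) (c w + (if dvpi w && dvpibar w then c w else 0))).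
  rewrite big_split /=; congr (_ + _).
  case: (boolP (13 %| n)%N) => [/dvdnP [m ->]|n13].
    rewrite -[RHS]big_mkcond -[RHS]big_filter -[RHS](perm_big _ (shell_13 m)) [RHS]big_map mulnK //.
    by apply: eq_bigr => z _; rewrite c13.
  rewrite big_seq big1 // => w hw; by rewrite (shell_13_empty n13 hw).
rewrite big_seq [RHS]big_seq; apply: eq_bigr => w /dvpi_or.
by case: (dvpi w); case: (dvpibar w); rewrite //= ?addr0 ?add0r.
Qed.

Fixpoint gpow2 (k : nat) : gint := if k is k'.+1 then gmul (gpow2 k') (gpow2 k') else gpi.

(** Applying the twist by u twice gives cross terms in u conj(u), which occur twice and cancel; only
    u^2 and its conjugate remain. *)
Lemma hecke13_iter k (c : gint -> 'F_2) : (forall z, c (scale13 z) = c z) ->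
  iter (2 ^ k) (hecke 13) (gtheta c) = gtheta (twist (gpow2 k) c).
Proof.
elim: k c => [|k IH] c c13; first exact: hecke13_gtheta.
rewrite expnS mul2n -addnn iterD (IH c c13) IH; last first.
  move=> z; rewrite /twist.
  have g13 u : gmul u (scale13 z) = scale13 (gmul u z).
    by rewrite /gmul /scale13 /=; congr (_, _); ring.
  by rewrite !g13 !c13.
apply: gtheta_ext => z _; rewrite /twist /= gconjM !gmulA.
move: (gpow2 k) => u; rewrite [gmul (gconj u) u]gmulC -addrA.
by rewrite [X in _ + X]addrA F2_addxx add0r.
Qed.

(* The residues 1, 2 of a/b modulo 3 single out one of the two numbers a + ib, a - ib. *)
Definition mod3cond (s : int) (z : gint) : bool :=
  ~~ (3 %| z.1)%Z && (3 %| z.1 - s * z.2)%Z.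

Definition exact_dvd (K b : int) : bool := (K %| b)%Z && ~~ (2 * K %| b)%Z.

Definition cn (n : nat) (s : int) (z : gint) : 'F_2 :=
  (exact_dvd (2 ^+ n) z.2 && mod3cond s z)%:R.

Lemma mod3cond13 s z : s = 1 \/ s = -1 -> mod3cond s (scale13 z) = mod3cond s z.
Proof. by case: z => a b [] -> ; rewrite /mod3cond /scale13 /=; lia. Qed.

Lemma dvd_pow2_odd j (u b : int) : (u %% 2)%Z = 1 ->
  (2 ^+ j %| u * b)%Z = (2 ^+ j %| b)%Z.
Proof.
move=> uo; rewrite Gauss_dvdzr // coprimezXl // coprimezE coprime2n.
by move: uo; lia.
Qed.

Lemma exact_dvd_odd j u b : (u %% 2)%Z = 1 ->
  exact_dvd (2 ^+ j) (u * b) = exact_dvd (2 ^+ j) b.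
Proof. by move=> uo; rewrite /exact_dvd -exprS !dvd_pow2_odd. Qed.

Lemma cn13 n s z : s = 1 \/ s = -1 -> cn n s (scale13 z) = cn n s z.
Proof. by move=> hs; rewrite /cn mod3cond13 // exact_dvd_odd. Qed.

(** Squaring u + iv has imaginary part 2uv, so each step gains one factor 2. Modulo 3, pi itself is
    a multiple of i, while all later powers are real and invertible. *)
Lemma gpow2_shape k : exists u w : int,
  [/\ gpow2 k = (u, 2 ^+ k.+1 * w), (u %% 2)%Z = 1, (w %% 2)%Z = 1 &
      if k is 0 then u = -3 /\ w = -1 else ~~ (3 %| u)%Z /\ (3 %| w)%Z].
Proof.
elim: k => [|k [u [w [ge uo wo h]]]]; first by exists (-3), (-1).
pose K : int := 2 ^+ k.
exists (u * u - 4 * (K * K * w * w)), (u * w); rewrite /= ge /gmul /= !exprS -/K.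
have [x ux] : exists x, u = 2 * x + 1 by exists (u %/ 2)%Z; lia.
have [y wy] : exists y, w = 2 * y + 1 by exists (w %/ 2)%Z; lia.
split.
- by congr (_, _); ring.
- have -> : u * u - 4 * (K * K * w * w) = 2 * (2 * x * x + 2 * x - 2 * (K * K * w * w)) + 1.
    by rewrite ux; ring.
  by lia.
- have -> : u * w = 2 * (2 * x * y + x + y) + 1 by rewrite ux wy; ring.
  by lia.
case: k @K h {ge} => [|k] K [h1 h2].
  by rewrite /K h1 h2.
have /dvdzP [v hv] := h2; split; last by rewrite dvdz_mull.
have -> : u * u - 4 * (K * K * w * w) = u * u - 3 * (4 * (K * K * w * v)).
  by rewrite hv; ring.
have [t [ht|ht]] : exists t, u = 3 * t + 1 \/ u = 3 * t + 2.
  by exists (u %/ 3)%Z; lia.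
  have -> : u * u = 3 * (3 * t * t + 2 * t) + 1 by rewrite ht; ring.
  by lia.
have -> : u * u = 3 * (3 * t * t + 4 * t + 1) + 1 by rewrite ht; ring.
by lia.
Qed.

(** If 2^j exactly divides b, both numbers are divisible by 2^(j+1), and as they differ by 2^(j+1)
    times an odd number exactly one is divisible by 2^(j+2). For other b neither is exactly
    divisible by 2^(j+1). *)
Lemma exact_dvd_xor j (u w a b : int) : (u %% 2)%Z = 1 -> (w %% 2)%Z = 1 -> (a %% 2)%Z = 1 ->
  exact_dvd (2 ^+ j.+1) (u * b + 2 ^+ j * w * a)
    (+) exact_dvd (2 ^+ j.+1) (u * b - 2 ^+ j * w * a) = exact_dvd (2 ^+ j) b.
Proof.
move=> uo wo ao; set K : int := 2 ^+ j.
have K0 : K != 0 by rewrite expf_neq0.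
case: (boolP (K %| b)%Z) => [/dvdzP [b' bE]|Kb]; last first.
  have no (y : int) : (K %| y)%Z -> exact_dvd (2 ^+ j.+1) (u * b + y) = false.
    move=> Ky; apply/negbTE/negP => /andP [h _]; case/negP: Kb.
    rewrite -(dvd_pow2_odd j b uo) -/K.
    have : (K %| u * b + y)%Z by apply: dvdz_trans h; rewrite exprS dvdz_mull.
    by rewrite rpredDr.
  rewrite !no ?rpredN // -?mulrA ?dvdz_mulr //.
  by rewrite /exact_dvd (negbTE Kb).
have e1 : u * b + K * w * a = K * (u * b' + w * a) by rewrite bE; ring.
have e2 : u * b - K * w * a = K * (u * b' - w * a) by rewrite bE; ring.
have KK x : (K %| K * x)%Z by rewrite dvdz_mulr.
rewrite e1 e2 bE /exact_dvd exprS -/K [b' * K]mulrC KK /=.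
rewrite [2 * (2 * K)]mulrA ![_ * K]mulrC !dvdz_mul2l //.
have [x ux] : exists x, u = 2 * x + 1 by exists (u %/ 2)%Z; lia.
have [y wy] : exists y, w = 2 * y + 1 by exists (w %/ 2)%Z; lia.
have [t ta] : exists t, a = 2 * t + 1 by exists (a %/ 2)%Z; lia.
have -> : w * a = 2 * (2 * y * t + y + t) + 1 by rewrite wy ta; ring.
have -> : u * b' = 2 * (x * b') + b' by rewrite ux; ring.
move: (2 * y * t + y + t) (x * b') => p q.
have D2 (n : int) : (2 %| n)%Z = ((n %% 2)%Z == 0) by lia.
have D4 (n : int) : (2 * 2 %| n)%Z = ((n %% 4)%Z == 0) by lia.
rewrite !D2 !D4 {uo wo ao e1 e2 ux wy ta bE K0 x y t u w a b}.
by lia.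
Qed.

(** The link from n = 2 to n = 1 multiplies by pi, a multiple of i modulo 3, which exchanges the
    conditions a = b and a = -b; the other links preserve them. *)
Definition sgn3 (n : nat) : int := if n == 1%N then -1 else 1.

Lemma twist_cn k z : primary z -> twist (gpow2 k) (cn k.+2 (sgn3 k.+2)) z = cn k.+1 (sgn3 k.+1) z.
Proof.
case: z => a b /andP [/= /eqP pa pb].
have [u [w [-> uo wo h]]] := gpow2_shape k.
rewrite /twist /cn /gmul /gconj /=.
have m3 : mod3cond 1 (u * a - 2 ^+ k.+1 * w * b, u * b + 2 ^+ k.+1 * w * a)
      = mod3cond (sgn3 k.+1) (a, b) /\
    mod3cond 1 (u * a - - (2 ^+ k.+1 * w) * b, u * b + - (2 ^+ k.+1 * w) * a)
      = mod3cond (sgn3 k.+1) (a, b).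
  case: k h => [|k] [h1 h2]; rewrite /mod3cond /sgn3 /=.
    by rewrite h1 h2 expr1; split; lia.
  have /dvdzP [v hv] := h2; rewrite hv; move: (2 ^+ k.+2 : int) => K.
  have [t ht] : exists t, u = 3 * t + 1 \/ u = 3 * t + 2 by exists (u %/ 3)%Z; lia.
  have q1 : K * (v * 3) * b = 3 * (K * v * b) by ring.
  have q2 : K * (v * 3) * a = 3 * (K * v * a) by ring.
  rewrite !mulNr q1 q2; move: (K * v * b) (K * v * a) => x y.
  case: ht => ->; rewrite !mulrDl -!mulrA; move: (t * a) (t * b) => p q; split; lia.
rewrite /sgn3 /= m3.1 m3.2 mulNr.
have := @exact_dvd_xor k.+1 u w a b uo wo; move=> <-; last by lia.
by case: (exact_dvd _ _); case: (exact_dvd _ _); case: (mod3cond _ _); apply: val_inj.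
Qed.

Lemma sum_seq_bij (T1 T2 : eqType) (s1 : seq T1) (s2 : seq T2) (f : T1 -> T2) :
  uniq s1 -> uniq s2 -> {in s1 &, injective f} ->
  (forall y, y \in s2 <-> exists2 x, x \in s1 & y = f x) ->
  \sum_(x <- s1) (1 : 'F_2) = \sum_(y <- s2) 1.
Proof.
move=> u1 u2 fi fs; have h : perm_eq (map f s1) s2.
  apply: uniq_perm; rewrite ?map_inj_in_uniq // => y.
  by apply/mapP/idP => /fs.
by rewrite -(perm_big _ h) big_map.
Qed.

Lemma absz_cases (c : int) : (absz c)%:Z = c \/ (absz c)%:Z = - c.
Proof. by lia. Qed.

Lemma primary_absz (a : int) : (a %% 4)%Z == 1 ->
  (if (absz a %% 4 == 1)%N then (absz a)%:Z else - (absz a)%:Z) = a.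
Proof. by case: ifP; lia. Qed.

Lemma mod3_excl (a y : int) : ~~ (3 %| a)%Z -> (3 %| a - y)%Z -> (3 %| a + y)%Z -> False.
Proof. by lia. Qed.

Lemma absz_sq (x : int) : (absz x)%:Z * (absz x)%:Z = x * x.
Proof.
by have [->|->] := absz_cases x; rewrite // mulrNN.
Qed.

Lemma odd_absz4 (a : int) : (a %% 4)%Z == 1 -> ~~ (3 %| a)%Z ->
  odd (absz a) && ~~ (3 %| absz a)%N.
Proof. by lia. Qed.

Lemma odd_absz2 (a : int) : ~~ (2 %| a)%Z -> ~~ (3 %| a)%Z ->
  odd (absz a) && ~~ (3 %| absz a)%N.
Proof. by lia. Qed.

Lemma pow2_int n : (2 ^+ n : int) = (2 ^ n)%N%:Z.
Proof. by elim: n => [|n IH] //; rewrite exprS IH expnS PoszM. Qed.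

(** D^(1+4^n) is D times D(x^(4^n)), so its coefficients count the a^2 + 4^n y^2 = N with a, y
    positive and prime to 6. Each pair is one Gaussian integer a + ib with b = 2^n y up to signs. *)
Lemma gtheta_D n (s : int) : (0 < n)%N -> s = 1 \/ s = -1 -> gtheta (cn n s) = D ^+ (1 + 4 ^ n).
Proof.
move=> n0 hs; have -> : (4 ^ n = 2 ^ (2 * n))%N by rewrite expnM.
rewrite exprD expr1 F2ps_pow2E.
have D1 : D = Vop 1 D by apply: pserP => m; rewrite /= dvd1n divn1.
rewrite {1}D1 D_theta; apply: pserP => N.
rewrite theta_mul ?expn_gt0 // -[LHS]/(\sum_(z <- shell N) cn n s z) /cn.
set K := (2 ^ (2 * n))%N.
pose Q (z : gint) := exact_dvd (2 ^+ n) z.2 && mod3cond s z.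
transitivity (\sum_(z <- [seq z <- shell N | Q z]) (1 : 'F_2)).
  rewrite [RHS]big_filter [RHS]big_mkcond; apply: eq_bigr => z _.
  by rewrite -/(Q z); case: (Q z).
pose P m := odd m && ~~ (3 %| m)%N.
pose S (x : 'I_N.+1 * 'I_N.+1) :=
  [&& P x.1, P x.2 & (1 * x.1 ^ 2 + K * x.2 ^ 2 == N)%N].
rewrite -[RHS]/(\sum_(x | S x) 1) -[RHS]big_filter.
pose k : int := 2 ^+ n.
have kE : k = (2 ^ n)%N%:Z := pow2_int n.
have k0 : (0 < 2 ^ n)%N by rewrite expn_gt0.
have KE : K = (2 ^ n * 2 ^ n)%N by rewrite /K mul2n -addnn expnD.
have k3 : (k %% 3)%Z != 0.
  have : ~~ (3 %| k)%Z by rewrite kE dvdzE /= Euclid_dvdX.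
  by lia.
(* The sign of the real part is forced by [primary], that of the imaginary part by the condition
   modulo 3. *)
pose f (x : 'I_N.+1 * 'I_N.+1) : gint :=
  let a : int := if (x.1 %% 4 == 1)%N then x.1%:Z else - x.1%:Z in
  let b : int := k * x.2%:Z in
  (a, if (3 %| a - s * b)%Z then b else - b).
apply/esym/(sum_seq_bij (f := f)).
- by rewrite filter_uniq // index_enum_uniq.
- by rewrite filter_uniq // shell_uniq.
- move=> [x1 x2] [y1 y2] _ _ [] /= e1 e2.
  have e3 : k * x2%:Z = k * y2%:Z.
    have p1 : 0 <= k * x2%:Z by rewrite kE -PoszM.
    have p2 : 0 <= k * y2%:Z by rewrite kE -PoszM.
    move: (k * x2%:Z) (k * y2%:Z) p1 p2 e2 => u v p1 p2.
    by do 2!case: ifP => _; lia.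
  congr (_, _); apply: val_inj => /=.
    by move: e1; do 2!case: ifP => _; lia.
  by move: e3; rewrite kE -!PoszM => -[] /eqP; rewrite eqn_pmul2l // => /eqP.
move=> [a b]; rewrite mem_filter mem_shell; split.
  move=> /andP [/andP [/andP [/= kb kb2] /andP [/= a3 ab3]] /andP [/andP [/= pa pb] /eqP]].
  rewrite /gnorm /= => ab.
  have /dvdzP [c bE] := kb.
  have c2 : ~~ (2 %| c)%Z.
    by apply: contraNN kb2 => c2; rewrite bE dvdz_mul.
  rewrite -/k in bE; subst b.
  have aN : (absz a < N.+1)%N.
    by have := @gnorm_box (a, c * k) N ab; rewrite mem_box /= => /andP [].
  have cN : (absz c < N.+1)%N.
    have := @gnorm_box (a, c * k) N ab; rewrite mem_box /= abszM => /andP [_ h].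
    rewrite ltnS; apply: leq_trans h.
    by rewrite leq_pmulr // kE absz_nat.
  exists (Ordinal aN, Ordinal cN).
    rewrite mem_filter mem_index_enum andbT /S /P /=.
    have c3 : ~~ (3 %| c)%Z.
      apply/negP => /dvdzP [d cd]; move: a3 ab3; rewrite cd.
      have -> : s * (d * 3 * k) = 3 * (s * d * k) by ring.
      by move: (s * d * k) => x; clear; lia.
    apply/and3P; split; [exact: odd_absz4|exact: odd_absz2|].
    have : (absz a * absz a + (2 ^ n * 2 ^ n) * (absz c * absz c))%N%:Z = N%:Z.
      rewrite -ab PoszD !PoszM -kE !absz_sq; ring.
    by rewrite KE mul1n -!mulnn => -[->].
  rewrite /f /=.
  have ea : (if (absz a %% 4 == 1)%N then (absz a)%:Z else - (absz a)%:Z) = a.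
    exact: primary_absz.
  rewrite ea; congr (_, _).
  have [hc|hc] := absz_cases c.
    by rewrite hc mulrC [k * c]mulrC ifT.
  rewrite hc mulrN opprK mulrC ifF //; apply/negbTE/negP => h.
  by apply: (mod3_excl a3 ab3); move: h; rewrite mulrN opprK [k * c]mulrC.
move=> [[x1 x2]]; rewrite mem_filter => /andP [/and3P [/= /andP [o1 t1] /andP [o2 t2] /eqP e] _].
have y3 : ~~ (3 %| k * x2%:Z)%Z.
  by rewrite dvdzE abszM Euclid_dvdM // negb_or -!dvdzE; apply/andP; split; lia.
rewrite /f /=; set a' := (if _ then _ else _) => -[aE]; set y := k * _ in y3 *.
have a3 : ~~ (3 %| a')%Z by rewrite /a'; case: ifP; lia.
have pa : (a' %% 4)%Z == 1 by rewrite /a'; case: ifP; lia.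
have aa : a' * a' = x1%:Z * x1%:Z by rewrite /a'; case: ifP => _; lia.
move: a' aE a3 pa aa => a' -> a3 pa aa bE.
have [bb b3] : (b = y \/ b = - y) /\ (3 %| a' - s * b)%Z.
  rewrite bE; case: ifP => h; split; [by left|by []|by right|].
  by case: hs h => ->; lia.
have bbe : b * b = y * y by case: bb => ->; lia.
have kb : exact_dvd k b.
  have k00 : k != 0 by rewrite kE; lia.
  rewrite /exact_dvd; suff : (k %| y)%Z && ~~ (2 * k %| y)%Z.
    by case: bb => -> //; rewrite !rpredN.
  rewrite dvdz_mulr // mulrC dvdz_mul2l //; lia.
have kb2 : (k %| b)%Z by case/andP: kb.
rewrite /Q /= -/k kb /mod3cond /= a3 b3 /primary /gnorm /= pa /=.
apply/andP; split.
  have : (2 %| b)%Z.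
    apply: dvdz_trans kb2; rewrite /k -(prednK n0) exprS dvdz_mulr //.
  by lia.
rewrite aa bbe /y; apply/eqP; have := congr1 Posz e.
by rewrite mul1n -!mulnn KE PoszD !PoszM -kE => <-; ring.
Qed.

Lemma hecke13_chain k :
  iter (2 ^ k) (hecke 13) (D ^+ (1 + 4 ^ k.+2)) = D ^+ (1 + 4 ^ k.+1).
Proof.
have sg n : sgn3 n = 1 \/ sgn3 n = -1 by rewrite /sgn3; case: ifP; [right|left].
rewrite -(@gtheta_D k.+2 (sgn3 k.+2)) // -(@gtheta_D k.+1 (sgn3 k.+1)) //.
rewrite hecke13_iter => [|z]; last exact: cn13.
by apply: gtheta_ext => z; apply: twist_cn.
Qed.

(* Composing the links 2^(n-1) + ... + 2 + 1 = 2^n - 1 of the chain. *)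
Lemma hecke13_chain_full n :
  iter (2 ^ n - 1) (hecke 13) (D ^+ (1 + 4 ^ n.+1)) = D ^+ 5.
Proof.
elim: n => [|n IH] //.
have -> : (2 ^ n.+1 - 1 = (2 ^ n - 1) + 2 ^ n)%N.
  by rewrite expnS; have := expn_gt0 2 n; lia.
by rewrite iterD hecke13_chain IH.
Qed.

End GaussianTheta.

(** * The common kernel of T_7 and T_13 *)

Definition in_W5 P := forall e, P`_e != 0 -> (e %% 6 = 5)%N.

Lemma in_W5D P Q : in_W5 P -> in_W5 Q -> in_W5 (P + Q).
Proof.
move=> h1 h2 e; rewrite coefD; case: (eqVneq P`_e 0) => [->|/h1 //].
by rewrite add0r => /h2.
Qed.

Lemma in_W5Z c P : in_W5 P -> in_W5 (c *: P).
Proof.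
move=> h e; rewrite coefZ; case: (F2_cases c) => ->; first by rewrite mul0r eqxx.
by rewrite mul1r; apply: h.
Qed.

Lemma in_W5_sum (I : Type) (s : seq I) (G : I -> F2poly) :
  (forall i, in_W5 (G i)) -> in_W5 (\sum_(i <- s) G i).
Proof.
move=> h; elim: s => [|i s IH]; first by rewrite big_nil => e; rewrite coef0 eqxx.
by rewrite big_cons; apply: in_W5D.
Qed.

Lemma in_W5Xn k : (k %% 6 = 5)%N -> in_W5 'X^k.
Proof. by move=> h e; rewrite coefXn; case: (eqVneq e k) => [->|_] //; rewrite eqxx. Qed.

Section PolyOpSize.
Variables (p : nat) (T : F2poly -> F2poly).
Hypothesis hT : polyop p T.

Lemma polyop_size P : (size (T P) <= (size P).-1)%N.
Proof.
apply/leq_sizeP => e he; apply/eqP; apply: contraTT he => nz.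
have [i [Pi ei _]] := polyop_coef_ne0 hT nz; rewrite -ltnNge.
have : (i < size P)%N by rewrite ltnNge; apply: contraNN Pi => h; rewrite nth_default.
by lia.
Qed.

Lemma iter_polyop_size n P : (size (iter n T P) <= size P - n)%N.
Proof.
elim: n => [|n IH]; first by rewrite subn0.
by rewrite iterS; have := polyop_size (iter n T P); lia.
Qed.

Lemma iter_polyop_ev n P : ev (iter n T P) = iter n (hecke p) (ev P).
Proof. by elim: n => [|n IH] //; rewrite !iterS (polyopE hT) IH. Qed.

Lemma iter_polyopD n P Q : iter n T (P + Q) = iter n T P + iter n T Q.
Proof. by elim: n => [|n IH] //; rewrite !iterS IH (polyopD hT). Qed.

Lemma iter_polyopZ n c P : iter n T (c *: P) = c *: iter n T P.
Proof. by elim: n => [|n IH] //; rewrite !iterS IH (polyopZ hT). Qed.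

Lemma iter_polyop0 n : iter n T 0 = 0.
Proof. by elim: n => [|n IH] //; rewrite iterS IH (polyop0 hT). Qed.

Lemma iter_polyop_sum n (I : Type) (s : seq I) (G : I -> F2poly) :
  iter n T (\sum_(i <- s) G i) = \sum_(i <- s) iter n T (G i).
Proof.
elim: s => [|i s IH]; first by rewrite !big_nil iter_polyop0.
by rewrite !big_cons iter_polyopD IH.
Qed.

Lemma polyop_W5 P : (p %% 6 = 1)%N -> in_W5 P -> in_W5 (T P).
Proof.
move=> p1 hP e nz; have [i [Pi _ ei]] := polyop_coef_ne0 hT nz.
have i5 := hP _ Pi; have e6 : (e %% 6 = (p * i) %% 6)%N.
  by rewrite -(modn_dvdm e (isT : 6 %| 24)%N) ei modn_dvdm.
by rewrite e6 -modnMml p1 mul1n.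
Qed.

Lemma iter_polyop_W5 n P : (p %% 6 = 1)%N -> in_W5 P -> in_W5 (iter n T P).
Proof. by move=> p1 hP; elim: n => [|n IH] //; rewrite iterS; apply: polyop_W5. Qed.

End PolyOpSize.

Lemma polyop_comm p q Tp Tq P : prime p -> prime q -> p != q ->
  polyop p Tp -> polyop q Tq -> Tp (Tq P) = Tq (Tp P).
Proof.
move=> pp pq ne hp hq; apply: ev_inj.
by rewrite (polyopE hp) !(polyopE hq) (polyopE hp) heckeC.
Qed.

Lemma iter_comm (T : Type) (f g : T -> T) n x :
  (forall x, f (g x) = g (f x)) -> iter n f (g x) = g (iter n f x).
Proof. by move=> fg; elim: n => [|n IH] //; rewrite !iterS IH fg. Qed.

Section Socle.
Variables T7 T13 : F2poly -> F2poly.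
Hypothesis h7 : polyop 7 T7.
Hypothesis h13 : polyop 13 T13.

Lemma T7_13_comm P : T7 (T13 P) = T13 (T7 P).
Proof. exact: (polyop_comm _ (isT : prime 7) (isT : prime 13) isT h7 h13). Qed.

(** Otherwise take the exponent of P of largest weight; its alpha is positive. By [lead_weight] any
    other exponent feeding its leading target weighs at least as much, hence is the same one, as [L]
    exceeds all exponents. So that coefficient of [T7 P] is 1. *)
Lemma T7_inj_alpha P : in_W5 P -> T7 P = 0 ->
  (forall m, alpha m = 0%N -> P`_(6 * m + 5) = 0) -> P = 0.
Proof.
move=> hP TP0 ha; apply/eqP; apply: contrapT => /negP P0.
have lastP : ((size P).-1 < size P)%N by rewrite prednK // size_poly_gt0.
pose L := (16 + size P)%N; have L16 : (16 <= L)%N by rewrite leq_addr.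
pose i0 := Ordinal lastP.
have Pi0 : P`_i0 != 0 by rewrite -/(lead_coef P) lead_coef_eq0.
case: (@arg_maxnP _ i0 (fun i : 'I_(size P) => P`_i != 0)
  (fun i : 'I_(size P) => weight L (i %/ 6)) Pi0) => i Pi imax.
have i5 := hP _ Pi; pose m := (i %/ 6)%N.
have iE : (i : nat) = (6 * m + 5)%N by rewrite /m; lia.
have am : (0 < alpha m)%N.
  by rewrite lt0n; apply: contraNneq Pi => a0; rewrite iE ha.
have [e [ea eb]] := digits_surj (alpha m).-1 (beta m).
have ea' : (alpha e + 1 = alpha m)%N by rewrite ea; lia.
have : (T7 P)`_(6 * e + 5) = 1.
  rewrite (polyop_coef h7) (bigD1 i) //= big1 ?addr0 => [|j /eqP ji].
    rewrite {2}iE -/(c7 T7 m e) (lead_coef_one (c7_small h7) (c7_rec h7)) // mulr1.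
    by case: (F2_cases P`_i) Pi => -> //; rewrite eqxx.
  case: (eqVneq P`_j 0) => [->|Pj]; first by rewrite mul0r.
  have j5 := hP _ Pj; have jE : (j : nat) = (6 * (j %/ 6) + 5)%N by lia.
  rewrite {2}jE -/(c7 T7 (j %/ 6) e); case: (eqVneq (c7 T7 (j %/ 6) e) 0) => [->|].
    by rewrite mulr0.
  move=> /(lead_weight (c7_small h7) (c7_rec h7) L16) hw.
  have wm := imax j Pj; have we : (weight L e + L = weight L m)%N.
    by rewrite /weight eb -ea'; lia.
  case: ji; apply: val_inj => /=; rewrite jE iE; congr (6 * _ + 5)%N.
  have mL : (m < L)%N by apply: leq_ltn_trans (leq_div i 6) (leq_trans (ltn_ord i) (leq_addl _ _)).
  have jL : (j %/ 6 < L)%N by apply: leq_ltn_trans (leq_div j 6) (leq_trans (ltn_ord j) (leq_addl _ _)).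
  apply: (weight_inj L16 jL mL); apply/eqP.
  by rewrite eqn_leq -we hw andbT we; exact: wm.
by rewrite TP0 coef0 => /eqP.
Qed.

(** In the recursion at k = 2^(j+3) the exponents k + 8, k + 4 and k are powers of two times
    exponents already known to be killed. This leaves ['X] times T_7 of exponent k + 1; three
    consecutive cases carry the induction. *)
Lemma T7_D14 n : T7 'X^(1 + 4 ^ n.+1) = 0.
Proof.
have z j : T7 'X^(2 ^ j + 1) = 0 /\ T7 'X^(2 ^ j.+1 + 1) = 0 /\ T7 'X^(2 ^ j.+2 + 1) = 0.
  elim: j => [|j [z0 [z1 z2]]].
    split; last split.
    - exact: (T7_double h7 (T7_zero h7 (hecke_D1 (isT : prime 7) isT))).
    - exact: (T7_zero h7 (hecke_D3 (isT : prime 7) isT)).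
    - exact: (T7_zero h7 hecke7_D5).
  split=> //; split => //.
  have pw (P : F2poly) k : T7 (P ^+ (2 ^ k)) = T7 P ^+ (2 ^ k).
    elim: k => [|k IH]; first by rewrite !expr1.
    by rewrite expnSr !exprM (polyop_sqr h7) // IH.
  have t8 : T7 'X^(2 ^ j.+3 + 8) = 0.
    have -> : (2 ^ j.+3 + 8 = (2 ^ j + 1) * 2 ^ 3)%N by rewrite !expnS; lia.
    by rewrite exprM pw z0 expr0n.
  have t4 : T7 'X^(2 ^ j.+3 + 4) = 0.
    have -> : (2 ^ j.+3 + 4 = (2 ^ j.+1 + 1) * 2 ^ 2)%N by rewrite !expnS; lia.
    by rewrite exprM pw z1 expr0n.
  have t0 : T7 'X^(2 ^ j.+3) = 0.
    rewrite -[(2 ^ j.+3)%N]mul1n exprM pw.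
    by rewrite (T7_zero h7 (hecke_D1 (isT : prime 7) isT)) expr0n gtn_eqF ?expn_gt0.
  have := T7_rec h7 (2 ^ j.+3); rewrite t8 t4 t0 !mulr0 addr0 add0r.
  by move=> /esym/eqP; rewrite mulf_eq0 polyX_eq0 => /eqP.
have -> : (1 + 4 ^ n.+1 = 2 ^ (2 * n).+2 + 1)%N by rewrite addnC -[4%N]/(2 ^ 2)%N -expnM; congr (2 ^ _ + 1)%N; lia.
by case: (z (2 * n)%N) => _ [].
Qed.

Lemma in_W5_D14 n : in_W5 'X^(1 + 4 ^ n.+1).
Proof.
apply: in_W5Xn; elim: n => // n IH; rewrite expnS; lia.
Qed.

Lemma T13_chain n : iter (2 ^ n - 1) T13 'X^(1 + 4 ^ n.+1) = 'X^5.
Proof. by apply: ev_inj; rewrite (iter_polyop_ev h13) !evXn hecke13_chain_full. Qed.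

Lemma T13_X5 : T13 'X^5 = 0.
Proof.
by apply: ev_inj; rewrite ev0 (polyopE h13) evXn; case: hecke13_small.
Qed.

Lemma T7_X5 : T7 'X^5 = 0.
Proof. exact: (T7_zero h7 hecke7_D5). Qed.

(* Restricted to the indices m with alpha m = 0 the kernel of T7 injects into a
   space of dimension 2^n, which is the length of the T13-chain ending in D^5; so
   T13 acts on that kernel by a single nilpotent Jordan block. *)
Lemma socle P : in_W5 P -> T7 P = 0 -> T13 P = 0 -> exists c, P = c *: 'X^5.
Proof.
move=> hP P7 P13; pose n := size P; pose N := (2 ^ n)%N.
have N0 : (0 < N)%N by rewrite expn_gt0.
pose f j := iter j T13 'X^(1 + 4 ^ n.+1).
have fW j : in_W5 (f j) by apply: (iter_polyop_W5 h13) => //; apply: in_W5_D14.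
have f7 j : T7 (f j) = 0.
  rewrite /f -(iter_comm (f := T13)) => [|x]; last by rewrite T7_13_comm.
  by rewrite T7_D14 (iter_polyop0 h13).
have fN : f N.-1 = 'X^5 by rewrite -subn1; exact: T13_chain.
have f_big j : (N <= j)%N -> f j = 0.
  move=> Nj; have -> : j = (j - N + 1 + N.-1)%N by lia.
  by rewrite /f iterD -/(f _) fN iterD /= T13_X5 (iter_polyop0 h13).
have n4 : (n < 4 ^ n)%N by apply: ltn_expl.
have fS j : (size (f j) <= 4 ^ n.+1 + 2)%N.
  by have := iter_polyop_size h13 j 'X^(1 + 4 ^ n.+1); rewrite size_polyXn -/(f j); lia.
have PS : (size P <= 4 ^ n.+1 + 2)%N by rewrite -/n expnS; lia.
(* The indices with alpha equal to 0, one for each beta; those below 4^n have beta below 2^n, hence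
   [N] columns against [N + 1] vectors. *)
have [code codeE] := choice (fun b => digits_surj 0 b).
pose vec (Q : F2poly) : 'rV['F_2]_N := \row_b Q`_(6 * code b + 5).
pose A : 'M['F_2]_(N.+1, N) := \matrix_(i < N.+1) vec (if (i < N)%N then f i else P).
have vec0 Q : in_W5 Q -> T7 Q = 0 -> (size Q <= 4 ^ n.+1 + 2)%N -> vec Q = 0 -> Q = 0.
  move=> QW Q7 QS vQ; apply: (T7_inj_alpha QW Q7) => m am.
  case: (ltnP (6 * m + 5) (size Q)) => hm; last by rewrite nth_default.
  have m4 : (m < 4 ^ n)%N by move: QS hm; rewrite expnS; lia.
  have := congr1 (fun v : 'rV['F_2]_N => v 0 (Ordinal (beta_bound m4))) vQ.
  rewrite !mxE /=; have [ca cb] := codeE (beta m).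
  by rewrite (@digits_inj (code (beta m)) m) ?ca ?cb.
have [v v0 vA] : exists2 v : 'rV['F_2]_(N.+1), v != 0 & v *m A = 0.
  have : ~~ row_free A by rewrite /row_free; have := rank_leq_col A; lia.
  rewrite -kermx_eq0 => /rowV0Pn [v /sub_kermxP vA v0].
  by exists v.
pose g (i : 'I_N.+1) := if (i < N)%N then f i else P.
pose R := \sum_i v 0 i *: g i.
have gW i : in_W5 (g i) by rewrite /g; case: ifP.
have R0 : R = 0.
  apply: vec0.
  - by apply: in_W5_sum => i; apply: in_W5Z.
  - rewrite /R (polyop_sum h7) big1 // => i _; rewrite (polyopZ h7) /g.
    by case: ifP; rewrite ?f7 ?P7 scaler0.
  - apply: (leq_trans (size_sum _ _ _)); apply/bigmax_leqP => i _.
    by apply: (leq_trans (size_scale_leq _ _)); rewrite /g; case: ifP.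
  - rewrite -vA; apply/rowP => b; rewrite !mxE coef_sum; apply: eq_bigr => i _.
    by rewrite !mxE coefZ.
(* A positive power of [T13] removes [P]. With k = N - 1 - j it moves [f j] to ['X^5] and kills all
   later members, so the coefficients before the last one vanish in turn. *)
have apply_iter k : (0 < k)%N -> \sum_(i < N) v 0 (widen_ord (leqnSn N) i) *: f (k + i)%N = 0.
  move=> k0; have := congr1 (iter k T13) R0.
  rewrite (iter_polyop0 h13) /R (iter_polyop_sum h13) big_ord_recr /=.
  rewrite (iter_polyopZ h13) /g /= ltnn.
  have -> : iter k T13 P = 0.
    by rewrite -(prednK k0) iterSr P13 (iter_polyop0 h13).
  rewrite scaler0 addr0 => h; rewrite -[RHS]h; apply: eq_bigr => i _.
  by rewrite (iter_polyopZ h13) /= ltn_ord /f -iterD.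
have vz j (jN : (j < N.-1)%N) : v 0 (inord j) = 0.
  elim/ltn_ind: j jN => j IH jN.
  have := @apply_iter (N.-1 - j)%N; rewrite subn_gt0 jN => /(_ isT).
  have jN' : (j < N)%N by lia.
  rewrite (bigD1 (Ordinal jN')) //= big1 ?addr0 => [|i /eqP ij].
    rewrite subnK; last by lia.
    rewrite fN => /(congr1 (fun Q : F2poly => Q`_5)).
    rewrite coefZ coefXn eqxx mulr1 coef0 => h.
    rewrite -[RHS]h; congr (v 0 _); apply: val_inj => /=.
    by rewrite inordK //; lia.
  case: (ltngtP i j) => lij.
  - have -> : widen_ord (leqnSn N) i = inord i by apply: val_inj => /=; rewrite inordK //; have := ltn_ord i; lia.
    by rewrite IH ?scale0r //; lia.
  - by rewrite f_big ?scaler0 //; lia.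
  - by case: ij; apply: val_inj.
have R1 : v 0 (inord N.-1) *: 'X^5 + v 0 (inord N) *: P = 0.
  rewrite -R0 /R (bigD1 (inord N)) //= (bigD1 (inord N.-1)) /=; last first.
    apply/eqP => /(congr1 val) /=; rewrite !inordK //; lia.
  rewrite big1 ?addr0 => [|i /andP [/eqP i1 /eqP i2]].
    rewrite addrC /g !inordK //; last by lia.
    by rewrite ltnn ifT ?fN //; lia.
  have iN : (i < N.-1)%N.
    have i1' : (i : nat) <> N by move=> h; apply: i1; apply: val_inj; rewrite /= inordK.
    have i2' : (i : nat) <> N.-1 by move=> h; apply: i2; apply: val_inj; rewrite /= inordK; lia.
    by have := ltn_ord i; lia.
  have -> : i = inord i by apply: val_inj; rewrite /= inordK.
  by rewrite vz // scale0r.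
case: (F2_cases (v 0 (inord N))) => vN; last first.
  exists (v 0 (inord N.-1)); move: R1; rewrite vN scale1r => R1.
  by rewrite -[P]add0r -R1 -addrA F2poly_addxx addr0.
case/eqP: v0; apply/rowP => i; rewrite mxE.
have v1 : v 0 (inord N.-1) = 0.
  have := congr1 (fun Q : F2poly => Q`_5) R1.
  by rewrite vN scale0r addr0 coefZ coefXn eqxx mulr1 coef0.
have -> : i = inord i by apply: val_inj; rewrite /= inordK.
case: (ltngtP i N.-1) => h; first by rewrite vz.
  by have -> : (i : nat) = N by have := ltn_ord i; lia.
by rewrite h.
Qed.
End Socle.

(** * Operators as power series in T_7 and T_13 *)

Lemma strong_rec (F : nat -> (nat -> 'F_2) -> 'F_2) :
  (forall k u u', (forall l, (l < k)%N -> u l = u' l) -> F k u = F k u') ->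
  exists mu : nat -> 'F_2, forall k, mu k = F k mu.
Proof.
move=> ext; pose st := fix st n := if n is n'.+1 then rcons (st n') (F n' (nth 0 (st n'))) else [::].
have sz n : size (st n) = n by elim: n => //= n IH; rewrite size_rcons IH.
pose mu k := nth 0 (st k.+1) k.
have stE n k : (k < n)%N -> nth 0 (st n) k = mu k.
  elim: n => // n IH kn; rewrite /= nth_rcons sz; case: (ltngtP k n) => h.
  - exact: IH.
  - by lia.
  - by rewrite /mu /= nth_rcons sz h ltnn eqxx.
exists mu => k; rewrite {1}/mu /= nth_rcons sz ltnn eqxx.
by apply: ext => l lk; rewrite stE.
Qed.

(* A functional vanishing on the common zeros of a sequence g of functionals is an
   infinite combination of the g k, which is locally finite: mu k is forced as soon
   as some x has g k x as its last nonzero value. *)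
Lemma functional_extension (V : zmodType) (U : V -> Prop) (psi : V -> 'F_2)
  (g : nat -> V -> 'F_2) :
  (forall x y, U x -> U y -> U (x + y)) ->
  (forall x y, psi (x + y) = psi x + psi y) ->
  (forall k x y, g k (x + y) = g k x + g k y) ->
  (forall x, U x -> (forall k, g k x = 0) -> psi x = 0) ->
  exists mu : nat -> 'F_2, forall x n, U x -> (forall k, (n <= k)%N -> g k x = 0) ->
    psi x = \sum_(k < n) mu k * g k x.
Proof.
move=> UD psiD gD inj.
pose S k x := [/\ U x, g k x = 1 & forall l, (k < l)%N -> g l x = 0].
have [q hq] : exists q : nat -> V, forall k, (exists x, S k x) -> S k (q k).
  have /choice [q hq] : forall k, exists y, (exists x, S k x) -> S k y.
    by move=> k; case: (pselect (exists x, S k x)) => [[x Sx]|n]; [exists x|exists 0].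
  by exists q.
have [mu muE] := @strong_rec (fun k u => psi (q k) + \sum_(l < k) u l * g l (q k))
  (fun k u u' h => congr1 (fun s => psi (q k) + s)
    (eq_bigr (fun l : 'I_k => u' l * g l (q k))
      (fun l _ => congr1 (fun c => c * g l (q k)) (h l (ltn_ord l))))).
exists mu => x n; elim: n x => [|n IH] x Ux gx.
  by rewrite big_ord0; apply: inj => // k; apply: gx.
rewrite big_ord_recr /=; case: (F2_cases (g n x)) => gn; rewrite gn.
  rewrite mulr0 addr0; apply: IH => // k; rewrite leq_eqVlt => /orP [/eqP <- //|].
  exact: gx.
have [Uq gq gq0] : S n (q n) by apply: hq; exists x; split.
have := IH (x + q n) (UD _ _ Ux Uq) _; rewrite psiD => e.
have {}e : psi x + psi (q n) = \sum_(k < n) mu k * g k (x + q n).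
  apply: e => k; rewrite leq_eqVlt gD => /orP [/eqP <-|nk].
    by rewrite gn gq F2_addxx.
  by rewrite gx // gq0 // addr0.
rewrite mulr1 muE addrC -addrA -big_split /=.
rewrite (eq_bigr (fun k : 'I_n => mu k * g k (x + q n))) => [|k _]; last first.
  by rewrite gD mulrDr addrC.
by rewrite -e addrCA F2_addxx addr0.
Qed.

Lemma sum_support (I : eqType) (s1 s2 : seq I) (h : I -> 'F_2) :
  uniq s1 -> uniq s2 -> (forall x, h x != 0 -> (x \in s1) = (x \in s2)) ->
  \sum_(x <- s1) h x = \sum_(x <- s2) h x.
Proof.
move=> u1 u2 e.
have red (s : seq I) : \sum_(x <- s) h x = \sum_(x <- [seq x <- s | h x != 0]) h x.
  rewrite big_filter [RHS]big_mkcond; apply: eq_bigr => x _.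
  by case: eqVneq => // ->.
rewrite (red s1) (red s2); apply: perm_big; apply: uniq_perm; rewrite ?filter_uniq //.
by move=> x; rewrite !mem_filter; case: (boolP (h x != 0)) => //= /e.
Qed.

Section PowerSeriesAction.
Variables T5 T7 T13 : F2poly -> F2poly.
Hypothesis h5 : polyop 5 T5.
Hypothesis h7 : polyop 7 T7.
Hypothesis h13 : polyop 13 T13.

Definition act i j P := iter i T7 (iter j T13 P).
Definition coord (x : nat * nat) P : 'F_2 := (act x.1 x.2 P)`_5.
Definition psi P : 'F_2 := (T5 (T5 P))`_5.

Lemma actD i j P Q : act i j (P + Q) = act i j P + act i j Q.
Proof. by rewrite /act (iter_polyopD h13) (iter_polyopD h7). Qed.

Lemma act_sum i j (I : Type) (s : seq I) (G : I -> F2poly) :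
  act i j (\sum_(k <- s) G k) = \sum_(k <- s) act i j (G k).
Proof. by rewrite /act (iter_polyop_sum h13) (iter_polyop_sum h7). Qed.

Lemma actZ i j c P : act i j (c *: P) = c *: act i j P.
Proof. by rewrite /act (iter_polyopZ h13) (iter_polyopZ h7). Qed.

Lemma coordD x P Q : coord x (P + Q) = coord x P + coord x Q.
Proof. by rewrite /coord actD coefD. Qed.

Lemma psiD P Q : psi (P + Q) = psi P + psi Q.
Proof. by rewrite /psi !(polyopD h5) coefD. Qed.

Lemma act_W5 i j P : in_W5 P -> in_W5 (act i j P).
Proof.
by move=> h; apply: (iter_polyop_W5 h7) => //; apply: (iter_polyop_W5 h13).
Qed.

Lemma act_size i j P : (size (act i j P) <= size P - (i + j))%N.
Proof.
have := iter_polyop_size h7 i (iter j T13 P); have := iter_polyop_size h13 j P.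
by rewrite /act; lia.
Qed.

Lemma act_zero i j P N : (size P <= N)%N -> (N <= i)%N || (N <= j)%N -> act i j P = 0.
Proof.
move=> PN h; apply/eqP; rewrite -size_poly_eq0; have := act_size i j P; lia.
Qed.

Lemma T13_act i j P : T13 (act i j P) = act i j.+1 P.
Proof.
rewrite /act iterS [RHS](iter_comm (f := T7)) // => x.
exact: T7_13_comm h7 h13 x.
Qed.

Lemma act_act a b i j P : act a b (act i j P) = act (a + i) (b + j) P.
Proof.
elim: b => [|b IH].
  by rewrite /act /= iterD.
have -> : act a b.+1 (act i j P) = T13 (act a b (act i j P)) by rewrite T13_act.
by rewrite IH T13_act.
Qed.

Lemma T5_act i j P : T5 (act i j P) = act i j (T5 P).
Proof.
have c7 x : T7 (T5 x) = T5 (T7 x).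
  exact: (polyop_comm _ (isT : prime 7) (isT : prime 5) isT h7 h5).
have c13 x : T13 (T5 x) = T5 (T13 x).
  exact: (polyop_comm _ (isT : prime 13) (isT : prime 5) isT h13 h5).
by rewrite /act (iter_comm _ _ c13) (iter_comm _ _ c7).
Qed.

Lemma T5_sqr_W5 P : in_W5 P -> in_W5 (T5 (T5 P)).
Proof.
move=> hP e nz; have [i [nzi _ ei]] := polyop_coef_ne0 h5 nz.
have [j [Pj _ ij]] := polyop_coef_ne0 h5 nzi; have := hP _ Pj.
move: ei; rewrite -modnMmr ij modnMmr mulnA => ej j5.
have : (e %% 6 = (5 * 5 * j) %% 6)%N.
  by rewrite -(modn_dvdm e (isT : 6 %| 24)%N) ej modn_dvdm.
by lia.
Qed.

(** By induction on the degree [T7 P] and [T13 P] are 0, since their coordinates are among those of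
    P. Then [socle] leaves a multiple of D^5, which the coordinate (0, 0) detects. *)
Lemma coord_inj P : in_W5 P -> (forall x, coord x P = 0) -> P = 0.
Proof.
have [n] := ubnP (size P); elim: n P => // n IH P Pn hP hc.
case: (eqVneq P 0) => // P0; have sP : (0 < size P)%N by rewrite size_poly_gt0.
have P7 : T7 P = 0.
  apply: IH; [by have := polyop_size h7 P; lia|exact: polyop_W5 h7 _ _ hP|].
  move=> [i j]; rewrite /coord /= -[T7 P]/(act 1 0 P) act_act.
  exact: (hc (i + 1, j + 0)%N).
have P13 : T13 P = 0.
  apply: IH; [by have := polyop_size h13 P; lia|exact: polyop_W5 h13 _ _ hP|].
  move=> [i j]; rewrite /coord /= -[T13 P]/(act 0 1 P) act_act.
  exact: (hc (i + 0, j + 1)%N).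
have [c Pc] := socle h7 h13 hP P7 P13.
have := hc (0, 0)%N; rewrite /coord /act /= Pc coefZ coefXn eqxx mulr1 => ->.
by rewrite scale0r.
Qed.

Definition both_even (x : nat * nat) := ~~ odd x.1 && ~~ odd x.2.

Lemma odd_pow_mod i j : (7 ^ i * 13 ^ j %% 24 =
  if odd i then (if odd j then 19 else 7) else (if odd j then 13 else 1))%N.
Proof.
have p7 k : (7 ^ k %% 24 = if odd k then 7 else 1)%N.
  by elim: k => // k IH; rewrite expnS -modnMmr IH /=; case: (odd k).
have p13 k : (13 ^ k %% 24 = if odd k then 13 else 1)%N.
  by elim: k => // k IH; rewrite expnS -modnMmr IH /=; case: (odd k).
by rewrite -modnMml -modnMmr p7 p13; case: (odd i); case: (odd j).
Qed.

Lemma odd_pow_mod5 i j r : (r %% 24 = 5 -> (7 ^ i * (13 ^ j * r) = 5 %[mod 24] ->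
   both_even (i, j)))%N.
Proof.
move=> r5; rewrite mulnA -modnMml odd_pow_mod -modnMmr r5 /both_even /=.
by case: (odd i); case: (odd j).
Qed.

Lemma even_pow_mod i j r : both_even (i, j) -> (7 ^ i * (13 ^ j * r) = r %[mod 24])%N.
Proof.
move=> /andP [/= /negbTE ei /negbTE ej].
by rewrite mulnA -modnMml odd_pow_mod ei ej mul1n.
Qed.

(* T_p multiplies degrees by p in the grading of polynomials by the exponent modulo
   24; this is the component of degree 5. *)
Definition part5 P : F2poly := \poly_(e < size P) (if (e %% 24 == 5)%N then P`_e else 0).

Lemma coef_part5 P e : (part5 P)`_e = if (e %% 24 == 5)%N then P`_e else 0.
Proof.
rewrite coef_poly; case: ltnP => // h; case: ifP => // _.
by rewrite nth_default.
Qed.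

Lemma part5_W5 P : in_W5 (part5 P).
Proof.
move=> e; rewrite coef_part5; case: ifP => [/eqP h _|_]; last by rewrite eqxx.
by rewrite -(modn_dvdm e (isT : 6 %| 24)%N) h.
Qed.

Lemma part5_mod24 P e : (part5 P)`_e != 0 -> (e %% 24 = 5)%N.
Proof. by rewrite coef_part5; case: ifP => [/eqP|_]; rewrite ?eqxx. Qed.

Lemma iter_coef_ne0 p T n P e : polyop p T -> (iter n T P)`_e != 0 ->
  exists2 i, P`_i != 0 & (e = p ^ n * i %[mod 24])%N.
Proof.
move=> hT; elim: n e => [|n IH] e nz; first by exists e; rewrite ?mul1n.
have [j [/IH [i Pi ji] _ ej]] := polyop_coef_ne0 hT nz.
by exists i; rewrite // ej -modnMmr ji modnMmr mulnA -expnS.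
Qed.

Lemma act_coef_ne0 i j P e : (act i j P)`_e != 0 ->
  exists2 k, P`_k != 0 & (e = 7 ^ i * (13 ^ j * k) %[mod 24])%N.
Proof.
move=> /(iter_coef_ne0 h7) [k /(iter_coef_ne0 h13) [l Pl kl] ek].
by exists l; rewrite // ek -modnMmr kl modnMmr.
Qed.

Lemma not5_part5 P k : (P + part5 P)`_k != 0 -> (k %% 24 != 5)%N.
Proof.
by rewrite coefD coef_part5; case: ifP => // _; rewrite F2_addxx eqxx.
Qed.

Lemma F2_add_eq0 (c d : 'F_2) : c + d = 0 -> c = d.
Proof. by move=> h; rewrite -[c]addr0 -(F2_addxx d) addrA h add0r. Qed.

Lemma coord_part5 x P : both_even x -> coord x P = coord x (part5 P).
Proof.
case: x => i j hx; apply: F2_add_eq0; rewrite -coordD; apply/eqP.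
apply: contrapT => /negP /act_coef_ne0 [k /not5_part5 /eqP k5].
by rewrite even_pow_mod // => h; apply: k5.
Qed.

Lemma psi_part5 P : psi P = psi (part5 P).
Proof.
apply: F2_add_eq0; rewrite -psiD; apply/eqP; apply: contrapT => /negP.
move=> /(@iter_coef_ne0 5 T5 2 (P + part5 P) 5 h5) [k /not5_part5 /eqP k5].
by rewrite -modnMml mul1n => h; apply: k5.
Qed.

(** The coordinates of even bidegree, arranged in one sequence as [functional_extension]
    requires. *)
Definition gcoord (k : nat) P : 'F_2 :=
  if pickle_inv k is Some x then (if both_even x then coord x P else 0) else 0.

(** Both [psi] and the even coordinates see only exponents congruent to 5 modulo 24. On that
    component the remaining coordinates vanish by the grading, so the even ones already separate
    points. *)
Lemma gcoord_inj P : in_W5 P -> (forall k, gcoord k P = 0) -> psi P = 0.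
Proof.
move=> hP hg; rewrite psi_part5.
suff -> : part5 P = 0 by rewrite /psi !(polyop0 h5) coef0.
apply: coord_inj; first exact: part5_W5.
move=> x; case: (boolP (both_even x)) => [ex|nx].
  by rewrite -coord_part5 //; have := hg (pickle x); rewrite /gcoord pickleK_inv ex.
apply/eqP; apply: contraNT nx; case: x => i j /act_coef_ne0 [k /part5_mod24 k5 e].
exact: (@odd_pow_mod5 i j k k5 (esym e)).
Qed.

Lemma sum_pmap (I : Type) (s : seq nat) (f : nat -> option I) (h : I -> 'F_2) :
  \sum_(x <- pmap f s) h x = \sum_(k <- s) (if f k is Some x then h x else 0).
Proof.
elim: s => [|k s IH]; first by rewrite !big_nil.
rewrite /= big_cons -IH; case: (f k) => [x|] /=; first by rewrite big_cons.
by rewrite add0r.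
Qed.

Lemma psi_expansion : exists u : nat * nat -> 'F_2, forall P N, in_W5 P -> (size P <= N)%N ->
  psi P = \sum_(i < N) \sum_(j < N)
    (if both_even (i : nat, j : nat) then u (i : nat, j : nat) else 0) * coord (i : nat, j : nat) P.
Proof.
have gD k P Q : gcoord k (P + Q) = gcoord k P + gcoord k Q.
  by rewrite /gcoord; case: pickle_inv => [x|]; rewrite ?addr0 //; case: ifP; rewrite ?coordD ?addr0.
have [mu hmu] := functional_extension (U := in_W5) in_W5D psiD gD gcoord_inj.
exists (fun x => mu (pickle x)) => P N hP PN.
pose H (x : nat * nat) := (if both_even x then mu (pickle x) else 0) * coord x P.
pose bx := [seq (i, j) | i <- iota 0 N, j <- iota 0 N].
have bx_uniq : uniq bx by rewrite allpairs_uniq ?iota_uniq // => -[a b] [c d] _ _ [-> ->].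
have out x : coord x P != 0 -> x \in bx.
  case: x => i j nz; apply/allpairsP; exists (i, j); rewrite !mem_iota /= !add0n.
  have [iN jN] : (i < N /\ j < N)%N.
    apply/andP; apply: contraNT nz; rewrite negb_and -!leqNgt => h.
    by rewrite /coord (act_zero PN h) coef0.
  by split.
pose n := (\max_(x <- bx) pickle x).+1.
have pn x : x \in bx -> (pickle x < n)%N by move=> xb; rewrite ltnS leq_bigmax_seq.
rewrite (hmu P n hP) => [|k nk]; last first.
  rewrite /gcoord; case e : (pickle_inv k) => [x|] //; case: ifP => // _.
  apply/eqP; apply: contraTT nk => /out /pn; rewrite -ltnNge.
  by have := @pickle_invK (nat * nat)%type k; rewrite e /= => ->.
transitivity (\sum_(x <- pmap (@pickle_inv (nat * nat)%type) (iota 0 n)) H x).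
  rewrite sum_pmap -(big_mkord xpredT (fun k => mu k * gcoord k P)) /index_iota subn0.
  apply: eq_bigr => k _; rewrite /gcoord /H; have := @pickle_invK (nat * nat)%type k.
  case: (pickle_inv k) => [x /= ->|_]; last by rewrite mulr0.
  by case: ifP; rewrite ?mul0r ?mulr0.
transitivity (\sum_(x <- bx) H x).
  apply: sum_support => //.
    by rewrite (pmap_uniq (@pickle_invK _)) ?iota_uniq.
  move=> x Hx; have cx : coord x P != 0 by apply: contraNneq Hx => c0; rewrite /H c0 mulr0.
  rewrite (out x cx) mem_pmap; apply/mapP; exists (pickle x); last by rewrite pickleK_inv.
  by rewrite mem_iota add0n pn ?out.
rewrite /bx big_allpairs_dep /= -[in RHS](big_mkord xpredT (fun i : nat => \sum_(j < N) H (i, j : nat))) /=.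
rewrite /index_iota subn0; apply: eq_bigr => i _.
by rewrite -(big_mkord xpredT (fun j : nat => H (i, j))) /index_iota subn0.
Qed.

Lemma F2XY_sqrE (u : F2XY) i j :
  (u ^+ 2) i j = if both_even (i, j) then u i./2 j./2 else 0.
Proof.
rewrite expr2 coefpsM (@sum_sym _ F2ps_addxx i (fun a b => u a * u b)).
  rewrite /both_even -[(i, j).1]/i -[(i, j).2]/j; case: (odd i); first by [].
  by rewrite -expr2 F2ps_sqrE /= dvdn2 divn2; case: (odd j).
by move=> a b; rewrite mulrC.
Qed.

Lemma coord_X5 i j : coord (i, j) 'X^5 = ((i == 0%N) && (j == 0%N))%:R.
Proof.
rewrite /coord /act /=; case: j => [|j].
  case: i => [|i]; first by rewrite /= coefXn.
  by rewrite iterSr (T7_X5 h7) (iter_polyop0 h7) coef0.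
by rewrite iterSr (T13_X5 h13) (iter_polyop0 h13) (iter_polyop0 h7) coef0 andbF.
Qed.

Lemma psi_X5 : psi 'X^5 = 0.
Proof.
rewrite /psi; have -> : T5 'X^5 = 'X^1.
  by apply: ev_inj; rewrite (polyopE h5) !evXn hecke5_D5 expr1.
have -> : T5 ('X^1) = 0 by apply: ev_inj; rewrite ev0 (polyopE h5) evXn hecke_D1.
by rewrite coef0.
Qed.

Lemma lambda_exists : exists lam : F2XY, lam 0%N 0%N = 0 /\
  forall P N, in_W5 P -> (size P <= N)%N ->
    T5 (T5 P) = \sum_(i < N) \sum_(j < N) (lam ^+ 2) i j *: act i j P.
Proof.
have [u hu] := psi_expansion.
(* The square root of a series in X^2 and Y^2: exponents are halved and coefficients kept. *)
pose lam : F2XY := Pser (fun i => Pser (fun j => u (2 * i, 2 * j)%N)).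
have lam2 i j : (lam ^+ 2) i j = if both_even (i, j) then u (i, j) else 0.
  rewrite F2XY_sqrE; case: ifP => // /andP [/= ei ej].
  by rewrite !mul2n !even_halfK.
exists lam; split.
  (* On D^5 all coordinates but (0, 0) vanish, so [psi] reads off the constant term there. *)
  have := hu 'X^5 6%N (@in_W5Xn 5 erefl); rewrite size_polyXn => /(_ isT).
  rewrite psi_X5 (bigD1 ord0) //= (bigD1 ord0) //= !big1.
  - by rewrite coord_X5 mulr1 !addr0 => <-.
  - by move=> i i0; rewrite big1 // => j _; rewrite coord_X5 (_ : (i : nat) == 0%N = false) ?mulr0 //; apply/negbTE.
  - by move=> j j0; rewrite coord_X5 (_ : (j : nat) == 0%N = false) ?mulr0 //; apply/negbTE.
move=> P N hP PN; apply/eqP; rewrite -subr_eq0; apply/eqP.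
set R := \sum_(i < N) _.
have -> : T5 (T5 P) - R = T5 (T5 P) + R.
  by congr (_ + _); rewrite -[LHS]addr0 -(F2poly_addxx R) addrA addNr add0r.
apply: coord_inj.
  apply: in_W5D; first exact: T5_sqr_W5.
  by apply: in_W5_sum => i; apply: in_W5_sum => j; apply: in_W5Z; apply: act_W5.
move=> [a b]; rewrite coordD.
(* As T_5 commutes with T_7 and T_13, every coordinate of T_5^2 P is [psi] at another element of W5,
   so the expansion of this one functional determines the operator. *)
have -> : coord (a, b) (T5 (T5 P)) = psi (act a b P) by rewrite /coord /psi !T5_act.
have sQ : (size (act a b P) <= N)%N by have := act_size a b P; lia.
rewrite (hu _ N (@act_W5 a b P hP) sQ).
have -> : coord (a, b) R = \sum_(i < N) \sum_(j < N)
    (if both_even (i : nat, j : nat) then u (i : nat, j : nat) else 0)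
      * coord (i : nat, j : nat) (act a b P).
  rewrite /coord /R act_sum coef_sum; apply: eq_bigr => i _.
  rewrite act_sum coef_sum; apply: eq_bigr => j _.
  by rewrite actZ coefZ lam2 !act_act /= [(i + a)%N]addnC [(j + b)%N]addnC.
exact: F2_addxx.
Qed.

End PowerSeriesAction.

(** * Return to series in x *)

Lemma in_maxidealP (lam : F2XY) : lam 0%N 0%N = 0 -> in_maxideal lam.
Proof.
move=> l0; exists (Pser (fun i => lam i.+1)).
exists (Pser (fun i => if i is 0 then Pser (fun j => lam 0%N j.+1) else 0)).
apply: pserP => i; rewrite coefpsD /varX /varY coefps_varM.
rewrite ps_constM coefpsZ.
case: i => [|i]; last by rewrite mulr0 addr0.
rewrite add0r; apply: pserP => j; rewrite coefps_varM.
by case: j.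
Qed.

Lemma W5_lift f : W 5 f -> exists2 P, in_W5 P & f = ev P.
Proof.
move=> [s [c [hs ->]]]; exists (\sum_(k <- s) c k *: 'X^k).
  rewrite big_seq; elim/big_rec: _ => [|k P ks hP].
    by move=> e; rewrite coef0 eqxx.
  by apply: in_W5D => //; apply: in_W5Z; apply: in_W5Xn; have [_ ->] := hs k ks.
by rewrite ev_sum; apply: eq_bigr => k _; rewrite evZ evXn.
Qed.

Theorem theorem4p18 :
  exists lam : F2XY,
    in_maxideal lam
    /\ (forall f : pser 'F_2, W 5 f ->
          is_action (lam ^+ 2) f (hecke 5 (hecke 5 f))).
Proof.
have [T5 h5] := polyop_exists lift5.
have [T7 h7] := polyop_exists lift7.
have [T13 h13] := polyop_exists lift13.
have [lam [l0 hl]] := lambda_exists h5 h7 h13.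
exists lam; split; first exact: in_maxidealP.
move=> f /W5_lift [P hP ->]; exists (size P).
have evact i j : iter i (hecke 7) (iter j (hecke 13) (ev P)) = ev (act T7 T13 i j P).
  by rewrite /act (iter_polyop_ev h7) (iter_polyop_ev h13).
split=> [i j h|]; first by rewrite evact (act_zero h7 h13 (leqnn _) h) ev0.
rewrite -!(polyopE h5) (hl P (size P) hP (leqnn _)) ev_sum; apply: eq_bigr => i _.
by rewrite ev_sum; apply: eq_bigr => j _; rewrite evZ evact.
Qed.
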